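(* Let $n\ge 1$ and $k\ge 0$ be integers with $2^k<n$, and set $d=\nu_2\big(\big\lfloor \frac{n}{2^k}\big\rfloor\big)$. Let $\lambda$ be an odd partition of $n-2^k$. Then $$e(\lambda,2^k)=\begin{cases}2^k & \text{if } d=0;\\ 2 & \text{if } d>0 \text{ and the } k\text{th row } \mathcal{Q}_2^{(k)}(\lambda) \text{ of the 2-quotient tower of } \lambda \text{ contains a } d\text{-good partition};\\ 0 & \text{otherwise.}\end{cases}$$
   Context: A partition $\lambda$ of $n$ is odd if the irreducible complex character $\chi^\lambda$ of $\mathfrak{S}_n$ has odd degree; the empty partition is considered odd. $\nu_2(a)$ is the exponent of the highest power of $2$ dividing the positive integer $a$. The map $f_k^n$ ($2^k<n$): for an odd partition $\mu$ of $n$ there is exactly one $2^k$-hook of $\mu$ whose removal leaves an odd partition of $n-2^k$ (known result), and $f_k^n(\mu)$ is that partition. (Equivalently $\chi^{f_k^n(\mu)}$ is the unique odd-degree irreducible constituent of the restriction of $\chi^\mu$ to $\mathfrak{S}_{n-2^k}$ appearing with odd multiplicity.) For an odd partition $\lambda$ of $n-2^k$, $e(\lambda,2^k)$ is the number of odd partitions $\mu$ of $n$ with $f_k^n(\mu)=\lambda$. $C_e(\lambda)$ is the $e$-core of $\lambda$ (obtained by successively removing $e$-hooks until none is left). The $2$-quotient $Q_2(\lambda)=(\lambda_0,\lambda_1)$ is the usual one: take a $\beta$-set $X=\{\lambda_i+s-i: 1\le i\le s\}$ of $\lambda$ (parts padded by zeros) with $s$ even; $\lambda_j$ is the partition with $\beta$-set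 $\{x: 2x+j\in X\}$, $j=0,1$. The $2$-quotient tower has rows $\mathcal{Q}_2^{(k)}(\lambda)=(\lambda^{(k)}_0,\dots,\lambda^{(k)}_{2^k-1})$, $k\ge0$, given by $\lambda_0^{(0)}=\lambda$ and $Q_2(\lambda_i^{(k)})=(\lambda^{(k+1)}_{2i},\lambda^{(k+1)}_{2i+1})$. For $d\ge0$, an odd partition $\lambda$ is $d$-good if (i) $|\lambda|\equiv 2^d-1 \pmod{2^{d+1}}$ and (ii) $C_{2^d}(\lambda)$ is a hook partition, i.e. of the form $(a,1^b)$, where the empty partition also counts as a hook partition. *)

(* Defs.v *)
From HB Require Import structures.
From mathcomp Require Import all_boot all_order all_algebra.
From mathcomp Require Import all_fingroup all_solvable all_field all_character.

Set Implicit Arguments.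
Unset Strict Implicit.
Unset Printing Implicit Defensive.

Import GRing.Theory.

(* Partitions are weakly decreasing sequences of positive parts; rows and
   columns of Young diagrams are numbered from 0. *)

Definition is_part (la : seq nat) : bool := sorted geq la && (0 \notin la).

Definition is_part_of (n : nat) (la : seq nat) : bool :=
  is_part la && (sumn la == n).

Record intpart (n : nat) := IntPart {
  part_val :> seq nat;
  part_valP : is_part_of n part_val }.

HB.instance Definition _ n := [isSub for @part_val n].
HB.instance Definition _ n := [Countable of intpart n by <:].

(* A partition of n is determined by its first n entries, padded with zeros;
   this makes [intpart n] a finite type. *)
Definition part_pad n (la : intpart n) : {ffun 'I_n -> 'I_n.+1} :=
  [ffun i : 'I_n => inord (nth 0 la i)].

Definition part_unpad n (f : {ffun 'I_n -> 'I_n.+1}) : option (intpart n) :=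
  insub [seq x <- [seq val (f i) | i <- enum 'I_n] | 0 < x].

Lemma size_part_leq (la : seq nat) : 0 \notin la -> size la <= sumn la.
Proof.
elim: la => //= x la IH; rewrite inE negb_or => /andP[x_neq0 /IH le_la].
by rewrite -add1n leq_add // lt0n eq_sym.
Qed.

Lemma nth_leq_sumn (la : seq nat) i : nth 0 la i <= sumn la.
Proof.
elim: la i => [|x la IH] [|i] //=; first exact: leq_addr.
exact: leq_trans (IH i) (leq_addl _ _).
Qed.

Lemma part_padK n : pcancel (@part_pad n) (@part_unpad n).
Proof.
move=> [la Pla]; case/andP: (Pla) => /andP[_ la0] /eqP sum_la.
have le_n : size la <= n by rewrite -sum_la size_part_leq.
rewrite /part_unpad; set s := filter _ _.
have -> : s = la.
  rewrite /s (eq_map (g := nth 0 la \o val)); last first.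
    by move=> i /=; rewrite ffunE /= inordK // ltnS; have:= nth_leq_sumn la i; rewrite sum_la.
  rewrite map_comp val_enum_ord -(subnKC le_n) iotaD map_cat filter_cat add0n.
  rewrite -/(mkseq _ _) mkseq_nth.
  rewrite (all_filterP _); last first.
    by apply/allP=> x x_la; rewrite lt0n; apply: contraNneq la0 => <-.
  rewrite (eq_in_filter (a2 := pred0)) ?filter_pred0 ?cats0 // => x.
  by case/mapP=> i; rewrite mem_iota => /andP[le_i _] ->; rewrite nth_default.
by rewrite (insubT (is_part_of n) Pla).
Qed.

HB.instance Definition _ n : isFinite (intpart n) := PCanIsFinite (@part_padK n).

Definition conj_part (la : seq nat) : seq nat :=
  [seq count (fun r => j < r) la | j <- iota 0 (head 0 la)].

Definition cells (la : seq nat) : seq (nat * nat) :=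
  [seq (i, j) | i <- iota 0 (size la), j <- iota 0 (nth 0 la i)].

Definition arm (la : seq nat) (c : nat * nat) : nat :=
  (nth 0 la c.1 - c.2).-1.

Definition leg (la : seq nat) (c : nat * nat) : nat :=
  (nth 0 (conj_part la) c.2 - c.1).-1.

Definition hook_length (la : seq nat) (c : nat * nat) : nat :=
  (arm la c + leg la c).+1.

Definition hooks (e : nat) (la : seq nat) : seq (nat * nat) :=
  [seq c <- cells la | hook_length la c == e].

(* Removing the hook at c = (i, j) deletes the boundary strip joining the end
   of the arm to the end of the leg: each of the rows i, ..., i + leg - 1
   becomes the next row minus one cell, and row i + leg keeps only its j cells
   to the left of the hook. *)
Definition remove_hook (la : seq nat) (c : nat * nat) : seq nat :=
  let l := leg la c in
  [seq x <- mkseq (fun r => if c.1 <= r < c.1 + l then (nth 0 la r.+1).-1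
                            else if r == c.1 + l then c.2
                            else nth 0 la r) (size la)
          | 0 < x].

Definition remove_first_hook (e : nat) (la : seq nat) : seq nat :=
  if hooks e la is c :: _ then remove_hook la c else la.

(* [sumn la] steps suffice, as every removal decreases the size by e > 0. *)
Definition core (e : nat) (la : seq nat) : seq nat :=
  iter (sumn la) (remove_first_hook e) la.

(* For a partition la this says la = (a, 1^b) or la = [::]. *)
Definition is_hook_part (la : seq nat) : bool := all (pred1 1) (behead la).

(* The least even number of beads that is at least the number of parts. *)
Definition even_size (la : seq nat) : nat := size la + odd (size la).

(* With 0-based rows, the bead of row i is la_i + s - (i + 1). *)
Definition beta_set (la : seq nat) : seq nat :=
  let s := even_size la in mkseq (fun i => nth 0 la i + (s - i.+1)) s.

(* The partition whose beta-set is the (strictly decreasing) sequence X. *)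
Definition part_of_beta (X : seq nat) : seq nat :=
  [seq x <- mkseq (fun i => nth 0 X i - (size X - i.+1)) (size X) | 0 < x].

Definition quotient2 (j : bool) (la : seq nat) : seq nat :=
  part_of_beta [seq x./2 | x <- beta_set la & odd x == j].

Fixpoint quotient_row (k : nat) (la : seq nat) : seq (seq nat) :=
  if k is k'.+1 then
    flatten [seq [:: quotient2 false mu; quotient2 true mu]
            | mu <- quotient_row k' la]
  else [:: la].

(* [reshape_index la x] is the row containing x when 0, 1, 2, ... are written
   into the diagram of la row by row. *)
Definition young_set (n : nat) (la : seq nat) : {set 'S_n} :=
  [set g : 'S_n | [forall x : 'I_n,
                     reshape_index la (g x) == reshape_index la x]].

Lemma young_group_set n la : group_set (young_set n la).
Proof.
apply/group_setP; split=> [|g h].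
  by rewrite inE; apply/forallP => x; rewrite perm1.
rewrite !inE => /forallP gP /forallP hP; apply/forallP => x.
by rewrite permM (eqP (hP _)).
Qed.

Canonical young n la : {group 'S_n} := Group (young_group_set n la).

Section SignCharacter.
Local Open Scope ring_scope.

Lemma sign_is_class_fun n (G : {group 'S_n}) :
  is_class_fun <<G>>%g
    [ffun g : 'S_n => if g \in G then (-1) ^+ odd_perm g else 0 : algC].
Proof.
rewrite genGid; apply: intro_class_fun => [g h Gg Gh | g /negPf-> //].
by rewrite groupJ // Gg odd_permJ.
Qed.

Definition sign_char n (G : {group 'S_n}) : 'CF(G) :=
  Cfun 0 (sign_is_class_fun G).

(* chi^la is the unique common irreducible constituent of the permutation
   character induced from the Young subgroup of la and the signed permutation
   character induced from the Young subgroup of the conjugate of la. *)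
Definition is_chi_index n (la : seq nat) (i : Iirr [set: 'S_n]) : bool :=
  (i \in irr_constt ('Ind[[set: 'S_n], young n la] 1)) &&
  (i \in irr_constt
           ('Ind[[set: 'S_n]] (sign_char (young n (conj_part la))))).

Definition chi_part (la : seq nat) : 'CF([set: 'S_(sumn la)]) :=
  'chi_(odflt 0 [pick i | is_chi_index la i]).

Definition odd_part (la : seq nat) : bool :=
  is_part la && odd (Num.truncn (chi_part la 1%g)).

End SignCharacter.

(* There is exactly one 2^k-hook of an odd partition mu, 2^k < |mu|, whose
   removal leaves an odd partition; [fk k mu] is that odd partition. *)
Definition fk (k : nat) (mu : seq nat) : seq nat :=
  head [::] [seq nu <- [seq remove_hook mu c | c <- hooks (2 ^ k) mu]
            | odd_part nu].

(* This is e(la, 2^k), for la a partition of n - 2^k. *)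
Definition e_count (n k : nat) (la : seq nat) : nat :=
  #|[set mu : intpart n | odd_part mu & fk k mu == la]|.

Definition good (d : nat) (la : seq nat) : bool :=
  [&& odd_part la, sumn la == 2 ^ d - 1 %[mod 2 ^ d.+1]
    & is_hook_part (core (2 ^ d) la)].

(* Main.v *)
(* The degree of chi^la modulo 2 is a function par of the beta-set X of la:
   chi^la is the alternating sum psi over w of the permutation characters on
   words of content X_i - (s - 1 - w i), because psi is a virtual character of
   norm 1 (Jacobi-Trudi) whose terms w <> 1 are orthogonal to the signed
   permutation character of the conjugate partition. As (sum_i x_i) ^ (2 ^ k)
   is sum_i x_i ^ (2 ^ k) modulo 2, par X is the sum modulo 2 of the values of
   par after removal of each of the 2 ^ k-hooks.

   Hence la is odd iff its 2-core has size at most 1 and its 2-quotient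
   consists of two odd partitions whose sizes have disjoint binary expansions.
   Adding or removing a 2 ^ (k + 1)-hook amounts to adding or removing a
   2 ^ k-hook in the 2-quotient, which reduces everything to k = 0. There, if
   2 ^ m is the top binary digit of |la|, the odd partition la has only one
   2 ^ m-hook; removing it changes neither the number of odd one-box extensions
   nor the 2 ^ d-core, as long as |la| + 1 < 2 ^ (m + 1). This leads to
   |la| = 2 ^ d - 1, where la is its own 2 ^ d-core and an extension of la is
   odd iff it is a hook partition of 2 ^ d. *)

Require Import Defs.
From HB Require Import structures.
From mathcomp Require Import all_boot all_order all_algebra.
From mathcomp Require Import all_fingroup all_solvable all_field all_character.
From mathcomp Require Import zify.

Set Implicit Arguments.
Unset Strict Implicit.
Unset Printing Implicit Defensive.

Import Order.TTheory GRing.Theory Num.Theory.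

(** * Permutation characters on words *)

(** Norm 1 comes from pairing [psi] with its own terms. Each non-zero term w is the permutation
    character on words of a content lexicographically at least la, with equality only for w = 1, and
    its pairing with [psi] is the coefficient of that content in a Jacobi-Trudi determinant, whose
    leading monomial is that of la. Contents are read as digits in base [N.+2], so that the
    dominance order gives way to the order on natural numbers and a multivariate leading term to a
    degree.

    [fk] returns the head of a list, so its fibres can be counted as odd additions of hooks only
    once the odd removal is known to be unique. This is [odd_movable_inj], proved by the same two
    reductions as the count: halving to the 2-quotient, then stripping the hook of the top digit.

    Bead moves see every addition of a hook only if there are enough beads; hence the bounds of
    [wt X] by [size X], and the bound on s in [nadd_main], chosen to be stable under passing to the
    quotient. *)

Section Words.
Variables (n : nat) (T : finType).
Implicit Types (u v : {ffun 'I_n -> T}) (g : 'S_n).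

Definition content u (t : T) : nat := #|[set x | u x == t]|.

Definition wact u g : {ffun 'I_n -> T} := [ffun x => u (g x)].

Lemma wact1 u : wact u 1%g = u.
Proof. by apply/ffunP=> x; rewrite ffunE perm1. Qed.

Lemma wactM u g h : wact u (g * h)%g = wact (wact u h) g.
Proof. by apply/ffunP=> x; rewrite !ffunE permM. Qed.

Lemma content_wact u g : content (wact u g) =1 content u.
Proof.
move=> t; rewrite /content -[RHS](card_preimset _ (@perm_inj _ g)).
by apply: eq_card => x; rewrite !inE ffunE.
Qed.

Lemma sum_content u : \sum_t content u t = n.
Proof.
transitivity (\sum_(x : 'I_n) 1); last by rewrite sum1_card card_ord.
rewrite (partition_big u predT) //=; apply: eq_bigr => t _.
by rewrite /content -sum1_card; apply: eq_bigl => x; rewrite inE.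
Qed.

Lemma content_orbit u v : content u =1 content v -> exists g, v = wact u g.
Proof.
move=> eq_uv; have: perm_eq [tuple v i | i < n] [tuple u i | i < n].
  apply/allP=> t _ /=.
  have count_content (w : {ffun _ -> T}) : count_mem t [tuple w i | i < n] = content w t.
    rewrite count_map /content cardE /enum_mem size_filter -enumT.
    by apply: eq_count => x; rewrite /= inE.
  by rewrite !count_content eq_uv.
case/tuple_permP=> g; move/val_inj=> eq_v; exists g; apply/ffunP=> x.
have := congr1 (fun t => tnth t x) eq_v.
by rewrite !tnth_mktuple ffunE.
Qed.

Definition wstab u : {set 'S_n} := [set g | wact u g == u].

Lemma wstab_group_set u : group_set (wstab u).
Proof.
apply/group_setP; split=> [|g h]; rewrite !inE ?wact1 //.
by move=> /eqP gu /eqP hu; rewrite wactM hu gu.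
Qed.

Canonical wstab_group u : {group 'S_n} := Group (wstab_group_set u).

Lemma card_transporter u v :
  content u =1 content v -> #|[set g | wact u g == v]| = #|wstab u|.
Proof.
case/content_orbit=> g0 ->; rewrite -(card_lcoset (wstab u) g0).
apply: eq_card => g; rewrite !inE mem_lcoset inE.
rewrite -{1}(mulKVg g0 g) wactM; apply/eqP/eqP=> [|-> //].
by move/(congr1 (fun w => wact w g0^-1%g)); rewrite -!wactM !mulgA mulVg mul1g wact1.
Qed.

Lemma card_transporterR u v :
  content u =1 content v -> #|[set g | wact u g == v]| = #|wstab v|.
Proof.
case/content_orbit=> g0 ->; rewrite -(card_rcoset (wstab _) g0).
apply: eq_card => g; rewrite !inE mem_rcoset inE -wactM mulgKV //.
Qed.

Definition same_content u : {set {ffun 'I_n -> T}} :=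
  [set v | [forall t, content v t == content u t]].

Lemma same_contentP u v :
  reflect (content v =1 content u) (v \in same_content u).
Proof. by rewrite inE; apply: (iffP forallP) => eq_c t; apply/eqP. Qed.

Lemma sum_wstab u : \sum_(v in same_content u) #|wstab v| = n`!.
Proof.
rewrite -card_Sn -cardsT -sum1_card (partition_big (wact u) (mem (same_content u))) /=.
  apply: eq_bigr => v /same_contentP eq_vu.
  rewrite -(card_transporterR (fsym eq_vu)) -sum1_card.
  by apply: eq_bigl => g; rewrite !inE.
by move=> g _; apply/same_contentP/content_wact.
Qed.

Definition nfix (A : {set {ffun 'I_n -> T}}) (g : 'S_n) : nat :=
  #|[set v in A | wact v g == v]|.

(** Permutations act transitively on the words with the content of u, and each such word is the
    image of u under #|wstab u| of them, which cancels the denominator of the induction formula. *)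
Lemma cfInd_wstab u (g : 'S_n) :
  ('Ind[[set: 'S_n], wstab u] 1 g = (nfix (same_content u) g)%:R)%R.
Proof.
rewrite cfIndE ?subsetT //.
rewrite (eq_bigr (fun y => (wact (wact u y) g == wact u y)%:R)%R); last first.
  move=> y _; rewrite cfun1E inE conjgE 2!wactM.
  congr ((nat_of_bool _)%:R)%R; apply/eqP/eqP=> [eq_u|->].
    by rewrite -{2}eq_u -[RHS]wactM mulgV wact1.
  by rewrite -wactM mulVg wact1.
rewrite (partition_big (wact u) (mem (same_content u))) /=; last first.
  by move=> y _; apply/same_contentP/content_wact.
rewrite (eq_bigr (fun v => #|wstab u|%:R * (wact v g == v)%:R)%R); last first.
  move=> v /same_contentP eq_vu; rewrite -(card_transporter (fsym eq_vu)).
  rewrite -sum1_card natr_sum mulr_suml; apply: eq_big => [y|y].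
    by rewrite !inE.
  by rewrite inE => /eqP ->; rewrite mul1r.
rewrite -mulr_sumr mulKf ?neq0CG // /nfix -sum1dep_card -natr_sum big_mkcondr /=.
by congr (_%:R)%R; apply: eq_bigr => v _; case: eqP.
Qed.

End Words.

(** * Pairs of words and matrices with prescribed margins *)

Section Margins.
Variable n : nat.

Lemma content_word (T : finType) (c : T -> nat) :
  \sum_t c t = n -> exists u : {ffun 'I_n -> T}, content u =1 c.
Proof.
move=> sum_c; pose s := flatten [seq nseq (c t) t | t <- enum T].
have size_s : size s == n.
  rewrite size_flatten /shape -map_comp sumnE big_map big_enum /= -sum_c.
  by apply/eqP; apply: eq_bigr => t _; rewrite size_nseq.
exists [ffun i => tnth (Tuple size_s) i] => t.
have -> : content [ffun i => tnth (Tuple size_s) i] t = count_mem t (Tuple size_s).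
  rewrite -(map_tnth_enum (Tuple size_s)) count_map.
  rewrite /content cardE /enum_mem size_filter -enumT.
  rewrite filter_predT; apply: eq_count => x; rewrite /= !inE ffunE //.
rewrite /= count_flatten -map_comp sumnE big_map big_enum /=.
rewrite (bigD1 t) //= count_nseq /= eqxx mul1n big1 ?addn0 // => t' ne_t.
by rewrite count_nseq /= (negbTE ne_t) mul0n.
Qed.

(* The words whose content is a - b; there are none if a i < b i for some i. *)
Definition wset (T : finType) (a b : T -> nat) : {set {ffun 'I_n -> T}} :=
  [set u | [forall t, content u t + b t == a t]].

Lemma wsetP (T : finType) (a b : T -> nat) u :
  reflect (forall t, content u t + b t = a t) (u \in wset a b).
Proof. by rewrite inE; apply: (iffP forallP) => eq_c t; apply/eqP. Qed.

Lemma wset_same_content (T : finType) (a b : T -> nat) u :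
  u \in wset a b -> wset a b = same_content u.
Proof.
move/wsetP=> uab; apply/setP=> v.
apply/wsetP/same_contentP=> eq_v t; last by rewrite eq_v.
by apply/eqP; rewrite -(eqn_add2r (b t)) eq_v uab.
Qed.

Variables U V : finType.

(** Matrices with row sums a - b and column sums a' - b'. The bound N on the entries gives a finite
    type; any N >= n serves for words of length n. *)
Definition margins N (a b : U -> nat) (a' b' : V -> nat) :
    {set {ffun U * V -> 'I_N.+1}} :=
  [set c : {ffun U * V -> 'I_N.+1} |
     [forall i, \sum_j c (i, j) + b i == a i] &&
     [forall j, \sum_i c (i, j) + b' j == a' j]].

Definition wfst (z : {ffun 'I_n -> U * V}) : {ffun 'I_n -> U} := [ffun x => (z x).1].
Definition wsnd (z : {ffun 'I_n -> U * V}) : {ffun 'I_n -> V} := [ffun x => (z x).2].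

Lemma content_wfst z i : content (wfst z) i = \sum_j content z (i, j).
Proof.
rewrite /content -sum1_card (partition_big (fun x => (z x).2) predT) //=.
apply: eq_bigr => j _; rewrite -sum1_card; apply: eq_bigl => x.
by rewrite !inE ffunE -pair_eqE.
Qed.

Lemma content_wsnd z j : content (wsnd z) j = \sum_i content z (i, j).
Proof.
rewrite /content -sum1_card (partition_big (fun x => (z x).1) predT) //=.
apply: eq_bigr => i _; rewrite -sum1_card; apply: eq_bigl => x.
by rewrite !inE ffunE -pair_eqE andbC.
Qed.

(** Burnside counting on pairs of words: a pair is a word over [U * V], its orbit is determined by
    its content, and this content is the matrix. *)
Lemma sum_nfix_mul N (a b : U -> nat) (a' b' : V -> nat) :
  n <= N -> \sum_i (a i) = n + \sum_i b i ->
  \sum_g nfix (wset a b) g * nfix (wset a' b') g = n`! * #|margins N a b a' b'|.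
Proof.
move=> le_nN sum_ab.
pose Z := [set z | (wfst z \in wset a b) && (wsnd z \in wset a' b')].
transitivity (\sum_(z in Z) #|wstab z|).
  transitivity (\sum_g \sum_(z in Z) (wact z g == z)).
    apply: eq_bigr => g _; rewrite -cardsX -sum1_card.
    rewrite -big_mkcondr /=.
    pose h (z : {ffun 'I_n -> U * V}) := (wfst z, wsnd z).
    pose h' (p : {ffun 'I_n -> U} * {ffun 'I_n -> V}) :=
      [ffun x => (p.1 x, p.2 x)] : {ffun 'I_n -> U * V}.
    have hK : cancel h h'.
      by move=> z; apply/ffunP=> x; rewrite !ffunE -surjective_pairing.
    have h'K : cancel h' h.
      by case=> u v; congr pair; apply/ffunP=> x; rewrite !ffunE.
    rewrite (reindex h) /=; last by exists h' => ? _; [exact: hK | exact: h'K].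
    rewrite big_mkcond [RHS]big_mkcond; apply: eq_bigr => z _.
    rewrite {}/Z; move: (wset a b) (wset a' b') => A B; rewrite !inE /=.
    have -> : (wact z g == z) = (wact (wfst z) g == wfst z) && (wact (wsnd z) g == wsnd z).
      apply/eqP/andP=> [eq_z | [/eqP/ffunP eq1 /eqP/ffunP eq2]].
        by rewrite -{2 4}eq_z; split; apply/eqP/ffunP=> x; rewrite !ffunE.
      apply/ffunP=> x; have := eq1 x; have := eq2 x.
      by rewrite !ffunE; case: (z _) (z x) => [? ?] [? ?] /= -> ->.
    by case: (_ \in A); case: (_ \in B); case: eqP; case: eqP.
  rewrite exchange_big /=; apply: eq_bigr => z _.
  by rewrite -sum1dep_card [RHS]big_mkcond; apply: eq_bigr => g _; case: eqP.
pose cont (z : {ffun 'I_n -> U * V}) : {ffun U * V -> 'I_N.+1} :=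
  [ffun t => inord (content z t)].
have contE z t : cont z t = content z t :> nat.
  rewrite ffunE inordK // ltnS (leq_trans _ le_nN) // -[X in _ <= X](sum_content z).
  by rewrite (bigD1 t) //= leq_addr.
have Zcont z : (z \in Z) = (cont z \in margins N a b a' b').
  rewrite !inE; congr andb; apply: eq_forallb => i; rewrite ?content_wfst ?content_wsnd.
    by congr (_ + _ == _); apply: eq_bigr => j _; rewrite contE.
  by congr (_ + _ == _); apply: eq_bigr => j _; rewrite contE.
rewrite (partition_big cont (mem (margins N a b a' b'))) /=; last first.
  by move=> z; rewrite Zcont.
rewrite mulnC -sum_nat_const; apply: eq_bigr => c c_marg.
have [z0 z0c] : exists z0 : {ffun 'I_n -> U * V}, forall t, content z0 t = c t.
  apply: (content_word (c := fun t => c t)); apply/eqP; rewrite -(eqn_add2r (\sum_i b i)) -sum_ab.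
  rewrite (eq_bigr (fun t => val (c (t.1, t.2)))); last by case.
  rewrite -(pair_bigA _ (fun i j => val (c (i, j)))) /= -big_split /=.
  apply/eqP; apply: eq_bigr => i _.
  by move: c_marg; rewrite inE => /andP[/forallP/(_ i)/eqP].
rewrite -(sum_wstab z0); apply: eq_bigl => z; rewrite Zcont.
apply/andP/same_contentP=> [[_ /eqP eq_c] t | eq_z].
  by rewrite z0c -eq_c contE.
have -> : cont z = c by apply/ffunP=> t; apply/val_inj; rewrite /= contE eq_z z0c.
by rewrite eqxx.
Qed.

End Margins.

(** * The Jacobi-Trudi determinant *)

Section Code.
Variable B : nat.

(** Digits in base B, the most significant first: for digits below B, the numerical order is the
    lexicographic one. *)
Definition code s (f : 'I_s -> nat) : nat := \sum_i f i * B ^ (s - i.+1).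

Lemma code_recl s (f : 'I_s.+1 -> nat) :
  code f = f ord0 * B ^ s + code (fun i => f (lift ord0 i)).
Proof. by rewrite /code big_ord_recl subn1. Qed.

Lemma code_bound s (f : 'I_s -> nat) : (forall i, f i < B) -> code f < B ^ s.
Proof.
elim: s f => [|s IH] f lt_f; first by rewrite /code big_ord0.
rewrite code_recl expnS.
have lt1 := lt_f ord0; have lt2 := IH (fun i => f (lift ord0 i)) (fun i => lt_f _).
by rewrite -addnS (leq_trans (leq_add (leqnn _) lt2)) // -mulSnr leq_mul2r lt1 orbT.
Qed.

Lemma code_lt s (f g : 'I_s -> nat) (v : 'I_s) :
    (forall i, g i < B) -> (forall i : 'I_s, i < v -> f i = g i) -> g v < f v ->
  code g < code f.
Proof.
elim: s f g v => [|s IH] f g v lt_g eq_fg lt_v; first by have := ltn_ord v.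
rewrite !code_recl; case: (unliftP ord0 v) => [u def_v | def_v].
  rewrite (eq_fg ord0); last by rewrite def_v.
  rewrite ltn_add2l (IH _ _ u) => [|i|i lt_i|] //; last by rewrite -def_v.
  by rewrite eq_fg // def_v !lift0 ltnS.
rewrite def_v in lt_v; have lt2 := @code_bound _ (fun i => g (lift ord0 i)) (fun i => lt_g _).
rewrite (leq_trans _ (leq_addr _ _)) // -addnS (leq_trans (leq_add (leqnn _) lt2)) //.
by rewrite -mulSnr leq_mul2r lt_v orbT.
Qed.

Lemma first_difference s (f g : 'I_s -> nat) i :
    f i != g i ->
  exists2 v : 'I_s, (forall j : 'I_s, j < v -> f j = g j) & f v != g v.
Proof.
move=> ne_i; case: (@arg_minnP _ i (fun i => f i != g i) val ne_i) => v ne_v min_v.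
exists v => // j lt_jv; apply/eqP.
by apply: contraTT lt_jv => /min_v; rewrite -leqNgt.
Qed.

Lemma code_inj s (f g : 'I_s -> nat) :
  (forall i, f i < B) -> (forall i, g i < B) -> code f = code g -> f =1 g.
Proof.
move=> lt_f lt_g eq_c i; apply/eqP; apply: contraT => /first_difference[v eq_lt ne_v].
have [lt_v | lt_v | eq_v] := ltngtP (f v) (g v); last by rewrite eq_v eqxx in ne_v.
  by have := code_lt lt_f (fun j lt => esym (eq_lt j lt)) lt_v; rewrite eq_c ltnn.
by have := code_lt lt_g eq_lt lt_v; rewrite eq_c ltnn.
Qed.

Lemma code_lt_first s (f g : 'I_s -> nat) :
    (forall i, f i < B) -> code g < code f ->
  exists2 v : 'I_s, (forall i : 'I_s, i < v -> f i = g i) & g v < f v.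
Proof.
move=> lt_f lt_c; have [i ne_i] : exists i, f i != g i.
  apply/existsP; rewrite -negb_forall; apply: contraL lt_c => /forallP eq_fg.
  by rewrite -leqNgt leq_sum // => i _; rewrite (eqP (eq_fg i)).
have [v eq_lt ne_v] := first_difference ne_i.
exists v => //; rewrite ltn_neqAle eq_sym ne_v leqNgt; apply/negP=> lt_v.
have := code_lt lt_f (fun j lt => esym (eq_lt j lt)) lt_v.
by rewrite ltnNge ltnW.
Qed.

(** The first moved point goes up, because all smaller values are taken by fixed points. *)
Lemma first_nonfixed s (w : 'S_s) :
  w != 1%g -> exists2 v : 'I_s, (forall i : 'I_s, i < v -> w i = i) & v < w v.
Proof.
move=> w1; have [i ne_i] : exists i, val (w i) != val i.
  apply/existsP; rewrite -negb_forall; apply: contra w1 => /forallP w_id.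
  by apply/eqP/permP=> i; rewrite perm1; apply/val_inj/eqP.
have [v fix_lt ne_v] := first_difference (f := fun j => val (w j)) (g := val) ne_i.
have fix_v (j : 'I_s) : j < v -> w j = j by move/fix_lt/val_inj.
exists v => //; rewrite ltn_neqAle eq_sym ne_v leqNgt /=.
by apply: contraNN ne_v => lt_wv; apply/eqP/congr1/(@perm_inj _ w)/fix_v.
Qed.

Lemma code_perm_lt s (f : 'I_s -> nat) (w : 'S_s) :
    (forall i, f i < B) -> {homo f : i j / i < j >-> j < i} -> w != 1%g ->
  code (fun i => f (w i)) < code f.
Proof.
move=> lt_f dec_f /first_nonfixed[v fix_v lt_v].
by apply: (code_lt (v := v)) => [i|i /fix_v->|] //; apply: dec_f.
Qed.

End Code.

(** * Leading coefficient of the determinant *)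

Section JacobiTrudi.
Local Open Scope ring_scope.

Section Truncation.
Variables (R : comNzRingType) (N : nat).
Implicit Types p q : {poly R}.

(** Congruence modulo ['X^N.+1], which stands in for identities between power series. *)
Definition eqtr p q := forall m, (m <= N)%N -> p`_m = q`_m.

Lemma eqtr_mul p q p' q' : eqtr p p' -> eqtr q q' -> eqtr (p * q) (p' * q').
Proof.
move=> eq_p eq_q m le_m; rewrite !coefM; apply: eq_bigr => j _.
by rewrite eq_p ?eq_q //; have := ltn_ord j; lia.
Qed.

Lemma eqtr_prod (I : Type) (r : seq I) (P : pred I) (F G : I -> {poly R}) :
    (forall i, P i -> eqtr (F i) (G i)) ->
  eqtr (\prod_(i <- r | P i) F i) (\prod_(i <- r | P i) G i).
Proof. by move=> eqFG; elim/big_rec2: _ => // i p q /eqFG; apply: eqtr_mul. Qed.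

Definition geom (t : R) : {poly R} := \poly_(k < N.+1) t ^+ k.

Lemma eqtr_geom t : eqtr ((1 - t *: 'X) * geom t) 1.
Proof.
move=> m le_m; rewrite mulrBl mul1r -scalerAl coefB coefZ coefXM !coef_poly coef1.
case: m le_m => [|m] le_m /=; first by rewrite mulr0 subr0 expr0.
by rewrite ltnS le_m ltnS ltnW // -exprS subrr.
Qed.

End Truncation.

Variables (s N : nat) (X : 'I_s -> nat).
Hypothesis X_leN : forall i, (X i <= N)%N.

(* Kronecker substitution: the variables t v are powers of a single one, so that
   the lexicographic order on exponents becomes the order on degrees. *)
Let b (v : 'I_s) : nat := (N.+2 ^ (s - v.+1))%N.
Let t (v : 'I_s) : {poly int} := 'X^(b v).
Let H (v : nat) : {poly {poly int}} := \prod_(j : 'I_s | (v <= j)%N) geom N (t j).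

(** The complete homogeneous polynomial of degree X i - (s - v.+1) in all the variables; [jt_flag]
    uses only those from v on. The factor ['X^(s - v.+1)] makes the entry 0 when that degree is
    negative, where a truncated subtraction would give 1. *)
Definition jt_h v i : {poly int} := ('X^(s - v.+1) * H 0)`_(X i).
Definition jt_flag v i : {poly int} := ('X^(s - v.+1) * H v)`_(X i).

(* The second matrix is obtained from the first by the unitriangular column
   operations given by the coefficients of \prod_(j < v) (1 - t j *: 'X). *)
Lemma jt_det :
  \det (\matrix_(i < s, v < s) jt_h v i) = \det (\matrix_(i < s, v < s) jt_flag v i).
Proof.
pose E (v : nat) : {poly {poly int}} := \prod_(j : 'I_s | (j < v)%N) (1 - t j *: 'X).
have size_E (v : 'I_s) : (size (E v) <= v.+1)%N.
  have card_lt : (\sum_(j : 'I_s | (j < v)%N) 1 = v)%N.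
    by rewrite -(big_ord_widen s (fun=> 1%N)) ?sum1_card ?card_ord // ltnW.
  rewrite (leq_trans (size_prod_leq _ _)) // -sum1_card card_lt.
  have: (\sum_(j : 'I_s | (j < v)%N) size (1 - t j *: 'X)%R <= v + v)%N.
    rewrite -{2 3}card_lt -big_split /= leq_sum // => j _.
    rewrite (leq_trans (size_polyD _ _)) // size_polyN size_poly1 geq_max /=.
    by rewrite (leq_trans (size_scale_leq _ _)) ?size_polyX.
  by move=> le_vv; rewrite leq_subLR addnS ltnS.
have E0 v : (E v)`_0 = 1.
  rewrite -horner_coef0 horner_prod big1 // => j _.
  by rewrite hornerD hornerN hornerZ hornerX mulr0 subr0 hornerC.
have EH v : eqtr N (E v * H 0) (H v).
  have -> : H 0 = (\prod_(j : 'I_s | (j < v)%N) geom N (t j)) * H v.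
    rewrite /H (bigID (fun j : 'I_s => (j < v)%N)) /=; congr (_ * _).
    by apply: eq_bigl => j; rewrite -leqNgt.
  rewrite mulrA -big_split /= -[X in eqtr _ _ X]mul1r.
  apply: eqtr_mul => //.
  have prod1 : \prod_(j : 'I_s | (j < v)%N) (1 : {poly {poly int}}) = 1 by rewrite big1.
  rewrite -[X in eqtr _ _ X]prod1.
  by apply: eqtr_prod => j _; apply: eqtr_geom.
pose U := \matrix_(u < s, v < s) (if (u <= v)%N then (E v)`_(v - u) else 0).
have detU : \det U = 1.
  rewrite -det_tr det_trig; last first.
    by apply/is_trig_mxP => i j lt_ij; rewrite !mxE leqNgt lt_ij.
  by rewrite big1 // => i _; rewrite !mxE leqnn subnn E0.
rewrite -[LHS]mulr1 -detU -det_mulmx; congr (\det _).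
apply/matrixP=> i v; rewrite !mxE /jt_flag.
have -> : ('X^(s - v.+1) * H v)`_(X i) = ('X^(s - v.+1) * (E v * H 0))`_(X i).
  by apply: (eqtr_mul (N := N)) => // m /EH.
have def_E : E v = \sum_(q < v.+1) (E v)`_q *: 'X^q.
  rewrite -poly_def; apply/polyP=> m; rewrite coef_poly.
  by case: ltnP => // le_m; rewrite nth_default // (leq_trans (size_E v)).
rewrite {1}def_E mulr_suml mulr_sumr coef_sum.
under eq_bigr do rewrite !mxE.
rewrite (bigID (fun u : 'I_s => (u < v.+1)%N)) /= addrC big1 ?add0r; last first.
  by move=> u; rewrite ltnS => /negPf->; rewrite mulr0.
rewrite -(big_ord_widen s (fun u => ('X^(s - u.+1) * H 0)`_(X i) *
   (if (u <= v)%N then (E v)`_(v - u) else 0))) //.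
rewrite (reindex_inj rev_ord_inj) /=; apply: eq_bigr => q _.
have le_q : (q <= v)%N by rewrite -ltnS.
rewrite subSS leq_subr subKn // -scalerAl -scalerAr coefZ mulrC mulrA -exprD.
by congr (_ * ('X^_ * _)`_ _); have := ltn_ord v; lia.
Qed.

(** Among the monomials of degree m in the variables from v on, the power of t v has the largest
    degree after substitution, since b is decreasing. *)
Lemma coef_H_top (v : 'I_s) m : (m <= N)%N ->
  (size ((H v)`_m - 'X^(m * b v))%R <= m * b v)%N.
Proof.
(* Series in which every coefficient of order q > 0 has degree strictly below that of (t v) ^ q;
   they are stable under products. *)
pose low (p : {poly {poly int}}) :=
  p`_0 = 1 /\ forall q, (0 < q)%N -> (size (p`_q)%R <= q * b v)%N.
have size_coefM (p r : {poly {poly int}}) q j : low p -> low r ->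
    (0 < q)%N -> (j < q.+1)%N -> (size (p`_j * r`_(q - j))%R <= q * b v)%N.
  case=> p0 lp [r0 lr] q_gt0; rewrite ltnS => le_jq.
  have [->|j_gt0] := posnP j; first by rewrite p0 mul1r subn0 lr.
  have [eq_jq|lt_jq] := eqVneq j q; first by rewrite eq_jq subnn r0 mulr1 lp.
  have lt_qj : (0 < q - j)%N by rewrite subn_gt0 ltn_neqAle lt_jq.
  rewrite (leq_trans (size_polyMleq _ _)) //.
  rewrite (leq_trans (leq_pred _)) // (leq_trans (leq_add (lp _ j_gt0) (lr _ lt_qj))) //.
  by rewrite -mulnDl subnKC.
have low_prod (P : pred 'I_s) : (forall j, P j -> low (geom N (t j))) ->
    low (\prod_(j | P j) geom N (t j)).
  move=> lowP; elim/big_rec: _ => [|j p Pj low_p].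
    by split=> [|q q_gt0]; rewrite coef1 //= eqn0Ngt q_gt0 size_poly0.
  have low_j := lowP _ Pj; split=> [|q q_gt0].
    by rewrite coefM big_ord1 low_j.1 low_p.1 mulr1.
  rewrite coefM (leq_trans (size_sum _ _ _)) //; apply/bigmax_leqP => i _.
  by apply: size_coefM.
have def_H : H v = geom N (t v) * \prod_(j : 'I_s | (v < j)%N) geom N (t j).
  rewrite /H (bigD1 v) //=; congr (_ * _); apply: eq_bigl => j.
  by rewrite andbC eq_sym -ltn_neqAle.
have low_K : low (\prod_(j : 'I_s | (v < j)%N) geom N (t j)).
  apply: low_prod => j lt_vj; split=> [|q q_gt0].
    by rewrite coef_poly /= expr0.
  rewrite coef_poly; case: ifP => _; last by rewrite size_poly0.
  rewrite -exprM size_polyXn mulnC ltn_mul2l q_gt0 /=.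
  by rewrite ltn_exp2l //; have := ltn_ord j; lia.
move=> le_mN; rewrite def_H coefM big_ord_recr /= subnn low_K.1 mulr1.
rewrite coef_poly ltnS le_mN -exprM mulnC addrK.
rewrite (leq_trans (size_sum _ _ _)) //; apply/bigmax_leqP => j _.
have lt_jm := ltn_ord j; rewrite coef_poly ltnS (leq_trans (ltnW lt_jm) le_mN) -exprM.
rewrite (leq_trans (size_polyMleq _ _)) // size_polyXn addSn /=.
have lt_mj : (0 < m - j)%N by rewrite subn_gt0.
rewrite (leq_trans (leq_add (leqnn _) (low_K.2 _ lt_mj))) //.
by rewrite [(b v * j)%N]mulnC -mulnDl subnKC // ltnW.
Qed.

Lemma jt_flag_monic (v i : 'I_s) :
  if (X i < s - v.+1)%N then jt_flag v i = 0
  else jt_flag v i \is monic /\ size (jt_flag v i) = ((X i - (s - v.+1)) * b v).+1%N.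
Proof.
rewrite /jt_flag coefXnM; case: ltnP => lt_X0 //.
have le_N : (X i - (s - v.+1) <= N)%N by rewrite (leq_trans (leq_subr _ _)).
have := coef_H_top v le_N; set m := (X i - _)%N; set p := (H v)`_m => lt_p.
have -> : p = 'X^(m * b v) + (p - 'X^(m * b v)) by rewrite addrCA subrr addr0.
have lt_X : (size (p - 'X^(m * b v))%R < size ('X^(m * b v) : {poly int})%R)%N.
  by rewrite size_polyXn ltnS.
by rewrite size_polyDl // size_polyXn monicE lead_coefDl // lead_coefXn.
Qed.

Lemma size_prod_flag (w : 'S_s) :
    \prod_i jt_flag (w i) i = 0 \/
  [/\ forall i, (s - (w i).+1 <= X i)%N, \prod_i jt_flag (w i) i \is monic
    & size (\prod_i jt_flag (w i) i) = (\sum_i (X i - (s - (w i).+1)) * b (w i)).+1].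
Proof.
have [/forallP ge_X | /forallPn[i]] := boolP [forall i, s - (w i).+1 <= X i]%N; last first.
  rewrite -ltnNge => lt_X; left; rewrite (bigD1 i) //=.
  by have := jt_flag_monic (w i) i; rewrite lt_X => ->; rewrite mul0r.
right; have mon_i i : jt_flag (w i) i \is monic /\
    size (jt_flag (w i) i) = ((X i - (s - (w i).+1)) * b (w i)).+1.
  by have := jt_flag_monic (w i) i; rewrite ltnNge ge_X.
split=> //; first by apply: monic_prod => i _; case: (mon_i i).
elim/big_rec2: _ => [|i d p _ size_p]; first by rewrite size_poly1.
have [mon_f size_f] := mon_i i.
by rewrite size_monicM ?size_f ?size_p ?addSn ?addnS // -size_poly_gt0 size_p.
Qed.

Let la (i : 'I_s) : nat := (X i - (s - i.+1))%N.

(** In the flagged determinant the product for w = 1 is monic of degree [code N.+2 la], and every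
    other product is 0 or of smaller degree. *)
Lemma jt_coef c : {homo X : i j / (i < j)%N >-> (j < i)%N} ->
    (forall i : 'I_s, s - i.+1 <= X i)%N -> (code N.+2 la <= c)%N ->
  (\det (\matrix_(i < s, v < s) jt_h v i))`_c = (c == code N.+2 la)%:R.
Proof.
move=> dec_X ge_X le_c; rewrite jt_det /determinant coef_sum (bigD1 1%g) //=.
rewrite odd_perm1 expr0 mul1r [X in _ + X]big1 ?addr0 => [|w w_neq1].
  rewrite (eq_bigr (fun i => jt_flag ((1 : 'S_s)%g i) i)); last first.
    by move=> i _; rewrite !mxE perm1.
  have [eq0 | [_ mon size_c]] := size_prod_flag 1.
    have /monic_neq0 : \prod_i jt_flag ((1 : 'S_s)%g i) i \is monic.
      apply: monic_prod => i _; have := jt_flag_monic i i.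
      by rewrite ltnNge ge_X perm1 => -[].
    by rewrite eq0 eqxx.
  have def_c : code N.+2 la = (size (\prod_i jt_flag ((1 : 'S_s)%g i) i)).-1.
    by rewrite size_c; apply: eq_bigr => i _; rewrite perm1.
  have [eq_c | ne_c] := eqVneq; first by rewrite eq_c def_c -/(lead_coef _) (monicP mon).
  rewrite nth_default //; have := size_c; rewrite def_c in le_c ne_c *.
  by case: (size _) le_c ne_c => //= m le_mc ne_mc _; rewrite ltn_neqAle eq_sym ne_mc.
rewrite (eq_bigr (fun i => jt_flag (w i) i)); last by move=> i _; rewrite !mxE.
have [-> | [ge_Xw _ size_w]] := size_prod_flag w; first by rewrite mulr0 coef0.
suff lt_w : (\sum_i (X i - (s - (w i).+1)) * b (w i) < code N.+2 la)%N.
  rewrite -signr_odd; case: (odd _); rewrite ?expr1 ?expr0 ?mulN1r ?mul1r ?coefN;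
    by rewrite nth_default ?oppr0 // size_w (leq_trans _ le_c).
(* Adding the staircase to both sides removes the subtractions: the degrees become the codes of X
   permuted by w^-1 and of X. *)
rewrite -(ltn_add2r (\sum_(v : 'I_s) (s - v.+1) * b v)%N).
have -> : (code N.+2 la + \sum_(v : 'I_s) (s - v.+1) * b v)%N = code N.+2 X.
  by rewrite -big_split /=; apply: eq_bigr => i _; rewrite -mulnDl subnK.
rewrite [X in (_ + X < _)%N](reindex_inj (@perm_inj _ w)) /= -big_split /=.
rewrite (reindex_inj (@perm_inj _ w^-1%g)) /=.
rewrite (eq_bigr (fun v => X (w^-1 v)%g * b v)%N); last first.
  by move=> v _; rewrite -mulnDl permKV subnK // -{1}(permKV w v) ge_Xw.
apply: code_perm_lt => // [i|]; first by rewrite ltnS (leq_trans (X_leN i)).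
by rewrite invg_eq1.
Qed.

Lemma jt_hE (v i : 'I_s) :
  jt_h v i = \sum_(r : {ffun 'I_s -> 'I_N.+1})
    if (\sum_j r j + (s - v.+1) == X i)%N then 'X^(code N.+2 (fun j => r j)) else 0.
Proof.
have -> : jt_h v i = ('X^(s - v.+1) *
    \prod_(j : 'I_s) \sum_(k : 'I_N.+1) (t j ^+ k *: 'X^k))`_(X i).
  congr (('X^_ * _)`_ _); apply: eq_bigr => j _; exact: poly_def.
rewrite bigA_distr_bigA mulr_sumr coef_sum; apply: eq_bigr => r _ /=.
have -> : \prod_i (t i ^+ r i *: 'X^(r i)) =
    'X^(code N.+2 (fun j => r j)) *: 'X^(\sum_j r j) :> {poly {poly int}}.
  rewrite scaler_prod prodrXr; congr (_ *: _).
  by rewrite -prodrXr; apply: eq_bigr => j _; rewrite -exprM mulnC.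
rewrite -scalerAr coefZ -exprD coefXn addnC eq_sym.
by case: eqP => _; rewrite ?mulr1 ?mulr0.
Qed.

(** A monomial chosen in each factor is a row of a matrix. The codes of the column sums and of be
    have digits below [N.+2], so equal codes mean equal vectors. *)
Lemma coef_prod_jt_h n (w : 'S_s) (be : 'I_s -> nat) :
    (\sum_i X i = n + \sum_(v < s) (s - v.+1))%N -> (n <= N)%N ->
    (forall j, be j <= N)%N ->
  (\prod_i jt_h (w i) i)`_(code N.+2 be) =
    #|margins N X (fun i => s - (w i).+1)%N be (fun=> 0%N)|%:R.
Proof.
move=> sum_X le_nN be_leN; under eq_bigr do rewrite jt_hE.
rewrite bigA_distr_bigA coef_sum -sum1_card natr_sum [RHS]big_mkcond /=.
pose cur (c : {ffun 'I_s * 'I_s -> 'I_N.+1}) :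
    {ffun 'I_s -> {ffun 'I_s -> 'I_N.+1}} := [ffun i => [ffun j => c (i, j)]].
pose unc (c : {ffun 'I_s -> {ffun 'I_s -> 'I_N.+1}}) :
    {ffun 'I_s * 'I_s -> 'I_N.+1} := [ffun p => c p.1 p.2].
have curK : cancel cur unc.
  by move=> c; apply/ffunP=> -[i j]; rewrite !ffunE.
have uncK : cancel unc cur.
  by move=> c; apply/ffunP=> i; apply/ffunP=> j; rewrite !ffunE.
rewrite (reindex cur) /=; last by exists unc => ? _; [exact: curK | exact: uncK].
apply: eq_bigr => c _; rewrite inE.
have [/forallP rowsP | /forallPn[i /negPf row_i]] :=
    boolP [forall i, (\sum_j c (i, j) + (s - (w i).+1) == X i)%N]; last first.
  rewrite (bigD1 i) //=; under eq_bigr do rewrite !ffunE.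
  by rewrite row_i mul0r coef0.
rewrite (eq_bigr (fun i => 'X^(code N.+2 (fun j => c (i, j))))); last first.
  move=> i _; have := rowsP i; under eq_bigr do rewrite -[c _](ffunE (fun j => c (i, j))).
  rewrite ffunE => ->; congr 'X^_; apply: eq_bigr => j _; rewrite !ffunE //.
rewrite prodrXr coefXn /=.
pose col j := (\sum_i c (i, j))%N.
have sum_col : (\sum_j col j = n)%N.
  rewrite exchange_big /=; apply/eqP.
  rewrite -(eqn_add2r (\sum_(v < s) (s - v.+1))%N) -sum_X.
  rewrite [X in (_ + X)%N](reindex_inj (@perm_inj _ w)) /= -big_split /=.
  by apply/eqP; apply: eq_bigr => i _; apply/eqP.
have col_lt j : (col j < N.+2)%N.
  rewrite ltnW // !ltnS (leq_trans _ le_nN) // -sum_col (bigD1 j) //=; exact: leq_addr.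
have -> : (\sum_i code N.+2 (fun j => c (i, j)) = code N.+2 col)%N.
  by rewrite /code exchange_big; apply: eq_bigr => j _; rewrite /= big_distrl.
have -> : (code N.+2 be == code N.+2 col) = [forall j, (\sum_i c (i, j) + 0 == be j)%N].
  apply/eqP/forallP=> [eq_c j | eq_c].
    by rewrite addn0 (code_inj _ _ eq_c) // => k; rewrite ltnS (leq_trans (be_leN k)).
  by apply: eq_bigr => j _; rewrite -(eqP (eq_c j)) addn0.
by case: forallP.
Qed.

End JacobiTrudi.

(** The left-hand side is to be the pairing of [psi] with the permutation character on words of
    content be, through [cfdot_permw]. *)
Lemma sum_margins_sign s n N (X be : 'I_s -> nat) :
    (forall i, X i <= N) -> n <= N ->
    {homo X : i j / i < j >-> j < i} ->
    \sum_i X i = n + \sum_(v < s) (s - v.+1) ->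
    (forall i : 'I_s, s - i.+1 <= X i) ->
    (forall j, be j <= N) ->
    code N.+2 (fun i => X i - (s - i.+1)) <= code N.+2 be ->
  (\sum_(w : 'S_s) (-1) ^+ w *
    #|margins N X (fun i => s - (w i).+1)%N be (fun=> 0%N)|%:R =
  (code N.+2 be == code N.+2 (fun i => X i - (s - i.+1))%N)%:R :> int)%R.
Proof.
move=> X_leN le_nN dec_X sum_X ge_X be_leN le_code.
rewrite -(jt_coef X_leN dec_X ge_X le_code) coef_sum; apply: eq_bigr => w _.
rewrite -(coef_prod_jt_h w sum_X le_nN be_leN).
under [in RHS]eq_bigr do rewrite mxE.
by case: (odd_perm w); rewrite ?(expr0, expr1, mul1r, mulN1r, coefN).
Qed.

(** * Identification of the irreducible character of a partition *)

Section ReshapeWord.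

Lemma reshape_index_cons a (la : seq nat) x :
  reshape_index (a :: la) x = if x < a then 0 else (reshape_index la (x - a)).+1.
Proof.
rewrite /reshape_index /= subn_eq0; case: ltnP => // le_ax.
by rewrite subSn.
Qed.

Lemma count_reshape_index la i :
  count (fun x => reshape_index la x == i) (iota 0 (sumn la)) = nth 0 la i.
Proof.
elim: la i => [|a la IH] i; first by rewrite nth_nil.
rewrite [sumn _]/= iotaD count_cat add0n -[X in iota X (sumn la)]addn0 iotaDl count_map.
rewrite (eq_in_count (a2 := fun=> 0 == i)); last first.
  move=> x; rewrite mem_iota add0n => /andP[_ lt_xa].
  by rewrite -[LHS]/(reshape_index (a :: la) x == i) reshape_index_cons lt_xa.
rewrite (eq_count (a2 := fun x => (reshape_index la x).+1 == i)); last first.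
  move=> x; rewrite -[LHS]/(reshape_index (a :: la) (a + x) == i) reshape_index_cons.
  by rewrite ltnNge leq_addr addKn.
case: i => [|i].
  by rewrite count_predT size_iota (eq_count (a2 := pred0)) ?count_pred0 ?addn0.
rewrite (eq_count (a2 := pred0)) // count_pred0 add0n -[RHS]/(nth 0 la i) -IH.
by apply: eq_count => x.
Qed.

Variables (n : nat) (la : seq nat).
Hypothesis sum_la : sumn la = n.

Lemma reshape_word_subproof (x : 'I_n) : reshape_index la x < size la.
Proof. by apply: reshape_indexP; rewrite sum_la. Qed.

Definition reshape_word : {ffun 'I_n -> 'I_(size la)} :=
  [ffun x => Ordinal (reshape_word_subproof x)].

Lemma content_reshape_word i : content reshape_word i = nth 0 la i.
Proof.
rewrite -count_reshape_index sum_la -val_enum_ord count_map.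
rewrite /content cardE /enum_mem size_filter filter_predT.
by apply: eq_count => x; rewrite /= inE ffunE -val_eqE.
Qed.

Lemma young_wstab : young n la = wstab_group reshape_word.
Proof.
apply/val_inj/setP=> g; rewrite !inE; apply/forallP/eqP=> [stab_g | /ffunP eq_g x].
  by apply/ffunP=> x; apply/val_inj; rewrite !ffunE /=; apply/eqP.
by have := congr1 val (eq_g x); rewrite !ffunE /= => ->.
Qed.

End ReshapeWord.

(** * Pairing with signed permutation characters *)

Section SignPairing.
Local Open Scope ring_scope.
Variables (n : nat) (U V : finType).

Lemma sign_char_is_char (G : {group 'S_n}) : sign_char G \is a character.
Proof.
have repr_sign : mx_repr G (fun g : 'S_n => ((-1) ^+ odd_perm g)%:M : 'M[algC]_1).
  split=> [|g h _ _]; first by rewrite odd_perm1.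
  by rewrite odd_permM signr_addb scalar_mxM.
have -> : sign_char G = cfRepr (MxRepresentation repr_sign).
  apply/cfun_inP=> g Gg; rewrite cfunE cfunE Gg mulr1n /=.
  by rewrite mxtrace_scalar.
exact: cfRepr_char.
Qed.

Definition pair_word (m : {ffun 'I_n -> U}) (v : {ffun 'I_n -> V}) :
  {ffun 'I_n -> U * V} := [ffun x => (m x, v x)].

(** A repeated letter puts a transposition in the stabilizer, which pairs off opposite signs;
    without repetition the stabilizer is trivial. *)
Lemma sum_sign_wstab (T : finType) (p : {ffun 'I_n -> T}) :
  \sum_(g in wstab p) ((-1) ^+ odd_perm g : algC) = (injectiveb p)%:R.
Proof.
have [/injectiveP inj_p | /injectivePn[x [y ne_xy eq_p]]] := boolP (injectiveb p).
  rewrite (big_pred1 1%g) ?odd_perm1 // => g; rewrite inE.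
  apply/eqP/eqP=> [/ffunP eq_g | ->]; last exact: wact1.
  by apply/permP=> x; rewrite perm1; apply: inj_p; have := eq_g x; rewrite ffunE.
have stab_xy : tperm x y \in wstab p.
  by rewrite inE; apply/eqP/ffunP=> z; rewrite ffunE; case: tpermP => [->|->|].
set S := \sum_(g in _) _; suff /eqP: S = - S.
  by rewrite -addr_eq0 -mulr2n mulrn_eq0 /= => /eqP.
rewrite {1}/S (reindex_inj (mulIg (tperm x y))) /= -sumrN.
apply: eq_big => [g | g _]; first by rewrite groupMr.
by rewrite odd_permM odd_tperm ne_xy addbT signrN.
Qed.

(** Frobenius reciprocity gives a signed sum over the stabilizer of m; in it each word v contributes
    the signed sum over the stabilizer of the word of pairs (m, v). *)
Lemma cfdot_perm_sign (u : {ffun 'I_n -> V}) (m : {ffun 'I_n -> U}) :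
  '['Ind[[set: 'S_n], wstab u] 1, 'Ind[[set: 'S_n]] (sign_char (wstab_group m))] =
  #|wstab m|%:R^-1 * #|[set v in same_content u | injectiveb (pair_word m v)]|%:R.
Proof.
rewrite cfdotC -Frobenius_reciprocity cfdotE rmorphM rmorph_sum /=.
rewrite fmorphV rmorph_nat; congr (_ * _).
rewrite (eq_bigr (fun g : 'S_n => \sum_(v in same_content u) (wact v g == v)%:R *
    (-1) ^+ odd_perm g)); last first.
  move=> g Gg; rewrite cfResE ?subsetT // cfInd_wstab conjC_nat rmorphM rmorph_nat.
  rewrite cfunE Gg -mulr_suml mulrC; congr (_ * _); last first.
    by rewrite -signr_odd; case: (odd _); rewrite ?expr0 ?expr1 ?rmorphN ?rmorph1.
  rewrite /nfix -sum1dep_card natr_sum big_mkcondr /=.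
  by apply: eq_bigr => v _; case: eqP.
rewrite exchange_big -sum1dep_card natr_sum [RHS]big_mkcondr /=.
apply: eq_bigr => v _.
transitivity (\sum_(g in wstab (pair_word m v)) ((-1) ^+ odd_perm g : algC)).
  rewrite big_mkcond [RHS]big_mkcond; apply: eq_bigr => g _ /=.
  have -> : (g \in wstab (pair_word m v)) = (g \in wstab m) && (wact v g == v).
    rewrite !inE; apply/eqP/andP=> [/ffunP eq_g | [/eqP/ffunP eq_m /eqP/ffunP eq_v]].
      by split; apply/eqP/ffunP=> x; have := eq_g x; rewrite !ffunE => -[].
    by apply/ffunP=> x; have := eq_m x; have := eq_v x; rewrite !ffunE => -> ->.
  by case: (g \in _); case: eqP => _; rewrite ?mul1r ?mul0r.
by rewrite sum_sign_wstab; case: injectiveb.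
Qed.

End SignPairing.

(** * Conjugate partitions and dominance *)

Lemma part_sorted la : is_part la -> sorted geq la.
Proof. by case/andP. Qed.

Lemma sum_ltn_ord h k : \sum_(j < h) (j < k) = minn k h.
Proof.
elim: h => [|h IH]; first by rewrite big_ord0 minn0.
by rewrite big_ord_recr /= IH; lia.
Qed.

Lemma nth_sorted_geq la i j : sorted geq la -> i <= j -> nth 0 la j <= nth 0 la i.
Proof.
move=> s_la le_ij; have [lt_j | ge_j] := ltnP j (size la); last by rewrite nth_default.
have geq_trans : transitive geq by move=> x y z /= le1 le2; apply: leq_trans le2 le1.
apply: (sorted_leq_nth geq_trans _ _ s_la) => //; rewrite ?inE //=.
  exact: leqnn.
exact: leq_ltn_trans le_ij lt_j.
Qed.

Lemma ltn_count_sorted la i j :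
  sorted geq la -> (i < count (fun r => j < r) la) = (j < nth 0 la i).
Proof.
elim: la i => [|a la IH] i s_la; first by rewrite nth_nil.
have [lt_ja | ge_ja] := ltnP j a.
  rewrite /= lt_ja; case: i => [|i]; first by rewrite lt_ja.
  by rewrite add1n ltnS IH // (path_sorted s_la).
rewrite [RHS]ltnNge (leq_trans (nth_sorted_geq s_la (leq0n i))) //.
rewrite (eq_in_count (a2 := pred0)) ?count_pred0 // => r /(nthP 0)[k _ <-].
by apply/negbTE; rewrite -leqNgt (leq_trans (nth_sorted_geq s_la (leq0n k))).
Qed.

Lemma nth_conj_part la j :
  sorted geq la -> nth 0 (conj_part la) j = count (fun r => j < r) la.
Proof.
move=> s_la; have [lt_j | ge_j] := ltnP j (head 0 la).
  by rewrite (nth_map 0) ?size_iota // nth_iota.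
rewrite nth_default ?size_map ?size_iota //; apply/esym/eqP.
by rewrite -leqn0 leqNgt ltn_count_sorted // -leqNgt nth0.
Qed.

Lemma ltn_conj_part la i j :
  sorted geq la -> (i < nth 0 (conj_part la) j) = (j < nth 0 la i).
Proof. by move=> s_la; rewrite nth_conj_part // ltn_count_sorted. Qed.

Lemma size_conj_part la : size (conj_part la) = nth 0 la 0.
Proof. by rewrite size_map size_iota nth0. Qed.

Lemma sumn_nth_ord (la : seq nat) : sumn la = \sum_(i < size la) nth 0 la i.
Proof. by rewrite sumnE (big_nth 0) big_mkord. Qed.

Lemma sum_nth_part la (i : 'I_(size la)) : sorted geq la ->
  \sum_(j < size (conj_part la)) (j < nth 0 la i) = nth 0 la i.
Proof.
move=> s_la; rewrite sum_ltn_ord size_conj_part; apply/minn_idPl.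
exact: nth_sorted_geq.
Qed.

Lemma sum_nth_conj la j : sorted geq la ->
  \sum_(i < size la) (j < nth 0 la i) = nth 0 (conj_part la) j.
Proof.
move=> s_la; under eq_bigr do rewrite -ltn_conj_part //.
rewrite sum_ltn_ord; apply/minn_idPl.
by rewrite nth_conj_part // count_size.
Qed.

Lemma sumn_conj_part la : sorted geq la -> sumn (conj_part la) = sumn la.
Proof.
move=> s_la; rewrite !sumn_nth_ord; under eq_bigr do rewrite -sum_nth_conj //.
by rewrite exchange_big /=; apply: eq_bigr => i _; apply: sum_nth_part.
Qed.

Section SignDominance.
Local Open Scope ring_scope.
Variables (la : seq nat).
Hypothesis s_la : sorted geq la.
Let n := sumn la.
Let sumn_conj : sumn (conj_part la) = n := sumn_conj_part s_la.
Let m : {ffun 'I_n -> 'I_(size (conj_part la))} := reshape_word sumn_conj.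

(** The easy half of the Gale-Ryser theorem: an injective pair is a 0-1 matrix whose column sums are
    the conjugate partition, and column j has at most the minimum of r and its sum among the first r
    rows. *)
Lemma pair_injective_dominated (v : {ffun 'I_n -> 'I_(size la)}) (r : nat) :
    injectiveb (pair_word m v) ->
  (\sum_(i < size la | i < r) content v i <= \sum_(i < size la | i < r) nth 0 la i)%N.
Proof.
move/injectiveP => inj_mv.
have -> : (\sum_(i < size la | i < r) content v i = \sum_x (v x < r))%N.
  rewrite /content (partition_big v predT) //= big_mkcond /=; apply: eq_bigr => i _.
  rewrite -sum1dep_card [RHS]big_mkcond [X in if _ then X else _]big_mkcond /=.
  by case: ifP => lt_ir; [apply: eq_bigr | rewrite big1 //] => x _;
    case: eqP => // ->; rewrite lt_ir.
rewrite (partition_big m predT) //=.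
have -> : (\sum_(i < size la | i < r) nth 0 la i =
    \sum_(j < size (conj_part la)) minn r (nth 0 (conj_part la) j))%N.
  under eq_bigr do rewrite -sum_nth_part //.
  rewrite exchange_big /=; apply: eq_bigr => j _.
  under eq_bigr do rewrite -ltn_conj_part //.
  rewrite big_mkcond /= (eq_bigr (fun i : 'I_(size la) =>
    (i < minn r (nth 0 (conj_part la) j))%N : nat)).
    rewrite sum_ltn_ord; apply/minn_idPl; rewrite geq_min.
    by rewrite nth_conj_part // count_size orbT.
  by move=> i _; rewrite ltn_min; case: ltnP.
apply: leq_sum => j _; rewrite leq_min; apply/andP; split; last first.
  rewrite -(content_reshape_word sumn_conj j) /content -sum1dep_card.
  by apply: leq_sum => x _; apply: leq_b1.
pose A := [set x | (m x == j) && (v x < r)%N].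
have -> : (\sum_(x | m x == j) (v x < r) = #|v @: A|)%N.
  rewrite card_in_imset => [|x y]; last first.
    rewrite !inE => /andP[/eqP mx _] /andP[/eqP my _] eq_v.
    by apply: inj_mv; rewrite [LHS]ffunE [RHS]ffunE mx my eq_v.
  rewrite -sum1dep_card big_mkcondr /=; apply: eq_bigr => x _; by case: ltnP.
have /subset_leq_card : v @: A \subset [set i : 'I_(size la) | i < r]%N.
  by apply/subsetP=> _ /imsetP[x + ->]; rewrite !inE => /andP[].
move=> /leq_trans-> //; rewrite -sum1dep_card big_mkcond /=.
rewrite (eq_bigr (fun i : 'I_(size la) => (i < r)%N : nat)); last by move=> i _; case: ltnP.
by rewrite sum_ltn_ord geq_minl.
Qed.

(** A lexicographically larger content would violate dominance at the first difference. *)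
Lemma pair_injective_code B (v : {ffun 'I_n -> 'I_(size la)}) :
    (n < B)%N -> injectiveb (pair_word m v) ->
  (code B (content v) <= code B (fun i : 'I_(size la) => nth 0%N la i))%N.
Proof.
move=> lt_nB inj_mv; rewrite leqNgt; apply/negP=> lt_c.
have [i|v0 eq_lt lt_v0] := code_lt_first _ lt_c.
  apply: leq_ltn_trans lt_nB; rewrite -[X in (_ <= X)%N](sum_content v) (bigD1 i) //=.
  exact: leq_addr.
have := pair_injective_dominated v0.+1 inj_mv.
rewrite (bigD1 v0) //= [X in (_ <= X)%N](bigD1 v0) //=.
rewrite (eq_bigr (fun i : 'I_(size la) => nth 0%N la i)); last first.
  move=> i /andP[le_i ne_i]; apply: eq_lt.
  by rewrite ltn_neqAle ne_i -ltnS.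
by rewrite leq_add2r leqNgt lt_v0.
Qed.

(** The 0-1 matrix is the diagram of la: z lists its cells, and g rearranges the list so that the
    columns read m. *)
Lemma pair_injective_exists (u := reshape_word (erefl (sumn la))) :
  exists2 v, v \in same_content u & injectiveb (pair_word m v).
Proof.
have [z content_z] : exists z : {ffun 'I_n -> 'I_(size la) * 'I_(size (conj_part la))},
    content z =1 (fun p => (p.2 < nth 0%N la p.1)%N : nat).
  apply: content_word.
  rewrite -(pair_bigA _ (fun (i : 'I_(size la)) (j : 'I_(size (conj_part la))) =>
     (j < nth 0%N la i)%N : nat)) /=.
  by under eq_bigr do rewrite sum_nth_part //; rewrite -sumn_nth_ord.
have fst_z : content (wfst z) =1 content u.
  move=> i; rewrite content_wfst content_reshape_word -(sum_nth_part i s_la).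
  by apply: eq_bigr => j _; rewrite content_z.
have snd_z : content (wsnd z) =1 content m.
  move=> j; rewrite content_wsnd content_reshape_word -(sum_nth_conj _ s_la).
  by apply: eq_bigr => i _; rewrite content_z.
have [g def_m] := content_orbit snd_z.
exists (wact (wfst z) g).
  by apply/same_contentP=> i; rewrite content_wact.
rewrite def_m; apply/injectiveP=> x y; rewrite !ffunE => -[eq2 eq1].
apply: (@perm_inj _ g); apply: contraTeq isT => ne_g.
have := content_z (z (g x)); rewrite /content (cardsD1 (g x)) (cardsD1 (g y)).
rewrite !inE eqxx eq_sym ne_g /=; have -> : z (g y) = z (g x).
  by rewrite [LHS]surjective_pairing [RHS]surjective_pairing eq1 eq2.
by rewrite eqxx; case: (_ < _)%N.
Qed.

End SignDominance.

(** * The virtual character psi *)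

Section PermChar.
Local Open Scope ring_scope.
Variables (n : nat) (T : finType).
Implicit Types a b : T -> nat.

Definition permw a b : 'CF([set: 'S_n]) :=
  if [pick u in wset n a b] is Some u then 'Ind[[set: 'S_n], wstab u] 1 else 0.

Lemma permwE a b (g : 'S_n) : permw a b g = (nfix (wset n a b) g)%:R.
Proof.
rewrite /permw; case: pickP => [u ab_u | ab0].
  by rewrite cfInd_wstab (wset_same_content ab_u).
rewrite cfunE /nfix (_ : [set _ in _ | _] = set0) ?cards0 //.
by apply/setP=> v; rewrite [LHS]inE ab0 inE.
Qed.

Lemma permw_wset a b a' b' : wset n a b = wset n a' b' -> permw a b = permw a' b'.
Proof. by move=> eq_ab; apply/cfunP=> g; rewrite !permwE eq_ab. Qed.

Lemma permw_char a b : permw a b \is a character.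
Proof.
rewrite /permw; case: pickP => [u _ | _]; last exact: cfun0_char.
by apply: cfInd_char; apply: cfun1_char.
Qed.

Lemma permw_Ind a b u : u \in wset n a b -> permw a b = 'Ind[[set: 'S_n], wstab u] 1.
Proof.
move=> ab_u; apply/cfunP=> g.
by rewrite permwE cfInd_wstab (wset_same_content ab_u).
Qed.

Lemma permw1 a b : permw a b 1%g = #|wset n a b|%:R.
Proof.
rewrite permwE /nfix; congr (_%:R); apply: eq_card => u.
by rewrite !inE wact1 eqxx andbT.
Qed.

Lemma cfdot_permw N a b a' b' : (n <= N)%N -> (\sum_i a i = n + \sum_i b i)%N ->
  '[permw a b, permw a' b'] = #|margins N a b a' b'|%:R.
Proof.
move=> le_nN sum_ab; rewrite cfdotE.
under eq_bigr do rewrite !permwE conjC_nat -natrM.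
rewrite -natr_sum (eq_bigl predT) => [|g]; last by rewrite inE.
rewrite (sum_nfix_mul a' b' le_nN sum_ab) cardsT card_Sn natrM mulKf //.
by rewrite pnatr_eq0 -lt0n fact_gt0.
Qed.

End PermChar.

Section ChiPart.
Local Open Scope ring_scope.
Variables (la : seq nat).
Hypothesis la_part : is_part la.

Let s := size la.
Let n := sumn la.
Let X (i : 'I_s) : nat := (nth 0%N la i + (s - i.+1))%N.
Let d (w : 'S_s) (i : 'I_s) : nat := (s - (w i).+1)%N.
Let s_la := part_sorted la_part.
Let N := (n + s)%N.
Let row (i : 'I_s) : nat := nth 0%N la i.

Definition psi : 'CF([set: 'S_n]) := \sum_(w : 'S_s) (-1) ^+ odd_perm w *: permw n X (d w).

Let sigma : 'CF([set: 'S_n]) := 'Ind[[set: 'S_n]] (sign_char (young n (conj_part la))).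

Lemma row_le i : (row i <= n)%N.
Proof. exact: nth_leq_sumn. Qed.

Lemma X_le i : (X i <= N)%N.
Proof. by rewrite leq_add ?row_le ?leq_subr. Qed.

Lemma X_dec : {homo X : i j / (i < j)%N >-> (j < i)%N}.
Proof.
move=> i j lt_ij; have := nth_sorted_geq s_la (ltnW lt_ij).
by rewrite /X; have := ltn_ord j; lia.
Qed.

Lemma X_sum : (\sum_i X i = n + \sum_(v < s) (s - v.+1))%N.
Proof. by rewrite big_split /= /n sumn_nth_ord. Qed.

Lemma X_sumw w : (\sum_i X i = n + \sum_i d w i)%N.
Proof. by rewrite X_sum; congr addn; rewrite [LHS](reindex_inj (@perm_inj _ w)). Qed.

Lemma rowE : row =1 (fun i => X i - (s - i.+1))%N.
Proof. by move=> i; rewrite /X addnK. Qed.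

(** The content be is X - d w. It agrees with la before the first point v moved by w, and exceeds it
    at v, because w v > v makes d w smaller there. *)
Lemma permwX w : permw n X (d w) = 0 \/ exists2 be : 'I_s -> nat,
    permw n X (d w) = permw n be (fun=> 0%N) &
    (forall i, be i <= N)%N /\ (code N.+2 row <= code N.+2 be ?= iff (w == 1%g))%N.
Proof.
have [/forallP ge_X | /forallPn[i]] := boolP [forall i, d w i <= X i]%N; last first.
  rewrite -ltnNge => lt_X; left; apply/cfunP=> g; rewrite permwE cfunE.
  rewrite /nfix (_ : [set _ in _ | _] = set0) ?cards0 //; apply/setP=> v; rewrite in_set0.
  apply/negP; rewrite inE => /andP[/wsetP/(_ i) eq_i _].
  by rewrite -eq_i ltnNge leq_addl in lt_X.
right; exists (fun i => X i - d w i)%N.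
  apply: permw_wset; apply/setP=> v; apply/wsetP/wsetP=> eq_v i; have := eq_v i.
    by rewrite addn0 => <-; rewrite addnK.
  by rewrite addn0 => ->; rewrite subnK.
split=> [i|]; first by rewrite (leq_trans (leq_subr _ _)) ?X_le.
have [-> | w_neq1] := eqVneq w 1%g.
  have -> : code N.+2 row = code N.+2 (fun i => X i - d 1%g i)%N.
    by rewrite /code; apply: eq_bigr => i _; rewrite /d perm1 rowE.
  exact: leqif_refl.
suff lt_c : (code N.+2 row < code N.+2 (fun i => X i - d w i))%N.
  by split; [exact: ltnW | exact: ltn_eqF].
have [v fix_v lt_v] := first_nonfixed w_neq1.
apply: (code_lt (v := v)) => [i | i lt_iv |].
- by rewrite ltnW // !ltnS (leq_trans (row_le i)) // leq_addr.
- by rewrite /d fix_v // rowE.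
by rewrite rowE /X /d; have := ltn_ord (w v); have := ltn_ord v; have := ge_X v; rewrite /X /d; lia.
Qed.

Lemma cfdot_psi w : '[psi, permw n X (d w)] = (w == 1%g)%:R.
Proof.
have [eq0 | [be eq_be [be_le le_code]]] := permwX w.
  have [w1 | _] := eqVneq w 1%g; last by rewrite eq0 cfdot0r.
  have := content_reshape_word (erefl (sumn la)); set u := reshape_word _ => content_u.
  have ab_u : u \in wset n X (d w).
    by apply/wsetP=> i; rewrite w1 /d perm1 content_u.
  have := congr1 (fun f : 'CF(_) => f 1%g) eq0; rewrite permw1 cfunE => /eqP.
  by rewrite pnatr_eq0 cards_eq0 => /eqP eq_set0; rewrite eq_set0 inE in ab_u.
rewrite eq_be cfdot_suml.
have := sum_margins_sign X_le (leq_addr _ _) X_dec X_sum (fun i => leq_addl _ _) be_le.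
have code_row : code N.+2 row = code N.+2 (fun i => X i - (s - i.+1))%N.
  by rewrite /code; apply: eq_bigr => i _; rewrite rowE.
rewrite -code_row => /(_ le_code.1); rewrite [_ == code _ _]eq_sym le_code.2.
move/(congr1 (intr : int -> algC)); rewrite rmorph_nat rmorph_sum /= => <-.
apply: eq_bigr => w' _.
rewrite cfdotZl (cfdot_permw _ _ (leq_addr s n) (X_sumw w')) rmorphM rmorphXn.
by rewrite rmorphN rmorph1 rmorph_nat.
Qed.

Lemma psi_vchar : psi \in ('Z[irr [set: 'S_n]])%g.
Proof.
by apply: rpred_sum => w _; rewrite rpredZsign char_vchar ?permw_char.
Qed.

Lemma psi_norm : '[psi] = 1.
Proof.
rewrite {2}/psi cfdot_sumr (bigD1 1%g) //= big1 => [|w /negPf w_neq1].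
  by rewrite odd_perm1 expr0 scale1r cfdot_psi eqxx addr0.
by rewrite cfdotZr cfdot_psi w_neq1 mulr0.
Qed.

Let sumn_conj : sumn (conj_part la) = n := sumn_conj_part s_la.

Lemma sigma_wstab :
  sigma = 'Ind[[set: 'S_n]] (sign_char (wstab_group (reshape_word sumn_conj))).
Proof. by rewrite /sigma (young_wstab sumn_conj). Qed.

Lemma sigma_char : sigma \is a character.
Proof. by rewrite cfInd_char ?sign_char_is_char. Qed.

(** A non-zero pairing would need a 0-1 matrix whose row sums lie lexicographically above la. *)
Lemma cfdot_permw_sigma w : w != 1%g -> '[permw n X (d w), sigma] = 0.
Proof.
move=> w_neq1; rewrite sigma_wstab.
have [-> | [be -> [be_le le_code]]] := permwX w; first exact: cfdot0l.
rewrite /permw; case: pickP => [u be_u | _]; last exact: cfdot0l.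
rewrite cfdot_perm_sign (_ : [set _ in _ | _] = set0) ?cards0 ?mulr0 //.
apply/setP=> v; rewrite in_set0; apply/negP; rewrite inE => /andP[/same_contentP eq_v inj_v].
have lt_n : (n < N.+2)%N by rewrite ltnW // !ltnS leq_addr.
have := pair_injective_code lt_n inj_v.
have -> : code N.+2 (content v) = code N.+2 be.
  rewrite /code; apply: eq_bigr => i _; rewrite eq_v; congr (_ * _)%N.
  by have /wsetP/(_ i) := be_u; rewrite addn0.
by rewrite -/(code N.+2 row) leqNgt ltn_neqAle le_code.1 (le_code.2) w_neq1.
Qed.

Let rho := permw n X (d 1%g).

Lemma row_word_wset : reshape_word (erefl (sumn la)) \in wset n X (d 1%g).
Proof. by apply/wsetP=> i; rewrite content_reshape_word /d perm1. Qed.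

Lemma rho_Ind : rho = 'Ind[[set: 'S_n], young n la] 1.
Proof. by rewrite /rho (permw_Ind row_word_wset) (young_wstab (erefl (sumn la))). Qed.

Lemma cfdot_rho_sigma : '[rho, sigma] != 0.
Proof.
rewrite /rho (permw_Ind row_word_wset) sigma_wstab cfdot_perm_sign.
rewrite mulf_neq0 ?invr_eq0 ?neq0CG // pnatr_eq0 cards_eq0; apply/set0Pn.
have [v v_la inj_v] := pair_injective_exists s_la.
by exists v; rewrite inE v_la.
Qed.

(** Norm 1 makes [psi] irreducible up to sign, and its pairing 1 with the character [rho] fixes the
    sign. A constituent of [sigma] is orthogonal to the terms w != 1, so a common constituent of
    [rho] and [sigma] pairs with [psi] as with [rho]: not to 0. *)
Lemma chi_partE : chi_part la = psi.
Proof.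
have [b [i def_psi]] := vchar_norm1P psi_vchar psi_norm.
have psi_rho : '[psi, rho] = 1 by rewrite cfdot_psi eqxx.
have psi_i : psi = 'chi_i.
  case: b def_psi psi_rho => def_psi; last by rewrite def_psi expr0 scale1r.
  rewrite def_psi expr1 scaleN1r cfdotNl => /eqP; rewrite eqr_oppLR => /eqP eqN1.
  have : 0 <= '['chi_i, rho] by rewrite natr_ge0 // Cnat_cfdot_char ?irr_char ?permw_char.
  by rewrite eqN1 oppr_ge0 ler10.
have psi_sigma : '[psi, sigma] = '[rho, sigma].
  rewrite /psi cfdot_suml (bigD1 1%g) //= odd_perm1 expr0 scale1r.
  by rewrite big1 ?addr0 // => w w_neq1; rewrite cfdotZl cfdot_permw_sigma ?mulr0.
have chi_i : is_chi_index la i.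
  rewrite /is_chi_index -/n -rho_Ind -/sigma !irr_consttE !(cfdotC _ 'chi_i) -psi_i.
  by rewrite psi_rho psi_sigma !conjC_eq0 oner_eq0 cfdot_rho_sigma.
have chi_uniq j : is_chi_index la j -> j = i.
  rewrite /is_chi_index -/n -rho_Ind -/sigma => /andP[rho_j sigma_j].
  have: '[psi, 'chi_j] != 0.
    rewrite /psi cfdot_suml (bigD1 1%g) //= odd_perm1 expr0 scale1r big1 ?addr0 // => w w_neq1.
    rewrite cfdotZl; have [-> | ne0] := eqVneq '[permw n X (d w), 'chi_j] 0; first by rewrite mulr0.
    have := constt_ortho_char (permw_char n X (d w)) sigma_char ne0 sigma_j
      (cfdot_permw_sigma w_neq1).
    by rewrite cfnorm_irr => /eqP; rewrite oner_eq0.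
  by rewrite psi_i cfdot_irr pnatr_eq0 eqb0 negbK => /eqP.
rewrite /chi_part; case: pickP => [j chi_j | /(_ i)]; last by rewrite chi_i.
by rewrite /= (chi_uniq j chi_j) psi_i.
Qed.

(** Modulo 2 the signs in the degree of [psi] disappear and leave a sum that is symmetric in the
    beads; beta-sets need not be sorted from here on. *)
Lemma odd_part_wset : odd_part la = \big[addb/false]_(w : 'S_s) odd #|wset n X (d w)|.
Proof.
rewrite /odd_part la_part /= chi_partE.
have /natrP[k def_k] : psi 1%g \in Num.nat by rewrite -chi_partE Cnat_irr1.
have def_z : (k : int) = \sum_(w : 'S_s) (-1) ^+ odd_perm w * #|wset n X (d w)|%:R.
  apply: (@intr_inj algC); rewrite rmorph_sum /= -[LHS]/(k%:R) -def_k sum_cfunE.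
  apply: eq_bigr => w _; rewrite cfunE permw1 rmorphM rmorphXn rmorphN rmorph1.
  by rewrite rmorph_nat.
rewrite def_k natrK.
have -> : odd k = odd `|Posz k| by [].
rewrite def_z; elim/big_rec2: _ => // w p z _ <-.
case: (odd_perm w); rewrite ?expr1 ?expr0; move: #|_| => c; lia.
Qed.

End ChiPart.

(** * The parity of the degree as a function of the beta-set *)

Lemma big_addb_sym s (f : 'I_s -> 'I_s -> bool) :
    (forall i j, f i j = f j i) ->
  \big[addb/false]_i \big[addb/false]_j f i j = \big[addb/false]_i f i i.
Proof.
move=> f_sym.
have split_i i : \big[addb/false]_j f i j = f i i (+)
    (\big[addb/false]_(j < s | i < j) f i j (+) \big[addb/false]_(j < s | j < i) f i j).
  rewrite (bigD1 i) //= (bigID (fun j : 'I_s => i < j)) /=.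
  by congr (_ (+) (_ (+) _)); apply: eq_bigl => j; rewrite -val_eqE /=; case: ltngtP.
under eq_bigr do rewrite split_i.
rewrite !big_split /= [X in _ (+) (X (+) _)](exchange_big_dep predT) //=.
rewrite [X in _ (+) (X (+) _)](eq_bigr (fun i : 'I_s => \big[addb/false]_(j < s | j < i) f i j)).
  by rewrite addbb addbF.
by move=> i _; apply: eq_bigr => j _; apply: f_sym.
Qed.

Section WordCount.
Variable T : finType.
Implicit Types a b : T -> nat.

Definition dec a i k : T -> nat := fun j => if j == i then a j - k else a j.

Lemma wset_ext n a a' b b' : a =1 a' -> b =1 b' -> wset n a b = wset n a' b'.
Proof.
by move=> eq_a eq_b; apply/setP=> u; rewrite !inE; apply: eq_forallb => t; rewrite eq_a eq_b.
Qed.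

Lemma card_wset_rec n a b :
  #|wset n.+1 a b| = \sum_(i | 0 < a i) #|wset n (dec a i 1) b|.
Proof.
rewrite -sum1_card (partition_big (fun u : {ffun 'I_n.+1 -> T} => u ord0) predT) //=.
rewrite [RHS]big_mkcond /=; apply: eq_bigr => i _.
pose tl (u : {ffun 'I_n.+1 -> T}) : {ffun 'I_n -> T} := [ffun x => u (lift ord0 x)].
pose cs (u : {ffun 'I_n -> T}) : {ffun 'I_n.+1 -> T} :=
  [ffun x => oapp u i (unlift ord0 x)].
have csK u : tl (cs u) = u by apply/ffunP=> x; rewrite !ffunE liftK.
have tlK (u : {ffun 'I_n.+1 -> T}) : u ord0 = i -> cs (tl u) = u.
  move=> u0; apply/ffunP=> x; rewrite ffunE.
  by case: unliftP => [y ->|->]; rewrite /= ?ffunE.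
have content_cs u t : content (cs u) t = (i == t) + content u t.
  rewrite /content -!sum1dep_card [LHS]big_mkcond [X in _ + X]big_mkcond big_ord_recl /=.
  rewrite ffunE unlift_none /=; congr (_ + _).
  by apply: eq_bigr => x _; rewrite ffunE liftK.
rewrite (reindex_onto cs tl) /=; last by move=> u /andP[_ /eqP]; apply: tlK.
case: posnP => [a0 | a_gt0].
  apply: big1 => u /andP[/andP[/wsetP/(_ i)]].
  by rewrite content_cs eqxx a0.
rewrite -sum1_card; apply: eq_bigl => u; rewrite csK eqxx andbT.
have -> : cs u ord0 == i by rewrite ffunE unlift_none.
rewrite andbT !inE; apply: eq_forallb => t; rewrite content_cs /dec [i == t]eq_sym.
by case: (eqVneq t i) => [->|_] //=; apply/eqP/eqP; lia.
Qed.

Lemma card_wset_perm n a b (p : {perm T}) :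
  #|wset n (fun i => a (p i)) (fun i => b (p i))| = #|wset n a b|.
Proof.
pose f (q : {perm T}) (u : {ffun 'I_n -> T}) : {ffun 'I_n -> T} := [ffun x => q (u x)].
have fK q : cancel (f q) (f q^-1%g) by move=> u; apply/ffunP=> x; rewrite !ffunE permK.
rewrite -(card_imset _ (can_inj (fK p))); apply: eq_card => u.
have content_f v t : content (f p v) (p t) = content v t.
  by rewrite /content; apply: eq_card => x; rewrite !inE ffunE (inj_eq perm_inj).
apply/imsetP/wsetP=> [[v /wsetP v_ab -> t]|u_ab].
  by rewrite -{1 2 3}(permKV p t) content_f v_ab.
exists (f p^-1%g u); last by rewrite -{1}[p]invgK fK.
apply/wsetP=> t; rewrite -content_f.
by have -> : f p (f p^-1%g u) = u; [rewrite -{1}[p]invgK fK | rewrite u_ab].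
Qed.

Lemma card_wset0 a b : #|wset 0 a b| = [forall i, b i == a i].
Proof.
have content0 (u : {ffun 'I_0 -> T}) t : content u t = 0.
  by apply/eqP; rewrite cards_eq0; apply/eqP/setP=> -[].
case: (boolP [forall i, _]) => [/forallP eq_ab | ne_ab].
  apply/eqP/cards1P; exists (ffun0 (card_ord 0)); apply/setP=> u; rewrite in_set1.
  have -> : u = ffun0 (card_ord 0) by apply/ffunP=> -[].
  by rewrite eqxx; apply/wsetP=> t; rewrite content0 (eqP (eq_ab t)).
apply/eqP; rewrite cards_eq0; apply/eqP/setP=> u; rewrite in_set0.
apply: contraNF ne_ab => /wsetP u_ab; apply/forallP=> t.
by rewrite -u_ab content0.
Qed.

End WordCount.

Section Parity.
Variable s : nat.
Implicit Types X : 'I_s -> nat.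

Definition parity n X : bool :=
  \big[addb/false]_(w : 'S_s) odd #|wset n X (fun i => s - (w i).+1)|.

Lemma parity_ext n X Y : X =1 Y -> parity n X = parity n Y.
Proof. by move=> eqXY; apply: eq_bigr => w _; rewrite (wset_ext n eqXY (frefl _)). Qed.

(* Squaring is additive modulo 2: composing two recursions for 2 ^ k, the
   terms with i != j cancel in pairs and those with i = j give 2 ^ k.+1. *)
Lemma parity_rec k n X :
  parity (n + 2 ^ k) X = \big[addb/false]_(i | 2 ^ k <= X i) parity n (dec X i (2 ^ k)).
Proof.
elim: k n X => [|k IH] n X.
  rewrite expn0 addn1 exchange_big /=; apply: eq_bigr => w _.
  by rewrite card_wset_rec (big_morph odd oddD (erefl _)).
rewrite expnS mul2n -addnn addnA IH big_mkcond /=.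
pose F i j := [&& 2 ^ k <= X i, 2 ^ k <= dec X i (2 ^ k) j &
                 parity n (dec (dec X i (2 ^ k)) j (2 ^ k))].
transitivity (\big[addb/false]_i \big[addb/false]_j F i j).
  apply: eq_bigr => i _; rewrite /F; case: leqP => _; last by rewrite big1.
  by rewrite IH big_mkcond /=; apply: eq_bigr => j _; case: leqP.
rewrite big_addb_sym => [|i j].
  rewrite [RHS]big_mkcond; apply: eq_bigr => i _; rewrite /F {1}/dec eqxx /=.
  rewrite andbA; have -> : (2 ^ k <= X i) && (2 ^ k <= X i - 2 ^ k) = (2 ^ k + 2 ^ k <= X i) by lia.
  case: leqP => //= _; apply: parity_ext => j.
  by rewrite /dec; case: eqP => // _; lia.
have [-> // | ne_ij] := eqVneq i j.
rewrite /F /dec (negPf ne_ij) eq_sym (negPf ne_ij) andbCA; congr [&& _, _ & _].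
by apply: parity_ext => l; case: eqP; case: eqP => // -> eq_ij; rewrite eq_ij eqxx in ne_ij.
Qed.

Lemma parity_perm n X (p : 'S_s) : parity n (fun i => X (p i)) = parity n X.
Proof.
rewrite /parity [RHS](reindex_inj (mulgI p^-1%g)) /=; apply: eq_bigr => w _.
rewrite -(card_wset_perm n X (fun i => s - ((p^-1 * w)%g i).+1) p).
by congr (odd #|pred_of_set _|); apply: wset_ext => i //; rewrite permM permK.
Qed.

(** Multiplication by the transposition of i and j pairs the even w with the odd ones, and paired
    terms count equally many words. *)
Lemma parity_dup n X i j : i != j -> X i = X j -> parity n X = false.
Proof.
move=> ne_ij eqX; rewrite /parity (bigID (fun w : 'S_s => odd_perm w)) /=.
rewrite [X in X (+) _](reindex_inj (mulgI (tperm i j))) /=.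
set S := (X in X (+) _); rewrite (_ : \big[_/_]_(w | ~~ odd_perm w) _ = S) ?addbb //.
apply: eq_big => w; first by rewrite odd_permM odd_tperm ne_ij addTb.
move=> _; rewrite -(card_wset_perm n X (fun m => s - ((tperm i j * w)%g m).+1) (tperm i j)).
congr (odd #|pred_of_set _|); apply: wset_ext => m; first by case: tpermP => [->|->|].
by rewrite permM tpermK.
Qed.

Lemma parity0 X : injective X -> (forall i, X i < s) -> parity 0 X.
Proof.
move=> injX ltX; pose p0 i := rev_ord (Ordinal (ltX i)).
have inj_p0 : injective p0 by move=> i j /rev_ord_inj[/injX].
rewrite /parity (bigD1 (perm inj_p0)) //= big1 ?addbF => [|w ne_w]; rewrite card_wset0.
  case: forallP => // -[] i; apply/eqP; rewrite permE /=; have := ltX i; lia.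
case: forallP => // eq_w; case/eqP: ne_w; apply/permP=> i; apply/val_inj.
by rewrite permE /= -(eqP (eq_w i)) subnSK // subKn // ltnW.
Qed.

End Parity.

(** * Beta-sets and bead moves *)

Implicit Types (X Y C la mu nu : seq nat) (x y z s : nat).

(* For uniq X, the size of the partition with beta-set X; the subtraction is
   then not truncated, by leq_bin_sumn. *)
Definition wt X : nat := sumn X - 'C(size X, 2).

Definition mv X x y : seq nat := [seq if z == x then y else z | z <- X].

Lemma size_mv X x y : size (mv X x y) = size X.
Proof. exact: size_map. Qed.

Lemma mem_mv X x y z :
  x \in X -> (z \in mv X x y) = (z == y) || (z \in X) && (z != x).
Proof.
move=> Xx; apply/mapP/orP=> [[v Xv ->] | [/eqP-> | /andP[Xz ne_z]]].
- by case: (eqVneq v x) => [_|ne_v]; [left | right; rewrite Xv].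
- by exists x; rewrite ?eqxx.
by exists z; rewrite ?(negPf ne_z).
Qed.

Lemma mv_uniq X x y : uniq X -> y \notin X -> uniq (mv X x y).
Proof.
move=> uX Xy; rewrite map_inj_in_uniq // => u v Xu Xv.
case: eqP => [->|_]; case: eqP => [->|_] // eq_uv.
  by rewrite eq_uv Xv in Xy.
by rewrite -eq_uv Xu in Xy.
Qed.

Lemma sumn_mv X x y : uniq X -> x \in X -> sumn (mv X x y) + x = sumn X + y.
Proof.
move=> uX Xx; rewrite !sumnE big_map (bigD1_seq x) //= eqxx [in RHS](bigD1_seq x) //=.
rewrite (eq_bigr id) => [|z /negPf->] //.
by move: (\sum_(_ <- _ | _) _) => S; lia.
Qed.

Lemma exists_geq_size X : uniq X -> 0 < size X -> exists2 x, x \in X & (size X).-1 <= x.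
Proof.
move=> uX X_gt0; apply/hasP; apply: contraLR X_gt0 => /hasPn ltX; rewrite -eqn0Ngt.
have : size X <= size (iota 0 (size X).-1).
  by apply: uniq_leq_size => // x /ltX; rewrite mem_iota /= -ltnNge.
by rewrite size_iota; case: (size X) => // s; rewrite ltnn.
Qed.

Lemma sumn_rem X x : x \in X -> sumn X = x + sumn (rem x X).
Proof. by move=> Xx; rewrite !sumnE (perm_big _ (perm_to_rem Xx)) big_cons. Qed.

Lemma bin2S s : 'C(s.+1, 2) = s + 'C(s, 2).
Proof. by rewrite binS bin1 addnC. Qed.

Lemma leq_bin_sumn X : uniq X -> 'C(size X, 2) <= sumn X.
Proof.
move: {2}(size X) (erefl (size X)) => s; elim: s X => [|s IH] X size_X uX.
  by rewrite size_X.
have X_gt0 : 0 < size X by rewrite size_X.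
have [x Xx] := exists_geq_size uX X_gt0.
have size_rem : size (rem x X) = s by rewrite size_rem // size_X.
have := IH _ size_rem (rem_uniq x uX).
rewrite size_rem size_X bin2S (sumn_rem Xx) /=; lia.
Qed.

Lemma wt0_iota X : uniq X -> wt X = 0 -> X =i iota 0 (size X).
Proof.
move: {2}(size X) (erefl (size X)) => s; elim: s X => [|s IH] X size_X uX wt0.
  by case: X size_X {uX wt0}.
have X_gt0 : 0 < size X by rewrite size_X.
have [x Xx] := exists_geq_size uX X_gt0.
have size_r : size (rem x X) = s by rewrite size_rem // size_X.
have := leq_bin_sumn (rem_uniq x uX); have := wt0.
rewrite /wt size_X bin2S size_r (sumn_rem Xx) /= => eq0 le_bin le_sx.
have def_x : x = s by lia.
have wt_r : wt (rem x X) = 0 by rewrite /wt size_r; lia.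
move=> z; rewrite (perm_mem (perm_to_rem Xx)) inE (IH _ size_r (rem_uniq x uX) wt_r).
by rewrite size_r -[0 :: _]/(iota 0 s.+1) !mem_iota def_x !add0n /= ltnS [RHS]leq_eqVlt.
Qed.

Lemma wtE X : uniq X -> wt X + 'C(size X, 2) = sumn X.
Proof. by move=> uX; rewrite subnK // leq_bin_sumn. Qed.

Lemma wt_mv X x y : uniq X -> x \in X -> y \notin X -> wt (mv X x y) + x = wt X + y.
Proof.
move=> uX Xx Xy; have := sumn_mv y uX Xx; have := wtE uX; have := wtE (mv_uniq x uX Xy).
by rewrite size_mv; lia.
Qed.

Lemma wt_gt0_move X : uniq X -> 0 < wt X ->
  exists2 x, x \in X & (0 < x) && (x.-1 \notin X).
Proof.
move=> uX wt_gt0; apply/hasP; apply: contraLR wt_gt0 => /hasPn no_move.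
have closed x : x \in X -> forall y, y <= x -> y \in X.
  elim: x => [|x IH] Xx y; first by rewrite leqn0 => /eqP->.
  rewrite leq_eqVlt => /predU1P[-> // | /IH]; apply.
  by have := no_move _ Xx; rewrite negbK.
rewrite -leqNgt leqn0 subn_eq0.
have sub : {subset X <= iota 0 (size X)}.
  move=> x Xx; rewrite mem_iota /= ltnNge; apply/negP=> le_x.
  suff: size (iota 0 (size X).+1) <= size X by rewrite size_iota ltnn.
  apply: uniq_leq_size => [|y]; first exact: iota_uniq.
  by rewrite mem_iota /= ltnS => le_y; apply: closed Xx _ (leq_trans le_y le_x).
have eq_X := uniq_min_size uX sub; rewrite size_iota leqnn in eq_X.
have perm_X : perm_eq X (iota 0 (size X)).
  by apply: uniq_perm => //; [exact: iota_uniq | exact: (eq_X isT).2].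
rewrite sumnE (perm_big _ perm_X) /= -[X in _ <= X](bin2_sum (size X)).
by rewrite -[X in iota _ X]subn0 -/(index_iota 0 _).
Qed.

Definition par X : bool :=
  parity (wt X) (fun i : 'I_(size X) => nth 0 X i).

Lemma parE s X : size X = s -> par X = parity (wt X) (fun i : 'I_s => nth 0 X i).
Proof. by move=> <-. Qed.

Lemma par_perm X Y : perm_eq X Y -> par X = par Y.
Proof.
move=> eqXY; have eq_sz := perm_size eqXY.
have eq_wt : wt X = wt Y.
  by rewrite /wt eq_sz !sumnE (perm_big _ eqXY).
have [p def_X] := tuple_permP (t := in_tuple Y) eqXY.
rewrite (parE eq_sz) eq_wt -[RHS](parity_perm _ _ p); apply: parity_ext => i.
rewrite def_X -[RHS](tnth_nth 0 (in_tuple Y)).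
by rewrite -[LHS](tnth_nth 0 [tuple tnth (in_tuple Y) (p i) | i < size Y]) tnth_mktuple.
Qed.

Lemma par_eq X Y : uniq X -> uniq Y -> X =i Y -> par X = par Y.
Proof. by move=> uX uY eqXY; apply/par_perm/uniq_perm. Qed.

Lemma par_wt0 X : uniq X -> wt X = 0 -> par X.
Proof.
move=> uX wt0; rewrite /par wt0; have eqX := wt0_iota uX wt0.
apply: parity0 => [i j eq_ij | i].
  by apply/val_inj/eqP; rewrite /= -(nth_uniq 0 _ _ uX) ?eq_ij.
by have := mem_nth 0 (ltn_ord i); rewrite eqX mem_iota.
Qed.

(** In [parity_rec], lowering a bead onto an occupied position repeats an entry, and [parity_dup]
    discards the term. *)
Lemma par_rec k X : uniq X -> 2 ^ k <= wt X ->
  par X = \big[addb/false]_(x <- X | (2 ^ k <= x) && (x - 2 ^ k \notin X))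
            par (mv X x (x - 2 ^ k)).
Proof.
move=> uX le_k; rewrite {1}/par -{1}(subnK le_k) parity_rec.
rewrite [RHS](big_nth 0) big_mkord [LHS]big_mkcond [RHS]big_mkcond.
apply: eq_bigr => i _; case: leqP => //= le_i.
have Xi : nth 0 X i \in X by apply: mem_nth.
case: ifPn => [Xi' | /negPn Xj].
  rewrite (parE (size_mv X _ _)); have eq_wt := wt_mv uX Xi Xi'.
  have -> : wt (mv X (nth 0 X i) (nth 0 X i - 2 ^ k)) = wt X - 2 ^ k by lia.
  apply: parity_ext => j; rewrite (nth_map 0) //.
  by rewrite nth_uniq // /dec -val_eqE; case: eqP => // /val_inj ->.
have [j lt_j def_j] := nthP 0 Xj.
have ne_ij : i != Ordinal lt_j.
  apply/eqP=> eq_ij; have := congr1 (nth 0 X \o val) eq_ij.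
  by rewrite /= def_j; have := expn_gt0 2 k; lia.
by apply: (parity_dup _ ne_ij); rewrite /dec eqxx eq_sym (negPf ne_ij) /= def_j.
Qed.

(* The beta-set of the same partition with one more bead. *)
Definition shift X : seq nat := 0 :: map S X.

Lemma mem_shift X x : (x \in shift X) = (x == 0) || (x.-1 \in X).
Proof. by case: x => [|x]; rewrite inE //= mem_map //; apply: succn_inj. Qed.

Lemma mem_shiftS X x : (x.+1 \in shift X) = (x \in X).
Proof. by rewrite mem_shift. Qed.

Lemma shift_uniq X : uniq X -> uniq (shift X).
Proof.
move=> uX /=; rewrite map_inj_uniq ?uX ?andbT; last exact: succn_inj.
by apply/mapP=> -[].
Qed.

Lemma size_shift X : size (shift X) = (size X).+1.
Proof. by rewrite /= size_map. Qed.

Lemma wt_shift X : wt (shift X) = wt X.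
Proof.
rewrite /wt /= size_map bin2S; suff -> : sumn (map S X) = size X + sumn X by lia.
by elim: X => //= y Y ->; lia.
Qed.

Lemma mv_shift X x y : mv (shift X) x.+1 y.+1 = shift (mv X x y).
Proof.
rewrite /mv /shift /= -!map_comp; congr (_ :: _); apply: eq_map => z /=.
by rewrite eqSS; case: eqP.
Qed.

(** Both sides obey the same recursion for k = 0: the new bead 0 cannot move, and it blocks the bead
    1 just as the bead 0 of X was blocked. *)
Lemma par_shift X : uniq X -> par (shift X) = par X.
Proof.
have [n] := ubnP (wt X); elim: n X => // n IH X lt_n uX.
have [wt0 | wt_gt0] := posnP (wt X); first by rewrite !par_wt0 ?shift_uniq ?wt_shift.
rewrite (@par_rec 0 X) // (@par_rec 0 (shift X)) ?shift_uniq ?wt_shift //.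
rewrite expn0 big_cons ltnn /= big_map.
rewrite [LHS]big_mkcond [RHS]big_mkcond big_seq_cond [RHS]big_seq_cond.
apply: eq_bigr => x; rewrite andbT subn1 /= subn1 mem_shift negb_or -lt0n => Xx.
case: andP => // -[x_gt0 Xx']; rewrite -[RHS]IH ?mv_uniq //.
  by rewrite -mv_shift prednK.
by have := wt_mv uX Xx Xx'; lia.
Qed.

(** * Removing the hook of the top binary digit *)

Definition movable e X x : bool := [&& x \in X, e <= x & x - e \notin X].

Lemma movable_mv e X x : uniq X -> movable e X x ->
  uniq (mv X x (x - e)) /\ wt (mv X x (x - e)) + e = wt X.
Proof.
move=> uX /and3P[Xx le_x Xx']; split; first exact: mv_uniq.
by have := wt_mv uX Xx Xx'; lia.
Qed.

Lemma movable_leq e X x : uniq X -> movable e X x -> e <= wt X.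
Proof. by move=> uX /(movable_mv uX)[_ <-]; apply: leq_addl. Qed.

(** Moving one of two such beads leaves the other movable, which would force the weight up to at
    least 2e. *)
Lemma movable_inj e X x1 x2 : uniq X -> wt X < e + e ->
  movable e X x1 -> movable e X x2 -> x1 = x2.
Proof.
move=> uX lt_wt mv1 mv2; apply/eqP; apply: contraLR lt_wt => ne_x.
have [uY eq_wt] := movable_mv uX mv1.
have/movable_leq : movable e (mv X x1 (x1 - e)) x2.
  case/and3P: mv1 => Xx1 le1 X1; case/and3P: mv2 => Xx2 le2 X2.
  rewrite /movable !mem_mv // le2 Xx2 [x2 == x1]eq_sym ne_x orbT (negPf X2) orbF /=.
  by apply: contra ne_x => /eqP; lia.
by move/(_ uY); lia.
Qed.

Lemma core_closed e X x : uniq X -> wt X < e -> x \in X -> e <= x -> x - e \in X.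
Proof.
move=> uX lt_wt Xx le_x; apply: contraLR lt_wt => Xx'.
by rewrite -leqNgt; apply: (@movable_leq _ _ x uX); apply/and3P.
Qed.

Lemma par_recE k X : uniq X -> 2 ^ k <= wt X ->
  par X = \big[addb/false]_(x <- X | movable (2 ^ k) X x) par (mv X x (x - 2 ^ k)).
Proof.
move=> uX le_k; rewrite (par_rec uX le_k) big_seq_cond [RHS]big_seq_cond.
by apply: eq_bigl => x; rewrite /movable; case: (x \in X).
Qed.

Lemma par_top k X x : uniq X -> wt X < 2 ^ k + 2 ^ k -> movable (2 ^ k) X x ->
  par X = par (mv X x (x - 2 ^ k)).
Proof.
move=> uX lt_wt mv_x; rewrite (par_recE uX (movable_leq uX mv_x)).
have Xx : x \in X by case/and3P: mv_x.
rewrite big_mkcond (bigD1_seq x) //= mv_x big1 ?addbF // => y ne_y.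
by case: ifP => // mv_y; rewrite (movable_inj uX lt_wt mv_y mv_x) eqxx in ne_y.
Qed.

Lemma par_movable k X : uniq X -> 2 ^ k <= wt X -> par X ->
  exists x, movable (2 ^ k) X x.
Proof.
move=> uX le_k; rewrite (par_recE uX le_k); case: (boolP (has (movable (2 ^ k) X) X)).
  by case/hasP=> x _ mv_x _; exists x.
by move/hasPn=> no_mv; rewrite big_seq_cond big_pred0 // => x; apply/andP=> -[/no_mv/negP].
Qed.

(** Without the bead 0 every bead could be lowered by one, which takes [size X] cells away. *)
Lemma zero_mem X : uniq X -> wt X < size X -> 0 \in X.
Proof.
move=> uX; apply: contraLR => X0; rewrite -leqNgt.
have pos x : x \in X -> 0 < x by case: x X0 => // /negP.
have uY : uniq (map predn X).
  rewrite map_inj_in_uniq // => x y /pos x_gt0 /pos y_gt0 eq_xy.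
  by rewrite -(prednK x_gt0) eq_xy prednK.
have eq_sum : sumn (map predn X) + size X = sumn X.
  elim: (X) pos => //= x Y IH pos.
  have := pos x (mem_head _ _); have := IH (fun y Yy => pos y (mem_behead (s := x :: Y) Yy)); lia.
have := wtE uX; have := wtE uY; rewrite size_map; lia.
Qed.

(** * Odd one-box additions across the top hook *)

Definition addable f X y : bool := (y \in X) && (y + f \notin X).
Definition odd_addable f X y : bool := addable f X y && par (mv X y (y + f)).
(* The number of odd partitions obtained by adding an f-hook to the partition
   with beta-set X, provided that wt X + f <= size X. *)
Definition nadd f X : nat := count (odd_addable f X) X.

Lemma addable_mv f X y : uniq X -> addable f X y ->
  uniq (mv X y (y + f)) /\ wt (mv X y (y + f)) = wt X + f.
Proof.
move=> uX /andP[Xy Xy']; split; first exact: mv_uniq.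
by have := wt_mv uX Xy Xy'; lia.
Qed.

Section TopBit.
Variables (k e : nat) (X : seq nat) (z : nat).
Hypotheses (def_e : 2 ^ k = e) (uX : uniq X) (lt_wt : (wt X).+1 < e + e).
Hypotheses (Xze : z + e \in X) (Xz : z \notin X) (X0 : 0 \in X).

Let X' := mv X (z + e) z.

Let mv_ze : movable e X (z + e).
Proof. by rewrite /movable Xze addnK Xz leq_addl. Qed.
Let uX' : uniq X'. Proof. exact: mv_uniq. Qed.
Let wtX' : wt X' + e = wt X.
Proof. by have [_] := movable_mv uX mv_ze; rewrite addnK. Qed.
Let z_gt0 : 0 < z. Proof. by rewrite lt0n; apply: contraNneq Xz => ->. Qed.
Let memX' v : (v \in X') = (v == z) || (v \in X) && (v != z + e).
Proof. exact: mem_mv. Qed.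
Let e_gt1 : 1 < e. Proof. by have := expn_gt0 2 k; rewrite def_e; lia. Qed.

(* X' is X with its unique 2 ^ k-hook removed. If moving the bead y of X' to
   y.+1 is an odd extension of X', then moving the bead top_add y of X is one of
   X; its unique 2 ^ k-hook is then carried by the bead top_mv y. *)
Definition top_add y := if y == z then z + e else if y.+1 == z + e then z.-1 else y.
Definition top_sub y := if y == z + e then z else if y.+1 == z then (z + e).-1 else y.

Definition top_mv y :=
  if y == z then (z + e).+1 else if y.+1 == z + e then y else z + e.

(** Away from z and z + e the two moves commute. If y = z, then X raises z + e to (z + e).+1, which
    drops by e to z.+1. If y.+1 = z + e, then X fills z from z.-1 and y drops to z.-1; there z.-1 is
    occupied because X', of weight below e, is an e-core. *)
Lemma top_addP y (Z := mv X (top_add y) (top_add y + 1)) : addable 1 X' y ->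
  [/\ addable 1 X (top_add y), top_sub (top_add y) = y, movable e Z (top_mv y),
      mv Z (top_mv y) (top_mv y - e) =i mv X' y (y + 1) & par Z = par (mv X' y (y + 1))].
Proof.
rewrite {}/Z => add_y; have [uZ' wtZ'] := addable_mv uX' add_y.
have /andP[Xy Xy1] := add_y; rewrite addn1 in Xy1.
suff [t [x [add_t [def_t def_x] sub_t mvx eqZ]]] : exists t x, [/\ addable 1 X t,
   top_add y = t /\ top_mv y = x, top_sub t = y, movable e (mv X t (t + 1)) x &
   mv (mv X t (t + 1)) x (x - e) =i mv X' y y.+1].
  rewrite def_t def_x sub_t (addn1 y); split=> //; have [uZ wtZ] := addable_mv uX add_t.
  have lt_wtZ : wt (mv X t (t + 1)) < 2 ^ k + 2 ^ k by rewrite def_e wtZ addn1.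
  rewrite -def_e in mvx eqZ; rewrite (par_top uZ lt_wtZ mvx).
  by apply: par_eq => //; [case: (movable_mv uZ mvx) | rewrite -addn1].
have lt_wtX' : wt X' < e by clear -lt_wt wtX'; lia.
have coreX' v : v + e \in X' -> v \in X'.
  by move=> Xv; have := core_closed uX' lt_wtX' Xv (leq_addl v e); rewrite addnK.
rewrite /top_add /top_sub /top_mv.
have [eq_y | ne_y] := eqVneq y z.
  rewrite {y add_y uZ' wtZ' Xy}eq_y in Xy1 *.
  have Xz1 : z.+1 \notin X.
    apply: contra Xy1 => Xz1; rewrite memX' Xz1 /=.
    by apply/orP; right; apply/eqP; clear -e_gt1; lia.
  have Xz2 : (z + e).+1 \notin X.
    apply: contra Xy1 => Xz2; apply: coreX'.
    by rewrite addSn memX' Xz2 orbC /= neq_ltn ltnS leqnn orbT.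
  have ne1 : (z.+1 == z + e) = false by apply/eqP; clear -e_gt1; lia.
  exists (z + e), (z + e).+1; rewrite addn1 -addSn addnK; split.
  - by rewrite /addable Xze addn1.
  - by [].
  - by rewrite eqxx.
  - rewrite /movable addnK !mem_mv // eqxx leq_addl (negPf Xz1) addSn eqSS.
    by apply/eqP; clear -e_gt1; lia.
  move=> v; rewrite !mem_mv ?mem_mv ?eqxx //.
  case: (eqVneq v z.+1) => //= n1; case: (eqVneq v (z.+1 + e)) => [->|n2] /=.
    by rewrite addSn (negPf Xz2) /= orbF; apply/esym/negbTE; rewrite neq_ltn; clear; lia.
  case: (eqVneq v z) => [->|n3]; first by rewrite (negPf Xz).
  by rewrite !andbT.
have [Xy_X ne_yz] : y \in X /\ y != z + e.
  by move: Xy; rewrite memX' (negPf ne_y) => /andP[].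
have [eq_y1 | ne_y1] := eqVneq y.+1 (z + e).
  have eq_y : y = z.-1 + e by clear -eq_y1 z_gt0; lia.
  have Xz1 : z.-1 \in X.
    have : z.-1 \in X' by apply: coreX'; rewrite -eq_y.
    by rewrite memX' => /orP[/eqP eqz | /andP[]//]; exfalso; clear -eqz z_gt0; lia.
  exists z.-1, y; rewrite addn1 prednK // eq_y addnK; split.
  - by rewrite /addable Xz1 addn1 prednK.
  - by [].
  - rewrite eqxx (_ : z.-1 == z + e = false); first by clear -z_gt0; lia.
    by apply/eqP; clear -z_gt0; lia.
  - rewrite /movable leq_addl addnK !mem_mv // -eq_y Xy_X eqxx andbF orbF /= orbC.
    apply/andP; split; last by apply/eqP; clear -z_gt0; lia.
    by apply/orP; left; apply/eqP; clear -eq_y z_gt0 e_gt1; lia.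
  have ne1 : (y == z.-1) = false by apply/eqP; clear -eq_y e_gt1; lia.
  have ne2 : (z + e == z.-1) = false by apply/eqP; clear -e_gt1; lia.
  move=> v; rewrite -eq_y eq_y1 !mem_mv ?mem_mv ?Xy_X ?ne_yz ?ne1 ?orbT //.
  case: (eqVneq v z.-1) => [->|n1] /=.
    by rewrite Xz1 [_ == y]eq_sym ne1 [_ == z + e]eq_sym ne2 orbT.
  case: (eqVneq v (z + e)) => [->|n2] /=; last by rewrite !andbT.
  by rewrite Xze orbT eq_sym ne_yz.
have Xy1_X : y.+1 \notin X.
  by apply: contra Xy1 => Xy1_X; rewrite memX' Xy1_X ne_y1 orbT.
have ne_y1z : y.+1 != z by apply: contra Xy1 => /eqP->; rewrite memX' eqxx.
exists y, (z + e); rewrite addnK addn1; split=> //.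
- by rewrite /addable Xy_X addn1.
- by rewrite (negPf ne_yz) (negPf ne_y1z).
- rewrite /movable addnK leq_addl !mem_mv // Xze (negPf Xz) /= orbF.
  by rewrite [z + e == y]eq_sym ne_yz orbT eq_sym ne_y1z.
move=> v; rewrite !mem_mv ?Xy_X ?ne_yz ?orbT //.
  case: (eqVneq v z) => [->|n1]; first by rewrite [z == y]eq_sym ne_y orbT.
  case: (eqVneq v y.+1) => [->|n2] /=; first by rewrite ne_y1.
  by case: (v \in X) => //; rewrite andbC.
by rewrite Xze [z + e == y]eq_sym ne_yz orbT.
Qed.

(** Oddness serves to provide a bead x of the enlarged set that can move by e; if [top_sub y] were
    not addable in X', every place for x would be excluded, X' being an e-core. *)
Lemma top_subP y : odd_addable 1 X y ->
  addable 1 X' (top_sub y) /\ top_add (top_sub y) = y.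
Proof.
case/andP=> add_y par_y; have [uZ wtZ] := addable_mv uX add_y.
have /andP[Xy Xy1] := add_y; rewrite addn1 in Xy1.
have [x mvx] : exists x, movable e (mv X y y.+1) x.
  have le_e : 2 ^ k <= wt (mv X y (y + 1)) by rewrite def_e wtZ; clear -wtX'; lia.
  by have [x] := par_movable uZ le_e par_y; rewrite def_e addn1; exists x.
have lt_wtX' : wt X' < e by clear -lt_wt wtX'; lia.
have coreX' v : v \in X' -> e <= v -> v - e \in X' by apply: core_closed.
have [Zx le_x Zxe] := and3P mvx.
have Xx_cases : x = y.+1 \/ [/\ x \in X, x != y & x - e != z -> x - e \in X].
  move: Zx; rewrite mem_mv // => /orP[/eqP-> | /andP[Xx ne_xy]]; [by left | right].
  split=> // ne_xez; have [eq_x | ne_x] := eqVneq x (z + e).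
    by rewrite eq_x addnK eqxx in ne_xez.
  have := coreX' x; rewrite !memX' Xx ne_x orbT (negPf ne_xez) /= => /(_ isT le_x).
  by case/andP.
have Zxe_cases : x - e \in X -> x - e = y.
  by move=> Xxe; apply/eqP; apply: contraNT Zxe => ne; rewrite mem_mv // Xxe ne orbT.
rewrite /addable /top_add /top_sub.
have [eq_y | ne_y] := eqVneq y (z + e).
  rewrite eqxx addn1 memX' eqxx /=; split=> //; rewrite memX' negb_or.
  have [Xz1 | //] := boolP (z.+1 \in X); last by rewrite ?andbT neq_ltn ltnSn orbT.
  exfalso; case: Xx_cases => [eq_x | [Xx ne_xy XxeP]].
    have eq_xe : x - e = z.+1 by rewrite eq_x eq_y -addSn addnK.
    by have := Zxe_cases; rewrite eq_xe Xz1 => /(_ isT); clear -eq_y e_gt1; lia.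
  have ne_xez : x - e != z by apply: contra ne_xy => /eqP; rewrite eq_y; clear -le_x; lia.
  have := Zxe_cases (XxeP ne_xez) => eq_xe.
  have Xx' : x \in X' by rewrite memX' Xx -eq_y ne_xy orbT.
  have := coreX' _ Xx' le_x; rewrite memX' (negPf ne_xez) eq_xe eq_y eqxx andbF //.
have [eq_y1 | ne_y1] := eqVneq y.+1 z.
  have eq_ye : (z + e).-1 = y + e by rewrite -eq_y1.
  have ne1 : (y + e == z) = false by apply/eqP; clear -eq_y1 e_gt1; lia.
  have ne2 : (z + e == z) = false by apply/eqP; clear -e_gt1; lia.
  rewrite addn1 prednK ?addn_gt0 ?z_gt0 // eq_ye ne1 eqxx; split; last by rewrite -eq_y1.
  rewrite [z + e \in X']memX' eqxx andbF orbF ne2 andbT.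
  case: Xx_cases => [eq_x | [Xx ne_xy XxeP]].
    have Xx' : x \in X' by rewrite memX' eq_x eq_y1 eqxx.
    have := coreX' _ Xx' le_x; rewrite memX'.
    have -> : (x - e == z) = false by apply/eqP; clear -eq_x eq_y1 e_gt1 le_x; lia.
    by case/andP=> /Zxe_cases; clear -eq_x le_x e_gt1; lia.
  have ne_xez : x - e != z.
    by apply: contra Zxe => /eqP->; rewrite mem_mv // eq_y1 eqxx.
  have eq_xe := Zxe_cases (XxeP ne_xez).
  have <- : x = y + e by rewrite -eq_xe subnK.
  by rewrite memX' Xx; apply/orP; right; apply: contra ne_xez => /eqP->; rewrite addnK.
rewrite addn1 !memX' Xy ne_y orbT /= negb_or ne_y1 (negPf Xy1); split=> //.
rewrite (_ : (y == z) = false); last by apply: contraNF Xz => /eqP<-.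
by rewrite (_ : (y.+1 == z + e) = false) //; apply: contraNF Xy1 => /eqP->.
Qed.

Lemma nadd_top : nadd 1 X = nadd 1 X'.
Proof.
rewrite /nadd -!size_filter -(size_map top_add (filter _ X')); apply: perm_size.
have in_X' y : (y \in [seq y <- X' | odd_addable 1 X' y]) = odd_addable 1 X' y.
  by rewrite mem_filter andb_idr // => /andP[/andP[]].
have in_X y : (y \in [seq y <- X | odd_addable 1 X y]) = odd_addable 1 X y.
  by rewrite mem_filter andb_idr // => /andP[/andP[]].
apply: uniq_perm => [||y]; first exact: filter_uniq.
  rewrite map_inj_in_uniq ?filter_uniq // => y1 y2; rewrite !in_X'.
  case/andP=> /top_addP[_ y1K _ _ _] _ /andP[/top_addP[_ y2K _ _ _] _] eq12.
  by rewrite -y1K eq12 y2K.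
rewrite in_X; apply/idP/mapP=> [add_y | [y' + ->]].
  have [add_y' y'K] := top_subP add_y; exists (top_sub y); rewrite ?y'K //.
  rewrite in_X' /odd_addable add_y' /=; have [_ _ _ _ <-] := top_addP add_y'.
  by rewrite y'K; case/andP: add_y.
rewrite in_X' => /andP[add_y' par_y']; rewrite /odd_addable.
by have [-> _ _ _ ->] := top_addP add_y'.
Qed.

End TopBit.

(** * Uniqueness of the odd one-box removal *)

Definition odd_movable f X x : bool := movable f X x && par (mv X x (x - f)).

Lemma exists_top_bit n : 0 < n -> exists k, 2 ^ k <= n < 2 ^ k + 2 ^ k.
Proof.
move=> n_gt0; exists (trunc_log 2 n).
have /andP[-> lt_n] := trunc_log_bounds (ltnSn 1) n_gt0.
by rewrite addnn -mul2n -expnS.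
Qed.

Lemma mem_mvK X x y v : x \in X -> y \notin X ->
  (v \in X) = (v == x) || (v \in mv X x y) && (v != y).
Proof.
move=> Xx Xy; rewrite mem_mv //.
case: (eqVneq v x) => [->|ne_x] /=; first by rewrite Xx.
by case: (eqVneq v y) => [->|ne_y] /=; rewrite ?(negPf Xy) ?andbT.
Qed.

(** The move leaves weight 0, so X is an initial interval with one bead raised. *)
Lemma hook_shape e X w : uniq X -> wt X = e -> movable e X w ->
  [/\ w - e < size X, size X <= w &
      forall v, (v \in X) = (v == w) || (v < size X) && (v != w - e)].
Proof.
move=> uX def_e mv_w; have [uX' wtX'] := movable_mv uX mv_w.
have [Xw le_w Xwe] := and3P mv_w.
have mem' v : (v \in mv X w (w - e)) = (v < size X).
  by rewrite (wt0_iota uX') ?size_mv ?mem_iota //; lia.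
split; first by rewrite -mem' mem_mv // eqxx.
  rewrite leqNgt -mem' mem_mv // eqxx andbF orbF; apply/eqP => eq_w.
  by rewrite -eq_w Xw in Xwe.
by move=> v; rewrite (mem_mvK v Xw Xwe) mem'.
Qed.

Lemma par_two_moves X x1 x2 : uniq X -> 0 < wt X -> x1 != x2 ->
    odd_movable 1 X x1 -> odd_movable 1 X x2 ->
    (forall x, movable 1 X x -> x = x1 \/ x = x2) ->
  par X = false.
Proof.
move=> uX wt_gt0 ne12 /andP[mv1 par1] /andP[mv2 par2] only.
have Xx1 : x1 \in X by case/and3P: mv1.
have Xx2 : x2 \in rem x1 X by rewrite mem_rem_uniq // inE eq_sym ne12; case/and3P: mv2.
rewrite (@par_recE 0) // (big_rem x1) // (big_rem x2) //= !expn0 mv1 mv2 par1 par2.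
rewrite big1_seq // => x /andP[/only[]-> //]; rewrite mem_rem_uniq ?rem_uniq // inE ?eqxx //.
by rewrite mem_rem_uniq // inE eqxx andbF.
Qed.

Lemma movable_addable f X x (Z := mv X x (x - f)) : uniq X -> movable f X x ->
  addable f Z (x - f) /\ mv Z (x - f) (x - f + f) =i X.
Proof.
move=> uX /and3P[Xx le_x Xx']; rewrite /addable subnK //.
have Zx' : x - f \in Z by rewrite mem_mv // eqxx.
have ne_x : x != x - f by apply: contraNneq Xx' => <-.
split; first by rewrite Zx' mem_mv // (negPf ne_x) eqxx andbF.
by move=> v; rewrite mem_mv // -mem_mvK.
Qed.

(** Induction on the weight. If it is a power of 2, X is a hook with at most two corners, and two
    odd removals would add up to an even degree. Otherwise each removal is carried through the top
    hook to X', which is smaller. *)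
Lemma odd_movable1_inj X x1 x2 : uniq X -> wt X < size X -> par X ->
  odd_movable 1 X x1 -> odd_movable 1 X x2 -> x1 = x2.
Proof.
move: {2}(wt X) (leqnn (wt X)) => n; elim: n X x1 x2 => [|n IH] X x1 x2 le_n uX lt_s parX.
  by case/andP=> /(movable_leq uX); lia.
move=> odd1 odd2.
have wt_gt0 : 0 < wt X by case/andP: odd1 => /(movable_leq uX).
have [k /andP[le_k lt_k]] := exists_top_bit wt_gt0.
have [w mv_w] := par_movable uX le_k parX.
have [eq_k | ne_k] := eqVneq (2 ^ k) (wt X).
  have [lt_ws le_sw memX] := hook_shape uX (esym eq_k) mv_w.
  have only x : movable 1 X x -> x = w \/ x = (w - 2 ^ k).+1.
    case/and3P; rewrite !memX => Xx x_gt0 Xx1; have [-> | ne_xw] := eqVneq x w; first by left.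
    right; move: Xx Xx1; rewrite (negPf ne_xw) /= => /andP[lt_xs ne_x].
    rewrite negb_or negb_and negbK => /andP[_ /orP[|/eqP]]; lia.
  have [//|ne12] := eqVneq x1 x2; suff: par X = false by rewrite parX.
  apply: (par_two_moves uX wt_gt0 ne12 odd1 odd2) => x /only mv_x.
  case/andP: odd1 => /only mv1 _; case/andP: odd2 => /only mv2 _.
  by case: mv1 mv2 mv_x ne12 => [->|->] [->|->] [->|->]; rewrite ?eqxx; auto.
set e := 2 ^ k in le_k lt_k mv_w ne_k; set X' := mv X w (w - e).
have [uX' wtX'] := movable_mv uX mv_w; rewrite -/X' in uX' wtX'.
have [Xw le_w Xwe] := and3P mv_w.
have parX' : par X' by rewrite -(par_top uX lt_k mv_w).
(* With Z the result of the removal at x: z + e carries the top hook of Z, and y is the bead whose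
   move by one leads from Z without that hook to X'. By uniqueness of the top hook of X, w is
   [top_mv e z y]. *)
pose info x y z := [/\ z + e \in mv X x (x - 1), z \notin mv X x (x - 1),
  addable 1 (mv (mv X x (x - 1)) (z + e) z) y, par (mv (mv X x (x - 1)) (z + e) z) &
  w = top_mv e z y /\ mv (mv (mv X x (x - 1)) (z + e) z) y (y + 1) =i X'].
have get_info x : odd_movable 1 X x -> exists y z, info x y z.
  case/andP=> mv_x par_x; have [uZ wtZ] := movable_mv uX mv_x.
  set Z := mv X x (x - 1) in par_x uZ wtZ.
  have le_kZ : 2 ^ k <= wt Z by rewrite -/e; clear -le_k ne_k wtZ; lia.
  have lt_kZ : (wt Z).+1 < e + e by rewrite -(addn1 (wt Z)) wtZ.
  have [z' /and3P[Zz' le_z' Zz]] := par_movable uZ le_kZ par_x.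
  have [z def_z'] : exists z, z' = z + e by exists (z' - e); rewrite subnK.
  rewrite {z'}def_z' addnK in Zz' le_z' Zz.
  have Z0 : 0 \in Z by apply: zero_mem uZ _; rewrite size_mv; lia.
  have [add_x eqX] := movable_addable uX mv_x.
  have add_x_odd : odd_addable 1 Z (x - 1).
    by rewrite /odd_addable add_x (par_eq _ uX eqX) //; case: (addable_mv uZ add_x).
  have [add_y yK] := top_subP (erefl _) uZ lt_kZ Zz' Zz Z0 add_x_odd.
  have [_ _ mvy eqZ' _] := top_addP (erefl _) uZ lt_kZ Zz' Zz Z0 add_y.
  rewrite yK in mvy eqZ'.
  have mvy' : movable e X (top_mv e z (top_sub e z (x - 1))).
    by move: mvy; rewrite /movable !eqX.
  have def_w := movable_inj uX lt_k mv_w mvy'.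
  have mvz : movable e (mv X x (x - 1)) (z + e) by rewrite /movable Zz' le_z' addnK.
  exists (top_sub e z (x - 1)), z; split=> //.
    by have := par_top uZ (ltnW lt_kZ) mvz; rewrite addnK => <-.
  split=> // v.
  rewrite -eqZ' -def_w mem_mv; last by rewrite eqX.
  by rewrite eqX mem_mv.
have uX1 x : odd_movable 1 X x -> uniq (mv X x (x - 1)).
  by case/andP=> /(movable_mv uX)[].
have up x y z : uniq (mv X x (x - 1)) -> info x y z ->
    odd_movable 1 X' y.+1 /\ mv X' y.+1 y =i mv (mv X x (x - 1)) (z + e) z.
  move=> uZ [Zz Zn add_y par_y [_ eqX']].
  have uZ' : uniq (mv (mv X x (x - 1)) (z + e) z) by apply: mv_uniq.
  have [uY _] := addable_mv uZ' add_y.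
  have /andP[Zy Zy1] := add_y; rewrite addn1 in Zy1 eqX' uY.
  have Xy1 : y.+1 \in X' by rewrite -eqX' mem_mv // eqxx.
  have Xy : y \notin X' by rewrite -eqX' mem_mv // eqxx andbF orbF neq_ltn ltnSn.
  have eqZ : mv X' y.+1 y =i mv (mv X x (x - 1)) (z + e) z.
    by move=> v; rewrite mem_mv // -eqX' -mem_mvK.
  split=> //; rewrite /odd_movable /movable Xy1 subn1 /= Xy.
  by rewrite (par_eq (mv_uniq _ uX' Xy) uZ' eqZ).
have [y1 [z1 info1]] := get_info _ odd1.
have [y2 [z2 info2]] := get_info _ odd2.
have [odd1' eqZ1] := up _ _ _ (uX1 _ odd1) info1.
have [odd2' eqZ2] := up _ _ _ (uX1 _ odd2) info2.
have e_gt0 : 0 < e by rewrite expn_gt0.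
have [eq_y] : y1.+1 = y2.+1.
  apply: (IH X' _ _ _ uX' _ parX' odd1' odd2'); first by clear -le_n wtX' e_gt0; lia.
  have -> : size X' = size X by apply: size_mv.
  clear -wtX' lt_s; lia.
rewrite -{y2}eq_y in info2 odd2' eqZ2.
case: info1 info2 => [Zz1 Zn1 add1 _ [def_w1 _]] [Zz2 Zn2 add2 _ [def_w2 _]].
have ne_yz Z z : z + e \in Z -> addable 1 (mv Z (z + e) z) y1 -> z != y1.+1 /\ z + e != y1.
  move=> Zz /andP[]; rewrite !mem_mv // addn1 negb_or => Zy /andP[ne_y _].
  rewrite eq_sym ne_y; split=> //; apply: contraTneq Zy => <-; rewrite eqxx andbF orbF.
  by clear -e_gt0; lia.
have [ne1 ne1'] := ne_yz _ _ Zz1 add1; have [ne2 ne2'] := ne_yz _ _ Zz2 add2.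
(* For fixed y, [top_mv] is injective in z: its branches could only coincide for z = y.+1 or z + e =
   y, where y is not addable. *)
have eq_z : z1 = z2.
  move: def_w1; rewrite def_w2 /top_mv; clear -ne1 ne1' ne2 ne2' e_gt0.
  by do 4?[case: eqVneq => ?]; lia.
rewrite -eq_z in Zz2 Zn2 eqZ2.
have eqZ : mv X x1 (x1 - 1) =i mv X x2 (x2 - 1).
  by move=> v; rewrite (mem_mvK v Zz1 Zn1) (mem_mvK v Zz2 Zn2) -eqZ1 -eqZ2.
have /andP[/and3P[X1 x1_gt0 _] _] := odd1; have /andP[/and3P[X2 _ X2n] _] := odd2.
have := eqZ x1; rewrite !mem_mv // X1 eqxx andbF orbF /=.
have -> : (x1 == x1 - 1) = false by clear -x1_gt0; lia.
by move/esym/negbT; rewrite negb_or negbK => /andP[_ /eqP].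
Qed.

(** * Partitions of 2^d and of 2^d - 1 *)

Lemma par_hook k X : uniq X -> wt X = 2 ^ k ->
  par X <-> exists w, movable (2 ^ k) X w.
Proof.
move=> uX wtX; split=> [parX | [w mv_w]]; first by apply: par_movable; rewrite ?wtX.
have [uX' wtX'] := movable_mv uX mv_w.
rewrite (par_top uX _ mv_w); first by apply: par_wt0 => //; lia.
by rewrite wtX; have := expn_gt0 2 k; lia.
Qed.

(** The beads at or beyond the length are counted by the side of the Durfee square, which is at most
    1 exactly for hooks. *)
Definition hookset X : bool := count (leq (size X)) X <= 1.

Lemma hooksetP X : uniq X ->
  reflect {in X &, forall x y, size X <= x -> size X <= y -> x = y} (hookset X).
Proof.
move=> uX; rewrite /hookset -size_filter.
have uF : uniq [seq x <- X | size X <= x] by rewrite filter_uniq.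
apply: (iffP idP) => [le1 x y Xx Xy le_x le_y | inj].
  have Fx : x \in [seq x <- X | size X <= x] by rewrite mem_filter le_x.
  have Fy : y \in [seq x <- X | size X <= x] by rewrite mem_filter le_y.
  move: le1 Fx Fy; case: {uF}(filter _ _) => [|a [|//]] // _.
  by rewrite !inE => /eqP-> /eqP->.
case def_F: (filter _ _) uF => [|a [|b F]] //=; rewrite inE negb_or => /andP[/andP[ne_ab _] _].
have: a \in [seq x <- X | size X <= x] by rewrite def_F mem_head.
have: b \in [seq x <- X | size X <= x] by rewrite def_F !inE eqxx orbT.
rewrite !mem_filter => /andP[le_b Xb] /andP[le_a Xa].
by rewrite (inj a b) ?eqxx in ne_ab.
Qed.

Lemma sub_iota_wt0 X : uniq X -> {subset X <= iota 0 (size X)} ->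
  X =i iota 0 (size X) /\ wt X = 0.
Proof.
move=> uX sub; have [|_ eqX] := uniq_min_size uX sub; first by rewrite size_iota.
split=> //; have/perm_sumn sumX : perm_eq X (iota 0 (size X)).
  by apply: uniq_perm; rewrite ?iota_uniq.
rewrite /wt sumX sumnE -[X in _ - X]bin2_sum.
by rewrite -[X in iota _ X]subn0 -/(index_iota 0 _) subnn.
Qed.

Section Base.
Variables (d : nat) (X : seq nat).
Let e := 2 ^ d.
Hypotheses (uX : uniq X) (wtX : (wt X).+1 = e) (lt_s : wt X < size X).

Let X0 : 0 \in X. Proof. exact: zero_mem. Qed.

Lemma odd_addable_baseP y :
  reflect (addable 1 X y /\ exists w, movable e (mv X y (y + 1)) w) (odd_addable 1 X y).
Proof.
apply: (iffP andP) => -[add_y]; have [uZ wtZ] := addable_mv uX add_y;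
  have wtZe : wt (mv X y (y + 1)) = 2 ^ d by rewrite wtZ addn1.
  by move=> parZ; split=> //; apply/(par_hook uZ wtZe).
by move=> ex_w; split=> //; apply/(par_hook uZ wtZe).
Qed.

Lemma nadd_base0 : d = 0 -> nadd 1 X = 1.
Proof.
move=> d0; have eX : wt X = 0 by move: wtX; rewrite /e d0 => -[].
have memX v : (v \in X) = (v < size X) by rewrite (wt0_iota uX eX) mem_iota.
have X_gt0 : 0 < size X by rewrite -memX.
rewrite /nadd (eq_in_count (a2 := pred1 (size X).-1)).
  by rewrite count_uniq_mem // memX ltn_predL X_gt0.
move=> y; rewrite memX => lt_y /=; apply/odd_addable_baseP/eqP => [[/andP[_]] | ->].
  by rewrite memX; lia.
have add_s : addable 1 X (size X).-1 by rewrite /addable !memX addn1 prednK // leqnn ltnn.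
split=> //; exists (size X); rewrite addn1 prednK // /movable /e d0 expn0 X_gt0 subn1.
by rewrite !mem_mv ?memX ?prednK // eqxx /= negb_or eqxx andbF; lia.
Qed.

(** An odd extension has 2^d cells, so it is a hook, and a hook minus a cell is a hook. *)
Lemma nadd_base_nonhook : ~~ hookset X -> nadd 1 X = 0.
Proof.
apply: contraNeq; rewrite -lt0n -has_count => /hasP[y Xy /odd_addable_baseP[add_y [w mv_w]]].
have [uZ wtZ] := addable_mv uX add_y.
have wtZe : wt (mv X y (y + 1)) = e by rewrite wtZ addn1.
have [lt_z le_w memZ] := hook_shape uZ wtZe mv_w; rewrite size_mv in lt_z le_w memZ.
have Xy1 : y + 1 \notin X by case/andP: add_y.
have memX v := mem_mvK v Xy Xy1.
have Zy1 : y + 1 \in mv X y (y + 1) by rewrite mem_mv // eqxx.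
have lt_sE v : size X <= v -> v \in X -> v = if y + 1 == w then y else w.
  move=> le_v; rewrite memX memZ (leq_gtF le_v) orbF; move: Zy1; rewrite memZ.
  case: (eqVneq (y + 1) w) => [<- _|ne_yw /= /andP[lt_y _]].
    by case/orP=> [/eqP//|/andP[-> //]].
  by case/orP=> [/eqP eq_v|/andP[/eqP]//]; lia.
by apply/hooksetP => // x1 x2 X1 X2 le1 le2; rewrite (lt_sE x1) // (lt_sE x2).
Qed.

(** X is an initial interval with the bead z raised to w. Moving w lengthens the arm, moving z.-1
    lengthens the leg, and any other addition puts a second bead at or beyond the length. *)
Lemma nadd_base_hook : 0 < d -> hookset X -> nadd 1 X = 2.
Proof.
move=> d_gt0 hookX; have e_gt1 : 1 < e by rewrite -(expn0 2) ltn_exp2l.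
have [w Xw le_w] : exists2 w, w \in X & size X <= w.
  apply/hasP; apply: contraTT e_gt1 => /hasPn lt_X; rewrite -leqNgt -wtX.
  have [x Xx|_ ->//] := sub_iota_wt0 uX _.
  by rewrite mem_iota /= ltnNge lt_X.
have w_uniq v : v \in X -> size X <= v -> v = w.
  by move=> Xv le_v; apply: (hooksetP uX hookX).
have [z lt_z Xz] : exists2 z, z < size X & z \notin X.
  have [/allP sub|/allPn[z]] := boolP (all (mem X) (iota 0 (size X))).
    have: size (w :: iota 0 (size X)) <= size X.
      apply: uniq_leq_size => [|v]; first by rewrite /= iota_uniq mem_iota /= -leqNgt le_w.
      by rewrite inE => /predU1P[-> | /sub].
    by rewrite /= size_iota ltnn.
  by rewrite mem_iota => /= lt_z Xz; exists z.
have uX' : uniq (mv X w z) by apply: mv_uniq.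
have sub' : {subset mv X w z <= iota 0 (size (mv X w z))}.
  move=> v; rewrite size_mv mem_iota /= add0n mem_mv // => /orP[/eqP-> //|/andP[Xv]].
  by apply: contraNT; rewrite -leqNgt => /(w_uniq _ Xv) ->.
have [mem' wt'] := sub_iota_wt0 uX' sub'; rewrite size_mv in mem'.
have memX v : (v \in X) = (v == w) || (v < size X) && (v != z).
  by rewrite (mem_mvK v Xw Xz) mem' mem_iota.
have w_z : w + 1 = z + e by have := wt_mv uX Xw Xz; rewrite wt' -wtX; lia.
have z_gt0 : 0 < z by rewrite lt0n; apply: contraNneq Xz => ->.
have Xz1 : z.-1 \in X by rewrite memX; apply/orP; right; lia.
have odd_w : odd_addable 1 X w.
  apply/odd_addable_baseP; split; first by rewrite /addable Xw memX; lia.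
  exists (w + 1); rewrite /movable !mem_mv // eqxx w_z leq_addl addnK (negPf Xz) /=; lia.
have odd_z : odd_addable 1 X z.-1.
  apply/odd_addable_baseP; rewrite addn1 prednK //; split.
    by rewrite /addable Xz1 addn1 prednK.
  exists w; rewrite /movable !mem_mv // Xw (_ : w - e = z.-1); last by lia.
  by rewrite eqxx andbF orbF; lia.
have F2 : perm_eq [seq y <- X | odd_addable 1 X y] [:: w; z.-1].
  apply: uniq_perm => [||y]; first exact: filter_uniq.
    by rewrite /= inE andbT; lia.
  rewrite mem_filter !inE; apply/andP/orP=> [[odd_y Xy]|[/eqP->|/eqP->]//].
  have [-> | ne_w] := eqVneq y w; [by left | right].
  have /andP[add_y _] := odd_y; have /andP[_ Xy1] := add_y.
  have lt_y : y < size X by rewrite ltnNge; apply: contra ne_w => /(w_uniq _ Xy)->.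
  apply: contraT => ne_z; case/odd_addable_baseP: odd_y => _ [v mv_v].
  have [uZ wtZ] := addable_mv uX add_y.
  have wtZe : wt (mv X y (y + 1)) = e by rewrite wtZ addn1.
  have [_ _ memZ] := hook_shape uZ wtZe mv_v; rewrite size_mv in memZ.
  have ge_s u : u \in mv X y (y + 1) -> size X <= u -> u = v.
    by rewrite memZ => /predU1P[-> //|/andP[+ _]]; rewrite ltnNge => /negPf->.
  have ne_y1w : y + 1 != w by apply: contraNneq Xy1 => ->.
  have le_y1 : size X <= y + 1.
    rewrite leqNgt; apply: contra Xy1 => lt_y1; rewrite memX lt_y1 /=; apply/orP; right.
    by apply: contra ne_z => /eqP<-; rewrite addn1.
  have Zy1 : y + 1 \in mv X y (y + 1) by rewrite mem_mv // eqxx.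
  have Zw : w \in mv X y (y + 1) by rewrite mem_mv // Xw [w == y]eq_sym ne_w orbT.
  by rewrite (ge_s _ Zy1 le_y1) (ge_s _ Zw le_w) eqxx in ne_y1w.
by rewrite /nadd -size_filter (perm_size F2).
Qed.

End Base.

(** * Cores on the abacus *)

Definition runner e r X : seq nat := [seq x <- X | x %% e == r].

(** As many beads as X on each runner, all pushed down. The core is specified by a relation so that
    one C can be kept in [nadd_one] while X loses hooks. *)
Definition is_core e X C :=
  [/\ uniq C, size C = size X,
      forall r, size (runner e r C) = size (runner e r X) &
      forall x, x \in C -> e <= x -> x - e \in C].

(** The quotients by e of the beads on one runner admit no downward move, so they form an initial
    interval, determined by its length. *)
Lemma closed_runner e C x : 0 < e -> uniq C ->
    (forall x, x \in C -> e <= x -> x - e \in C) ->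
  (x \in C) = (x %/ e < size (runner e (x %% e) C)).
Proof.
move=> e_gt0 uC closedC; pose L := [seq y %/ e | y <- runner e (x %% e) C].
have memL y : (y %/ e \in L) && (y %% e == x %% e) = (y \in C) && (y %% e == x %% e).
  case: eqVneq => [eq_y|]; rewrite ?andbF // !andbT.
  apply/mapP/idP=> [[z]|Cy]; last by exists y; rewrite // mem_filter eq_y eqxx.
  rewrite mem_filter => /andP[/eqP eq_z Cz eq_yz].
  by rewrite (divn_eq y e) eq_yz eq_y -eq_z -divn_eq.
have uL : uniq L.
  rewrite map_inj_in_uniq ?filter_uniq // => y z; rewrite !mem_filter.
  case/andP=> /eqP eq_y _ /andP[/eqP eq_z _] eq_yz.
  by rewrite (divn_eq y e) (divn_eq z e) eq_yz eq_y eq_z.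
have closedL : wt L = 0.
  apply/eqP; rewrite -leqn0 leqNgt; apply/negP=> /(wt_gt0_move uL)[_ /mapP[y + ->]].
  rewrite mem_filter => /andP[eq_y Cy] /andP[y_gt0]; case/negP.
  have le_ey : e <= y by rewrite -divn_gt0.
  have eq_ye : (y - e) %% e = y %% e by rewrite -{2}(subnK le_ey) modnDr.
  have := memL (y - e); rewrite eq_ye eq_y !andbT closedC //.
  by rewrite -{2}(subnK le_ey) divnDr // divnn e_gt0 addn1.
have := memL x; rewrite eqxx !andbT => <-.
by rewrite (wt0_iota uL closedL) mem_iota size_map.
Qed.

Lemma is_core_unique e X C C' : 0 < e -> is_core e X C -> is_core e X C' -> C =i C'.
Proof.
move=> e_gt0 [uC _ cntC closedC] [uC' _ cntC' closedC'] x.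
by rewrite (closed_runner _ e_gt0 uC) // (closed_runner _ e_gt0 uC') // cntC cntC'.
Qed.

Lemma size_runner_mv e r X x y : x %% e = y %% e ->
  size (runner e r (mv X x y)) = size (runner e r X).
Proof.
move=> eq_xy; rewrite !size_filter count_map; apply: eq_count => z /=.
by have [->|_] := eqVneq z x; rewrite ?eq_xy.
Qed.

Lemma is_core_mv e X C x y : x %% e = y %% e -> is_core e X C -> is_core e (mv X x y) C.
Proof.
move=> eq_xy [uC szC cntC closedC]; split=> // [|r]; first by rewrite size_mv.
by rewrite size_runner_mv.
Qed.

Lemma hookset_perm X Y : perm_eq X Y -> hookset X = hookset Y.
Proof. by move=> eqXY; rewrite /hookset (perm_size eqXY); have /seq.permP-> := eqXY. Qed.

Lemma nadd_one d X C : uniq X -> wt X < size X -> par X ->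
    wt X = 2 ^ d - 1 %[mod 2 ^ d.+1] -> is_core (2 ^ d) X C ->
  nadd 1 X = if d == 0 then 1 else if hookset C then 2 else 0.
Proof.
have e_gt0 : 0 < 2 ^ d by rewrite expn_gt0.
have [n] := ubnP (wt X); elim: n X => // n IH X lt_n uX lt_s parX wt_mod coreX.
have def_wt : wt X = wt X %/ 2 ^ d.+1 * 2 ^ d.+1 + (2 ^ d - 1).
  rewrite {1}(divn_eq (wt X) (2 ^ d.+1)) wt_mod modn_small // expnS; lia.
have [q0 | q_gt0] := posnP (wt X %/ 2 ^ d.+1).
  have wtX : (wt X).+1 = 2 ^ d by rewrite def_wt q0; lia.
  have coreXX : is_core (2 ^ d) X X.
    by split=> // x; apply: core_closed => //; lia.
  have eq_hook : hookset C = hookset X.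
    apply/hookset_perm/uniq_perm => //; first by case: coreX.
    exact: is_core_unique e_gt0 coreX coreXX.
  have [d0 | d_gt0] := posnP d; first exact: (nadd_base0 uX wtX lt_s d0).
  rewrite eq_hook; case: ifPn => [hookX | nhookX].
    exact: (nadd_base_hook uX wtX lt_s d_gt0 hookX).
  exact: (nadd_base_nonhook uX wtX).
have ge_wt : 2 ^ d.+1 <= wt X by rewrite def_wt (leq_trans _ (leq_addr _ _)) // leq_pmull.
have [k /andP[le_k lt_k]] : exists k, 2 ^ k <= wt X < 2 ^ k + 2 ^ k.
  by apply: exists_top_bit; apply: leq_trans ge_wt; rewrite expn_gt0.
have lt_dk : d < k.
  rewrite ltnNge; apply/negP=> le_kd.
  have : 2 ^ k + 2 ^ k <= 2 ^ d.+1 by rewrite addnn -mul2n -expnS leq_exp2l.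
  by rewrite leqNgt (leq_ltn_trans ge_wt).
have dvd_k : 2 ^ d.+1 %| 2 ^ k by rewrite dvdn_exp2l.
(* The number wt X + 1 is 2^d modulo 2^(d+1), so it is not the multiple 2^(k+1) of 2^(d+1). *)
have lt_wt : (wt X).+1 < 2 ^ k + 2 ^ k.
  rewrite ltn_neqAle lt_k andbT; apply/eqP=> eq_wt.
  have : 2 ^ d.+1 %| (wt X).+1 by rewrite eq_wt dvdn_add.
  rewrite def_wt -addnS dvdn_addr ?dvdn_mull // subn1 prednK // gtnNdvd //.
  by rewrite ltn_exp2l.
have X0 := zero_mem uX lt_s.
have [x mv_x] := par_movable uX le_k parX.
have [Xx le_x Xx'] := and3P mv_x.
have Xxe : x - 2 ^ k + 2 ^ k \in X by rewrite subnK.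
rewrite (nadd_top (erefl _) uX lt_wt Xxe Xx' X0) subnK //.
have [uX' wtX'] := movable_mv uX mv_x.
apply: IH => //.
- by have := expn_gt0 2 k; lia.
- by rewrite size_mv; lia.
- by rewrite -(par_top uX lt_k mv_x).
- by rewrite -wt_mod -wtX' -modnDmr (eqP dvd_k) addn0.
apply: is_core_mv coreX; rewrite -{1}(subnK le_x) -modnDmr.
by rewrite (eqP (_ : 2 ^ d %| 2 ^ k)) ?addn0 // dvdn_exp2l // ltnW.
Qed.

(** * 2-quotients *)

Section Disjoint.
Implicit Types a b i k : nat.

Definition bit i n := odd (n %/ 2 ^ i).

(** All bits beyond position a + b vanish, so a finite quantifier is enough. By Kummer's theorem the
    relation says that the binomial coefficient of a + b over a is odd. *)
Definition disj a b : bool := [forall i : 'I_(a + b).+1, ~~ (bit i a && bit i b)].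

Lemma bit_small i n : n < 2 ^ i -> bit i n = false.
Proof. by move=> lt_n; rewrite /bit divn_small. Qed.

Lemma bit0 n : bit 0 n = odd n.
Proof. by rewrite /bit divn1. Qed.

Lemma bitS i n : bit i.+1 n = bit i n./2.
Proof. by rewrite /bit expnS divnMA divn2. Qed.

Lemma disjP a b : reflect (forall i, ~~ (bit i a && bit i b)) (disj a b).
Proof.
apply: (iffP forallP) => [dis i | dis i //].
have [lt_i | ge_i] := ltnP i (a + b).+1; first exact: (dis (Ordinal lt_i)).
by rewrite bit_small //; have := ltn_expl i (ltnSn 1); lia.
Qed.

Lemma disjC a b : disj a b = disj b a.
Proof. by apply/disjP/disjP=> dis i; rewrite andbC. Qed.

Lemma disj0 a : disj a 0.
Proof. by apply/disjP=> i; rewrite /bit div0n andbF. Qed.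

Lemma disj_rec a b : disj a b = ~~ (odd a && odd b) && disj a./2 b./2.
Proof.
apply/disjP/andP=> [dis | [dis0 /disjP dis] [|i]]; last 2 first.
- by rewrite !bit0.
- by rewrite !bitS.
by split; [have := dis 0; rewrite !bit0 | apply/disjP=> i; rewrite -!bitS].
Qed.

Lemma disj_lt k a b : disj a b -> a < 2 ^ k -> b < 2 ^ k -> a + b < 2 ^ k.
Proof.
elim: k a b => [|k IH] a b; first by rewrite expn0; lia.
rewrite disj_rec expnS => /andP[dis0 dis] lt_a lt_b.
have : a./2 + b./2 < 2 ^ k by apply: IH => //; lia.
have := odd_double_half a; have := odd_double_half b; lia.
Qed.

(** The bounds make k the top bit of a and put b below 2^k, so clearing that bit changes nothing. *)
Lemma disj_sub k a b : 2 ^ k <= a -> a + b < 2 ^ k + 2 ^ k -> disj (a - 2 ^ k) b = disj a b.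
Proof.
elim: k a b => [|k IH] a b; rewrite ?expn0 ?expnS.
  move=> a_gt0 lt_ab; have [-> ->] : a = 1 /\ b = 0 by lia.
  by rewrite !disj0.
move=> le_a lt_ab; rewrite disj_rec [RHS]disj_rec -(IH a./2 b./2); [|lia..].
have -> : (a - 2 * 2 ^ k)./2 = a./2 - 2 ^ k by lia.
by rewrite oddB // oddM addbF.
Qed.

End Disjoint.

(** * Parity of the degree through the two runners *)

Definition half (b : bool) X : seq nat := [seq x./2 | x <- X & odd x == b].

Lemma mem_half b X v : (v \in half b X) = (b + v.*2 \in X).
Proof.
apply/mapP/idP=> [[x + ->] | Xv].
  by rewrite mem_filter => /andP[/eqP <- Xx]; rewrite odd_double_half.
exists (b + v.*2); last by rewrite half_bit_double.
by rewrite mem_filter oddD odd_double addbF oddb eqxx.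
Qed.

Lemma half_uniq b X : uniq X -> uniq (half b X).
Proof.
move=> uX; rewrite map_inj_in_uniq ?filter_uniq // => x y; rewrite !mem_filter.
case/andP=> /eqP odd_x _ /andP[/eqP odd_y _] eq_xy.
by rewrite -[x]odd_double_half -[y]odd_double_half eq_xy odd_x odd_y.
Qed.

Lemma size_half X : size (half false X) + size (half true X) = size X.
Proof.
rewrite !size_map !size_filter -(count_predC (fun x => odd x == false) X); congr addn.
by apply: eq_count => x /=; case: odd.
Qed.

Lemma sumn_half X :
  sumn X = (sumn (half false X) + sumn (half true X)).*2 + size (half true X).
Proof.
elim: X => //= x X IH; rewrite /half /=.
by have := odd_double_half x; case: (odd x) => /= <-; rewrite IH; rewrite /half; lia.
Qed.

(** For an even number of beads, these are the two distributions over the runners for which the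
    2-core has at most one cell. *)
Definition balanced X : bool :=
  (size (half false X) == size (half true X)) ||
  (size (half false X) == (size (half true X)).+2).

Lemma bin2E s : ('C(s, 2)).*2 = s * s.-1.
Proof. by rewrite bin2 -[RHS]odd_double_half; case: s => // s; rewrite oddM /= andNb. Qed.

(** The 2-core has c(2c - 1) cells if there are 2c more even beads than odd ones, and c(2c + 1) if
    there are 2c fewer: 0 or 1 in the balanced cases, at least 3 in the others. *)
Lemma wt_half X (w := wt (half false X) + wt (half true X)) : uniq X -> ~~ odd (size X) ->
  if balanced X then wt X = w.*2 + (size (half false X) != size (half true X))
  else w.*2 + 3 <= wt X.
Proof.
move=> uX even_X; have := sumn_half X; rewrite -(wtE uX) -(wtE (half_uniq false uX)).
rewrite -(wtE (half_uniq true uX)) -/(balanced X) {}/w /balanced.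
move: even_X; rewrite -(size_half X).
move: (size (half false X)) (size (half true X)) => a b even_ab.
have := bin2E a; have := bin2E b; have := bin2E (a + b).
move: (wt X) (wt (half false X)) (wt (half true X)) 'C(a, 2) 'C(b, 2) 'C(a + b, 2).
move=> w wa wb ca cb cab.
have sq n : n * n.-1 + n = n * n by case: n => // n; rewrite -mulnSr.
have [le_ba | lt_ab] := leqP b a.
  have [c ->] : exists c, a = b + c.*2.
    exists (a - b)./2; have := odd_double_half (a - b).
    by rewrite oddB // -oddD (negPf even_ab); lia.
  have e1 : (b + c.*2) * (b + c.*2).-1 + (b + c.*2) = b * b + b * c * 4 + c * c * 4.
    by rewrite sq; lia.
  have e2 : (b + c.*2 + b) * (b + c.*2 + b).-1 + (b + c.*2 + b) = b * b * 4 + b * c * 8 + c * c * 4.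
    by rewrite sq; lia.
  have e3 := sq b.
  have : [\/ c = 0 /\ c * c = 0, c = 1 /\ c * c = 1 | 1 < c /\ c + c <= c * c].
    case: (c) => [|[|m]]; [by constructor 1 | by constructor 2 | constructor 3].
    by rewrite addnn -mul2n leq_mul2r.
  have -> : (b + c.*2 == b) = (c == 0) by lia.
  have -> : (b + c.*2 == b.+2) = (c == 1) by lia.
  move: e1 e2 e3; move: (_ * _.-1) (_ * _.-1) (_ * _.-1) (b * b) (b * c) (c * c).
  move=> p q r bb bc cc; clear => e1 e2 e3 [[c0 cc0]|[c0 cc0]|[c_gt1 le_cc]].
  - by rewrite c0 /= in e1 e2 *; lia.
  - by rewrite c0 /= in e1 e2 *; lia.
  have -> : (c == 0) = false by lia.
  have -> : (c == 1) = false by lia.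
  by rewrite /=; lia.
have [c ->] : exists c, b = a + c.*2.+2.
  exists (b - a)./2.-1; have := odd_double_half (b - a).
  by rewrite oddB ?(ltnW lt_ab) // -oddD (addnC b) (negPf even_ab); lia.
have -> : (a == a + c.*2.+2) || (a == (a + c.*2.+2).+2) = false by lia.
have e1 : (a + c.*2.+2) * (a + c.*2.+2).-1 + (a + c.*2.+2) =
    a * a + a * c * 4 + a * 4 + c * c * 4 + c * 8 + 4 by rewrite sq; lia.
have e2 : (a + (a + c.*2.+2)) * (a + (a + c.*2.+2)).-1 + (a + (a + c.*2.+2)) =
    a * a * 4 + a * c * 8 + a * 8 + c * c * 4 + c * 8 + 4 by rewrite sq; lia.
have e3 := sq a; move: e1 e2 e3.
move: (_ * _.-1) (_ * _.-1) (_ * _.-1) (a * a) (a * c) (c * c) => p q r aa ac cc.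
clear; lia.
Qed.

Lemma size_half_mv b b' X u v : size (half b' (mv X (b + u.*2) (b + v.*2))) = size (half b' X).
Proof.
rewrite !size_map !size_filter count_map; apply: eq_count => x /=.
by case: (eqVneq x (b + u.*2)) => [->|//]; rewrite !oddD !odd_double.
Qed.

Lemma half_mv_same b X u v : half b (mv X (b + u.*2) (b + v.*2)) = mv (half b X) u v.
Proof.
rewrite /half /mv filter_map -!map_comp (eq_filter (a2 := fun x => odd x == b)).
  apply/eq_in_map => x; rewrite mem_filter /= => /andP[/eqP odd_x _].
  have -> : (x == b + u.*2) = (x./2 == u).
    by rewrite -[x in LHS]odd_double_half odd_x eqn_add2l -!muln2 eqn_pmul2r.
  by case: eqP => // _; rewrite half_bit_double.
by move=> x /=; case: (eqVneq x (b + u.*2)) => [->|//]; rewrite !oddD !odd_double.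
Qed.

Lemma half_mv_other b X u v : half (~~ b) (mv X (b + u.*2) (b + v.*2)) = half (~~ b) X.
Proof.
rewrite /half /mv filter_map -!map_comp (eq_filter (a2 := fun x => odd x == ~~ b)).
  apply/eq_in_map => x; rewrite mem_filter /= => /andP[/eqP odd_x _].
  case: eqP => // eq_x; move: odd_x; rewrite eq_x oddD odd_double addbF oddb.
  by case: (b).
by move=> x /=; case: (eqVneq x (b + u.*2)) => [->|//]; rewrite !oddD !odd_double.
Qed.

Lemma movable_half e (b : bool) X u : movable e.*2 X (b + u.*2) = movable e (half b X) u.
Proof.
rewrite /movable !mem_half; congr (_ && _).
have -> : (e.*2 <= b + u.*2) = (e <= u) by case: b; lia.
by case: leqP => //= le_eu; congr (_ \notin X); lia.
Qed.

Lemma big_half (b : bool) X (P : pred nat) (F : nat -> bool) :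
  \big[addb/false]_(x <- X | (odd x == b) && P x) F x =
  \big[addb/false]_(u <- half b X | P (b + u.*2)) F (b + u.*2).
Proof.
rewrite big_map big_filter_cond !(big_mkcond (fun x => (_ x == b) && _)) /=.
apply: eq_bigr => x _; case: eqP => // <-; by rewrite odd_double_half.
Qed.

Lemma big_parity X (P : pred nat) (F : nat -> bool) :
  \big[addb/false]_(x <- X | P x) F x =
  \big[addb/false]_(u <- half false X | P u.*2) F u.*2 (+)
  \big[addb/false]_(u <- half true X | P u.*2.+1) F u.*2.+1.
Proof.
rewrite -(big_half false X P F) -(big_half true X P F) (bigID (fun x => odd x == false)) /=.
congr (_ (+) _); apply: eq_bigl => x; rewrite andbC //.
by case: odd.
Qed.

Lemma big_addb_and (X : seq nat) (P : pred nat) (F : nat -> bool) c :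
  \big[addb/false]_(x <- X | P x) (c && F x) = c && \big[addb/false]_(x <- X | P x) F x.
Proof. by case: c => //=; rewrite big1. Qed.

(** Induction on the weight, removing 2^(k+1)-hooks with 2^k the top digit of the total weight of
    the halves. At most one half weighs 2^k or more, so only that half contributes; if neither does,
    the sum is empty, and the weights are not disjoint by [disj_lt]. *)
Lemma par_half X : uniq X -> ~~ odd (size X) ->
  par X = [&& par (half false X), par (half true X),
              disj (wt (half false X)) (wt (half true X)) & balanced X].
Proof.
have [n] := ubnP (wt X); elim: n X => // n IH X lt_n uX even_X.
have uA b := half_uniq b uX.
have := wt_half uX even_X; set wA := wt (half false X); set wB := wt (half true X).
move=> wtX; have [N0 | N_gt0] := posnP (wA + wB).
  have [wA0 wB0] : wA = 0 /\ wB = 0 by lia.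
  rewrite wA0 wB0 disj0 (par_wt0 (uA false) wA0) (par_wt0 (uA true) wB0) /=.
  case: ifP wtX => bal; rewrite N0 double0 /= => wtX.
    have [wt0 | wt_gt0] := posnP (wt X); first by rewrite par_wt0.
    apply/(@par_hook 0) => //; first by rewrite expn0; case: (_ != _) wtX wt_gt0; lia.
    have [x Xx /andP[x_gt0 Xx']] := wt_gt0_move uX wt_gt0.
    by exists x; rewrite /movable Xx expn0 x_gt0 subn1.
  (* An unbalanced 2-core has at least 3 cells and no 2-hook, so its recursion for 2-hooks is an
     empty sum. *)
  rewrite (@par_recE 1) //; last by rewrite expn1; lia.
  rewrite big_pred0 // => x; apply/negP; rewrite expn1.
  rewrite -[x]odd_double_half -[2]/(1.*2) movable_half => /(movable_leq (uA _)).
  by case: (odd x); rewrite -/wA -/wB ?wA0 ?wB0.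
have [k /andP[le_k lt_k]] := exists_top_bit N_gt0.
have le_kX : 2 ^ k.+1 <= wt X by rewrite expnS; case: ifP wtX; lia.
rewrite (par_recE uX le_kX) big_parity.
have E : 2 ^ k.+1 = (2 ^ k).*2 by rewrite expnS mul2n.
set g := 2 ^ k in le_k lt_k E.
have g_gt0 : 0 < g by rewrite expn_gt0.
have sum_half (b : bool) :
    \big[addb/false]_(u <- half b X | movable (2 ^ k.+1) X (b + u.*2))
      par (mv X (b + u.*2) (b + u.*2 - 2 ^ k.+1)) =
    [&& g <= wt (half b X), par (half b X), par (half (~~ b) X),
       disj (wt (half b X) - g) (wt (half (~~ b) X)) & balanced X].
  pose c := [&& par (half (~~ b) X),
    disj (wt (half b X) - g) (wt (half (~~ b) X)) & balanced X].
  rewrite (eq_big (movable g (half b X)) (fun u => c && par (mv (half b X) u (u - g)))).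
  - rewrite big_addb_and /c; have [le_g | lt_g] := leqP g (wt (half b X)).
      by rewrite -par_recE // andbC.
    by rewrite big_pred0 ?andbF // => u; apply/negP=> /(movable_leq (uA b)); rewrite leqNgt lt_g.
  - by move=> u; rewrite E movable_half.
  move=> u; rewrite E movable_half => mv_u; set X' := mv X _ _.
  have mv_x : movable (2 ^ k.+1) X (b + u.*2) by rewrite E movable_half.
  have [uX' wtX'] := movable_mv uX mv_x; rewrite E -/X' in uX' wtX'.
  have def_X' : X' = mv X (b + u.*2) (b + (u - g).*2).
    by congr mv; case/and3P: mv_u => _ le_u _; lia.
  have [uY wtY] := movable_mv (uA b) mv_u.
  rewrite IH ?size_mv //; last by lia.
  have -> : balanced X' = balanced X by rewrite def_X' /balanced !size_half_mv.
  have eq_b : half b X' = mv (half b X) u (u - g) by rewrite def_X' half_mv_same.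
  have eq_nb : half (~~ b) X' = half (~~ b) X by rewrite def_X' half_mv_other.
  rewrite /c; have <- : wt (half b X') = wt (half b X) - g by rewrite eq_b; lia.
  rewrite -eq_b -eq_nb; case: (b); rewrite /= ?(disjC (wt (half true X'))).
    by rewrite [RHS]andbC andbA -!andbA; do !bool_congr.
  by rewrite [RHS]andbC; do !bool_congr.
have := sum_half false; have := sum_half true; rewrite /= -/wA -/wB => -> ->.
rewrite (disjC (wB - g)).
have [le_gA | lt_gA] := leqP g wA.
  have lt_gB : wB < g by lia.
  by rewrite (ltn_geF lt_gB) /= addbF disj_sub.
have [le_gB | lt_gB] := leqP g wB => /=.
  rewrite disjC disj_sub // 1?disjC 1?addnC //; by do !bool_congr.
suff -> : disj wA wB = false by rewrite !andbF.
by apply: contraTF le_k => /disj_lt/(_ lt_gA lt_gB); rewrite -ltnNge.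
Qed.

(** * Disjointness after adding a power of 2 *)

Section DisjointSuccessor.
Implicit Types a b k : nat.

Lemma disj_odd a b : disj a b -> odd a -> ~~ odd b.
Proof. by rewrite disj_rec => /andP[dis _] a1; rewrite a1 in dis. Qed.

Lemma half_disjD a b : disj a b -> (a + b)./2 = a./2 + b./2.
Proof. by rewrite disj_rec halfD => /andP[/negPf-> _]. Qed.

Lemma logn2_even n : ~~ odd n -> logn 2 n.+1 = 0.
Proof. by move=> even_n; rewrite lognE dvdn2 /= (negPf even_n). Qed.

Lemma logn2_odd n : odd n -> logn 2 n.+1 = (logn 2 n./2.+1).+1.
Proof.
move=> odd_n; have -> : n.+1 = 2 * n./2.+1 by have := odd_double_half n; lia.
by rewrite lognM.
Qed.

(** The valuation of a + 1 counts the trailing ones of a. Adding 1 clears them and sets the next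
    bit, which b must leave free; equivalently, a + b, the union of the bits, has no more trailing
    ones than a. *)
Lemma disj_succ a b : disj a b ->
  (disj a.+1 b = (logn 2 a.+1 == logn 2 (a + b).+1)) /\ logn 2 a.+1 <= logn 2 (a + b).+1.
Proof.
have [n] := ubnP (a + b); elim: n a b => // n IH a b lt_n dis.
have [odd_a | even_a] := boolP (odd a).
  have even_b := disj_odd dis odd_a.
  have dis2 : disj a./2 b./2 by move: dis; rewrite disj_rec => /andP[].
  have [|IH1 IH2] := IH _ _ _ dis2; first by have := odd_double_half a; lia.
  have odd_ab : odd (a + b) by rewrite oddD odd_a (negPf even_b).
  rewrite (logn2_odd odd_a) (logn2_odd odd_ab) half_disjD // eqSS ltnS -IH1; split=> //.
  by rewrite disj_rec /= odd_a /= uphalf_half odd_a.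
rewrite logn2_even //; split=> //; have [odd_b | even_b] := boolP (odd b).
  by rewrite disj_rec /= even_a odd_b logn2_odd // oddD (negPf even_a).
rewrite logn2_even ?oddD ?(negPf even_a) // disj_rec (negPf even_b) andbF /=.
by rewrite uphalf_half (negPf even_a); move: dis; rewrite disj_rec => /andP[].
Qed.

Lemma disj_addX k a b : disj a b ->
  (disj (a + 2 ^ k) b = (logn 2 (a %/ 2 ^ k).+1 == logn 2 ((a + b) %/ 2 ^ k).+1)) /\
  logn 2 (a %/ 2 ^ k).+1 <= logn 2 ((a + b) %/ 2 ^ k).+1.
Proof.
elim: k a b => [|k IH] a b dis; first by rewrite !divn1 addn1; apply: disj_succ.
have := dis; rewrite disj_rec => /andP[dis0 /IH[IH1 IH2]].
rewrite expnS !divnMA !divn2 half_disjD //; split=> //; rewrite -IH1 disj_rec.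
have -> : (a + 2 * 2 ^ k)./2 = a./2 + 2 ^ k by lia.
by rewrite oddD oddM addbF dis0.
Qed.

Lemma disj_logn0 k a b : disj a b -> 0 < logn 2 (a %/ 2 ^ k).+1 -> logn 2 (b %/ 2 ^ k).+1 = 0.
Proof.
move=> /disjP/(_ k); rewrite /bit => dis a_gt0; apply: logn2_even.
have [odd_a | even_a] := boolP (odd (a %/ 2 ^ k)); first by rewrite odd_a in dis.
by rewrite logn2_even in a_gt0.
Qed.

(** In terms of binomial coefficients: modulo 2 the power 2^k of 1 + x is 1 + x^(2^k), so the
    coefficient of a + b over a is the sum of those for (a - 2^k, b) and (a, b - 2^k), and the three
    cannot all be odd. *)
Lemma disj_sub2 k a b : 2 ^ k <= a -> 2 ^ k <= b -> disj a b ->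
  disj (a - 2 ^ k) b -> disj a (b - 2 ^ k) -> False.
Proof.
elim: k a b => [|k IH] a b; last first.
  rewrite expnS => le_a le_b; rewrite disj_rec => /andP[_ dis].
  rewrite disj_rec => /andP[_ dis1]; rewrite disj_rec => /andP[_ dis2].
  apply: (IH a./2 b./2); rewrite ?leq_half_double -?mul2n //; try lia.
    by have <- : (a - 2 * 2 ^ k)./2 = a./2 - 2 ^ k by lia.
  by have <- : (b - 2 * 2 ^ k)./2 = b./2 - 2 ^ k by lia.
rewrite expn0 !subn1; have [n] := ubnP (a + b); elim: n a b => // n IHn a b lt_n a_gt0 b_gt0.
rewrite disj_rec => /andP[dis0 dis].
rewrite disj_rec => /andP[dis10 dis1]; rewrite disj_rec => /andP[dis20 dis2].
have [even_a even_b] : ~~ odd a /\ ~~ odd b.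
  have odd_pred m : 0 < m -> odd m.-1 = ~~ odd m by case: m => //= m; rewrite negbK.
  by move: dis0 dis10 dis20; rewrite !odd_pred //; case: (odd a); case: (odd b).
have ea := odd_double_half a; have eb := odd_double_half b; rewrite (negPf even_a) in ea.
rewrite (negPf even_b) in eb.
apply: (IHn a./2 b./2) => //; try lia.
  by have <- : a.-1./2 = a./2.-1 by lia.
by have <- : b.-1./2 = b./2.-1 by lia.
Qed.

End DisjointSuccessor.

(** * Extra beads, uniqueness of the odd hook, and halving *)

Lemma fill X v : uniq X -> wt X + v < size X -> v \in X.
Proof.
elim: v X => [|v IH] X uX lt_v; first by apply: zero_mem; rewrite // -[wt X]addn0.
have X0 : 0 \in X by apply: zero_mem; lia.
pose Y := map predn (rem 0 X).
have eqX : perm_eq X (shift Y).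
  suff eqS : map S Y = rem 0 X by rewrite /shift eqS perm_to_rem.
  rewrite /Y -map_comp -[RHS]map_id; apply/eq_in_map => x /=.
  by rewrite mem_rem_uniq // inE -lt0n => /andP[/prednK].
have uY : uniq Y.
  have: uniq (shift Y) by rewrite -(perm_uniq eqX).
  by rewrite /= map_inj_uniq => [/andP[]|]; last exact: succn_inj.
rewrite (perm_mem eqX) mem_shiftS IH // -ltnS -size_shift -(perm_size eqX).
rewrite -addnS (leq_trans _ lt_v) // ltnS leq_add2r -wt_shift /wt (perm_size eqX) leq_sub2r //.
by rewrite (perm_sumn eqX).
Qed.

Lemma odd_movable_shift f X x : uniq X -> 0 < f ->
  odd_movable f (shift X) x.+1 = odd_movable f X x.
Proof.
move=> uX f_gt0; rewrite /odd_movable /movable mem_shiftS.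
have [le_fx | lt_xf] := leqP f x; last first.
  rewrite andbF /=; have [eq_f | ] := eqVneq f x.+1; last by move=> ne; rewrite leqNgt; lia.
  by rewrite eq_f subnn mem_shift eqxx !andbF.
rewrite (leqW le_fx) subSn // mem_shiftS mv_shift.
case: (boolP (x - f \in X)) => [|Xf]; first by rewrite !andbF.
by rewrite par_shift // mv_uniq.
Qed.

Lemma odd_addable_shift f X y : uniq X ->
  odd_addable f (shift X) y.+1 = odd_addable f X y.
Proof.
move=> uX; rewrite /odd_addable /addable addSn !mem_shiftS mv_shift.
case: (boolP (y + f \in X)) => [|Xf]; first by rewrite !andbF.
by rewrite par_shift // mv_uniq.
Qed.

(** The bound makes sure that the new bead 0 is not addable: position f of [shift X] is occupied by
    [fill]. *)
Lemma nadd_shift f X : uniq X -> wt X + f < size X -> 0 < f -> nadd f (shift X) = nadd f X.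
Proof.
move=> uX lt_f f_gt0; rewrite /nadd /= {1}/odd_addable /addable add0n.
have -> : f \in shift X by rewrite -(prednK f_gt0) mem_shiftS fill //; lia.
rewrite andbF add0n count_map; apply: eq_count => y; exact: odd_addable_shift.
Qed.

(** For k = 0, beads are added until [odd_movable1_inj] applies. For larger k, two moves on one
    runner are settled by induction in that half, and moves on different runners contradict
    [disj_sub2]. *)
Lemma odd_movable_inj k X x1 x2 : uniq X -> par X ->
  odd_movable (2 ^ k) X x1 -> odd_movable (2 ^ k) X x2 -> x1 = x2.
Proof.
elim: k X x1 x2 => [|k IH] X x1 x2 uX parX.
  rewrite expn0; have [n] := ubnP ((wt X).+1 - size X).
  elim: n X x1 x2 uX parX => // n IHn X x1 x2 uX parX lt_n odd1 odd2.
  have [lt_s | ge_s] := ltnP (wt X) (size X); first exact: (odd_movable1_inj uX).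
  apply: succn_inj; apply: (IHn (shift X)); rewrite ?shift_uniq ?odd_movable_shift //.
    by rewrite par_shift.
  by rewrite wt_shift size_shift; lia.
have f_gt0 : 0 < 2 ^ k.+1 by rewrite expn_gt0.
wlog even_X : X x1 x2 uX parX / ~~ odd (size X).
  move=> wlog_even odd1 odd2.
  have [odd_X | even_X] := boolP (odd (size X)); last exact: (wlog_even X).
  apply: succn_inj; apply: (wlog_even (shift X)); rewrite ?shift_uniq ?odd_movable_shift //.
    by rewrite par_shift.
  by rewrite size_shift /= odd_X.
have E : 2 ^ k.+1 = (2 ^ k).*2 by rewrite expnS mul2n.
have halves x (b := odd x) : odd_movable (2 ^ k.+1) X x ->
    odd_movable (2 ^ k) (half b X) x./2 /\ disj (wt (half b X) - 2 ^ k) (wt (half (~~ b) X)).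
  rewrite /odd_movable -{1 2 3}[x]odd_double_half -/b E movable_half.
  case/andP=> mv_u; have [uY wtY] := movable_mv (half_uniq b uX) mv_u.
  have -> : b + x./2.*2 - (2 ^ k).*2 = b + (x./2 - 2 ^ k).*2.
    by case/and3P: mv_u => _ le_u _; lia.
  have Xu : b + (x./2 - 2 ^ k).*2 \notin X by case/and3P: mv_u => _ _; rewrite mem_half.
  rewrite mv_u par_half ?size_mv ?mv_uniq // => /and4P[].
  have -> : wt (half b X) - 2 ^ k = wt (mv (half b X) x./2 (x./2 - 2 ^ k)) by lia.
  rewrite -half_mv_same -(half_mv_other b X x./2 (x./2 - 2 ^ k)).
  by case: (b) => par1 par2 dis _; rewrite ?par1 ?par2; split=> //; rewrite disjC.
move=> odd1 odd2; have [mv1 dis1] := halves _ odd1; have [mv2 dis2] := halves _ odd2.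
have := parX; rewrite par_half // => /and4P[parA parB dis _].
have parh b : par (half b X) by case: b.
have [eq_b | ne_b] := eqVneq (odd x1) (odd x2).
  rewrite -eq_b in mv2; have eq_u := IH _ _ _ (half_uniq _ uX) (parh _) mv1 mv2.
  by rewrite -[x1]odd_double_half -[x2]odd_double_half eq_b eq_u.
exfalso; have le_wt b u : odd_movable (2 ^ k) (half b X) u -> 2 ^ k <= wt (half b X).
  by case/andP=> /(movable_leq (half_uniq b uX)).
have := le_wt _ _ mv1; have := le_wt _ _ mv2.
move: ne_b dis1 dis2; case: (odd x1); case: (odd x2) => // _ /= dis1 dis2 le2 le1.
  by apply: (disj_sub2 le1 le2) => //; rewrite disjC.
by apply: (disj_sub2 le1 le2) => //; rewrite disjC.
Qed.

(** Adding a 2g-hook is adding a g-hook to one half. This preserves [balanced], so by [par_half] it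
    is odd exactly when it is odd in that half and the weights stay disjoint. *)
Lemma nadd_half k X (g := 2 ^ k) (A := half false X) (B := half true X) :
    uniq X -> ~~ odd (size X) -> par X ->
  nadd (2 ^ k.+1) X = disj (wt A + g) (wt B) * nadd g A + disj (wt B + g) (wt A) * nadd g B.
Proof.
move=> uX even_X parX; have E : 2 ^ k.+1 = g.*2 by rewrite expnS mul2n.
have := parX; rewrite par_half // => /and4P[parA parB dis bal].
have parh b : par (half b X) by case: b.
have addb (b : bool) u : odd_addable (2 ^ k.+1) X (b + u.*2) =
    disj (wt (half b X) + g) (wt (half (~~ b) X)) && odd_addable g (half b X) u.
  rewrite /odd_addable [RHS]andbCA {1}/addable E -addnA -doubleD -!mem_half.
  rewrite -/(addable g (half b X) u).
  case: (boolP (addable g _ _)) => //= add_u; have [uY wtY] := addable_mv (half_uniq b uX) add_u.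
  have Xu : b + (u + g).*2 \notin X by case/andP: add_u => _; rewrite mem_half.
  rewrite par_half ?size_mv ?mv_uniq //.
  rewrite /balanced !size_half_mv -/(balanced X) bal andbT -wtY.
  have := half_mv_same b X u (u + g); have := half_mv_other b X u (u + g).
  by case: (b) => /= -> ->; rewrite ?parA ?parB ?andbT //= 1?disjC 1?andbC.
have cnt b : count (fun x => odd_addable (2 ^ k.+1) X x && (odd x == b)) X =
    disj (wt (half b X) + g) (wt (half (~~ b) X)) * nadd g (half b X).
  rewrite /nadd count_map count_filter.
  rewrite (eq_count (a2 := fun x => disj (wt (half b X) + g) (wt (half (~~ b) X)) &&
      (odd_addable g (half b X) x./2 && (odd x == b)))) => [|x].
    by case: disj; rewrite ?mul1n // mul0n count_pred0.
  rewrite andbA; case: eqP => [<-|]; rewrite ?andbF // !andbT.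
  by rewrite -{1}[x]odd_double_half addb.
rewrite -(cnt false) -(cnt true) /nadd; elim: (X) (odd_addable _ X) => //= x Y IHY a.
by rewrite IHY; case: (a x); case: (odd x) => /=; lia.
Qed.

(** * Partitions and their beta-sets *)

Lemma geq_trans : transitive geq.
Proof. by move=> x y z /= le1 le2; apply: leq_trans le2 le1. Qed.

Lemma gtn_trans : transitive gtn.
Proof. by move=> x y z /= lt1 lt2; apply: ltn_trans lt2 lt1. Qed.

Lemma nth_filter_pos la i : sorted geq la -> nth 0 [seq x <- la | 0 < x] i = nth 0 la i.
Proof.
elim: la i => //= a la IH i s_la; case: ifP => [_|/negbT].
  by case: i => //= i; rewrite IH // (path_sorted s_la).
rewrite -leqNgt leqn0 => /eqP a0; rewrite IH ?(path_sorted s_la) //.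
have le0 j : nth 0 la j <= a := @nth_sorted_geq (a :: la) 0 j.+1 s_la isT.
case: i => [|i] /=; first by have := le0 0; lia.
by have := le0 i; have := le0 i.+1; lia.
Qed.

Lemma is_part_filter la : sorted geq la -> is_part [seq x <- la | 0 < x].
Proof.
move=> s_la; rewrite /is_part sorted_filter //; last exact: geq_trans.
by rewrite mem_filter ltnn.
Qed.

Lemma part_nth_gt0 la i : is_part la -> (0 < nth 0 la i) = (i < size la).
Proof.
case/andP=> _ la0; have [lt_i | ge_i] := ltnP i (size la); last by rewrite nth_default.
by rewrite lt0n; apply: contraNneq la0 => <-; rewrite mem_nth.
Qed.

Lemma part_ext la mu : is_part la -> is_part mu -> nth 0 la =1 nth 0 mu -> la = mu.
Proof.
move=> la_p mu_p eq_n; have eq_i i : (i < size la) = (i < size mu).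
  by rewrite -!part_nth_gt0 ?eq_n.
have eq_s : size la = size mu.
  by have := eq_i (size la); have := eq_i (size mu); rewrite !ltnn; lia.
by apply: (eq_from_nth (x0 := 0)).
Qed.

(** [beta_set] with a free number of beads; s = [even_size la] gives it back. *)
Definition betas s la : seq nat := mkseq (fun i => nth 0 la i + (s - i.+1)) s.

Lemma size_betas s la : size (betas s la) = s.
Proof. exact: size_mkseq. Qed.

Lemma nth_betas s la i : i < s -> nth 0 (betas s la) i = nth 0 la i + (s - i.+1).
Proof. exact: nth_mkseq. Qed.

Lemma mem_betasP s la v :
  reflect (exists2 i, i < s & v = nth 0 la i + (s - i.+1)) (v \in betas s la).
Proof.
apply: (iffP mapP) => [[i] | [i lt_i ->]]; last by exists i; rewrite ?mem_iota.
by rewrite mem_iota => /= lt_i ->; exists i.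
Qed.

Lemma betas_sorted s la : sorted geq la -> sorted gtn (betas s la).
Proof.
move=> s_la; apply/(sortedP 0) => i; rewrite size_betas => lt_i.
rewrite !nth_betas //; last by lia.
by rewrite /= ; have := nth_sorted_geq s_la (leqnSn i); lia.
Qed.

Lemma gtn_sorted_uniq X : sorted gtn X -> uniq X.
Proof. by apply: sorted_uniq; [exact: gtn_trans | move=> x; rewrite /= ltnn]. Qed.

Lemma gtn_sorted_geq X : sorted gtn X -> sorted geq X.
Proof. by apply: sub_sorted => x y /= /ltnW. Qed.

Lemma betas_uniq s la : sorted geq la -> uniq (betas s la).
Proof. by move/(betas_sorted s)/gtn_sorted_uniq. Qed.

Lemma sumn_betas s la : size la <= s -> sumn (betas s la) = sumn la + 'C(s, 2).
Proof.
move=> le_s; rewrite sumnE big_map big_split /=.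
rewrite -[X in iota _ X]subn0 -/(index_iota 0 s) !big_mkord; congr addn.
  rewrite sumn_nth_ord -(subnKC le_s) big_split_ord /= [X in _ + X]big1 ?addn0 // => i _.
  by rewrite nth_default // leq_addr.
rewrite -bin2_sum big_mkord (reindex_inj rev_ord_inj) /=; apply: eq_bigr => i _.
by have := ltn_ord i; lia.
Qed.

Lemma wt_betas s la : size la <= s -> wt (betas s la) = sumn la.
Proof. by move=> le_s; rewrite /wt sumn_betas // size_betas addnK. Qed.

Lemma mem_betasS s la : size la <= s -> betas s.+1 la =i shift (betas s la).
Proof.
move=> le_s v; rewrite mem_shift.
apply/mem_betasP/orP=> [[i lt_i ->] | [/eqP-> | /mem_betasP[i lt_i]]].
- have [eq_i | ne_i] := eqVneq i s; first by left; rewrite eq_i nth_default // subnn.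
  right; apply/mem_betasP; exists i; lia.
- by exists s; rewrite // nth_default // subnn.
by case: v => [|v] /= eq_v; [exists s; rewrite // nth_default // subnn | exists i; lia].
Qed.

Lemma betas_mem_inj s la mu : is_part la -> is_part mu -> size la <= s -> size mu <= s ->
  betas s la =i betas s mu -> la = mu.
Proof.
move=> la_p mu_p le_la le_mu eq_b; have := part_sorted la_p; have := part_sorted mu_p.
move=> s_mu s_la; have eq_X : betas s la = betas s mu.
  apply: (irr_sorted_eq gtn_trans) => //; first by move=> x; rewrite /= ltnn.
    exact: betas_sorted.
  exact: betas_sorted.
apply: part_ext => // i; have [lt_i | ge_i] := ltnP i s; last first.
  by rewrite !nth_default // (leq_trans _ ge_i).
by have := congr1 (fun X => nth 0 X i) eq_X; rewrite !nth_betas // => /addIn.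
Qed.

Lemma nth_gtn_sorted X i j : sorted gtn X -> i < j < size X -> nth 0 X j < nth 0 X i.
Proof.
move=> s_X /andP[lt_ij lt_j].
by apply: (sorted_ltn_nth gtn_trans 0 s_X) => //; rewrite inE // (ltn_trans lt_ij).
Qed.

Lemma geq_gtn_sorted X i : sorted gtn X -> i < size X -> size X - i.+1 <= nth 0 X i.
Proof.
move=> s_X; move: {2}(size X - i.+1) (erefl (size X - i.+1)) => m.
elim: m i => [|m IH] i eq_m lt_i; first by rewrite eq_m.
have lt_i1 : i.+1 < size X by lia.
have := IH i.+1 _ lt_i1; have := @nth_gtn_sorted X i i.+1 s_X; rewrite ltnSn lt_i1.
by move=> /(_ isT) lt1 /(_ _); lia.
Qed.

Lemma part_of_beta_presorted X : sorted gtn X ->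
  sorted geq (mkseq (fun i => nth 0 X i - (size X - i.+1)) (size X)).
Proof.
move=> s_X; apply/(sortedP 0) => i; rewrite size_mkseq => lt_i1.
have lt_i : i < size X by lia.
rewrite !nth_mkseq // /=; have := @nth_gtn_sorted X i i.+1 s_X; rewrite ltnSn lt_i1 => /(_ isT).
by have := geq_gtn_sorted s_X lt_i; have := geq_gtn_sorted s_X lt_i1; lia.
Qed.

Lemma part_of_beta_part X : sorted gtn X -> is_part (part_of_beta X).
Proof. by move=> s_X; apply/is_part_filter/part_of_beta_presorted. Qed.

Lemma size_part_of_beta X : size (part_of_beta X) <= size X.
Proof. by rewrite size_filter (leq_trans (count_size _ _)) // size_mkseq. Qed.

Lemma part_of_betaK X : sorted gtn X -> betas (size X) (part_of_beta X) = X.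
Proof.
move=> s_X; apply: (eq_from_nth (x0 := 0)); rewrite size_betas // => i lt_i.
rewrite nth_betas // nth_filter_pos ?part_of_beta_presorted // nth_mkseq //.
by rewrite subnK // geq_gtn_sorted.
Qed.

Lemma betasK s la : is_part la -> size la <= s -> part_of_beta (betas s la) = la.
Proof.
move=> la_p le_s; have s_b := betas_sorted s (part_sorted la_p).
apply: (betas_mem_inj (s := s)) => //; first exact: part_of_beta_part.
  by rewrite -[X in _ <= X](size_betas s la) size_part_of_beta.
by move=> v; rewrite -{1}(size_betas s la) part_of_betaK.
Qed.

Lemma odd_part_par s la : size la <= s -> odd_part la = is_part la && par (betas s la).
Proof.
move=> le_s; have [la_p | /negPf np] := boolP (is_part la); last by rewrite /odd_part np.
rewrite -(subnKC le_s); elim: (s - size la) => [|m IH]; last first.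
  rewrite addnS IH /=; have le_m : size la <= size la + m by apply: leq_addr.
  have s_la := part_sorted la_p.
  rewrite -par_shift ?betas_uniq //; apply: par_eq; rewrite ?betas_uniq ?shift_uniq ?betas_uniq //.
  by move=> v; rewrite mem_betasS.
rewrite addn0 odd_part_wset //= (parE (size_betas _ _)) wt_betas //.
apply: eq_bigr => w _; congr (odd #|pred_of_set _|); apply: wset_ext => // i.
by rewrite nth_betas.
Qed.

(** * Hooks as bead moves *)

Lemma mem_hooks e la i j : sorted geq la ->
  ((i, j) \in hooks e la) =
    (j < nth 0 la i) && (nth 0 la i + nth 0 (conj_part la) j == e + i + j + 1).
Proof.
move=> s_la; rewrite mem_filter andbC.
have -> : ((i, j) \in cells la) = (j < nth 0 la i).
  apply/allpairsPdep/idP=> [[i' [j' [_ + [-> ->]]]] | lt_j]; first by rewrite mem_iota.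
  exists i, j; rewrite !mem_iota; split=> //=; rewrite ltnNge.
  by apply: contraTN lt_j => le_i; rewrite nth_default.
case: (boolP (j < _)) => //= lt_j; rewrite /hook_length /arm /leg /=.
by have := lt_j; rewrite -ltn_conj_part // => lt_i; apply/eqP/eqP; lia.
Qed.

Definition hook_row la (c : nat * nat) r : nat :=
  if c.1 <= r < c.1 + leg la c then (nth 0 la r.+1).-1
  else if r == c.1 + leg la c then c.2 else nth 0 la r.

Lemma remove_hookP e la i j (c := (i, j)) : sorted geq la -> c \in hooks e la ->
  [/\ sorted geq (mkseq (hook_row la c) (size la)), is_part (remove_hook la c),
      size (remove_hook la c) <= size la &
      nth 0 (remove_hook la c) =1 hook_row la c].
Proof.
move=> s_la; rewrite mem_hooks // => /andP[lt_j _].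
have nthS r := nth_sorted_geq s_la (leqnSn r).
set t := nth 0 (conj_part la) j.
have lt_t r : (r < t) = (j < nth 0 la r) by rewrite ltn_conj_part.
have lt_it : i < t by rewrite lt_t.
have def_t : i + leg la c = t.-1 by rewrite /leg /= -/t; lia.
have def_row r : hook_row la c r =
    if i <= r < t.-1 then (nth 0 la r.+1).-1 else if r == t.-1 then j else nth 0 la r.
  by rewrite /hook_row -def_t.
have s_row : sorted geq (mkseq (hook_row la c) (size la)).
  apply/(sortedP 0) => r; rewrite size_mkseq => lt_r.
  rewrite !nth_mkseq // 1?ltnW // !def_row /=.
  have n0 := nthS r; have n1 := nthS r.+1.
  have t0 := lt_t r; have t1 := lt_t r.+1; have t2 := lt_t r.+2.
  clear -n0 n1 t0 t1 t2 lt_it.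
  by case: ifP => [?|?]; [|case: ifP => [?|?]]; (case: ifP => [?|?]; [|case: ifP => [?|?]]); lia.
have nth_row r : nth 0 (remove_hook la c) r = hook_row la c r.
  rewrite nth_filter_pos //; have [lt_r | ge_r] := ltnP r (size la).
    by rewrite nth_mkseq.
  rewrite nth_default ?size_mkseq // def_row.
  have le_t : t <= size la.
    by rewrite leqNgt lt_t nth_default.
  by rewrite !nth_default ?(leq_trans ge_r) //; case: ifP => //; case: eqP; lia.
split=> //; first exact: is_part_filter.
by rewrite size_filter (leq_trans (count_size _ _)) // size_mkseq.
Qed.

(** Column j, of length t, owns the gap j + (s - t), and the hook length is the distance from this
    gap to the bead of row i. The beads in between keep their places but belong to the row above,
    which is why [remove_hook] gives a row the next row minus one cell. *)
Lemma hook_movable e s la i j (c := (i, j)) (x := nth 0 la i + (s - i.+1)) :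
    0 < e -> sorted geq la -> size la <= s -> c \in hooks e la ->
  movable e (betas s la) x /\ betas s (remove_hook la c) =i mv (betas s la) x (x - e).
Proof.
move=> e_gt0 s_la le_s hook_c; have [_ _ _ nth_row] := remove_hookP s_la hook_c.
move: hook_c; rewrite mem_hooks // => /andP[lt_j /eqP].
set t := nth 0 (conj_part la) j => eq_e.
have lt_t r : (r < t) = (j < nth 0 la r) by rewrite ltn_conj_part.
have lt_it : i < t by rewrite lt_t.
have le_t : t <= size la by rewrite leqNgt lt_t nth_default.
have def_t : i + leg la c = t.-1 by rewrite /leg /= -/t; lia.
have def_y : x - e = j + (s - t) by rewrite /x; clear -eq_e lt_it le_t le_s; lia.
have le_x : e <= x by rewrite /x; clear -eq_e lt_it le_t le_s; lia.
have Xx : x \in betas s la by apply/mem_betasP; exists i => //; clear -lt_it le_t le_s; lia.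
have Xy : x - e \notin betas s la.
  apply/mem_betasP=> -[r lt_r]; rewrite def_y; have := lt_t r; clear -lt_r le_t le_s; lia.
split; first by rewrite /movable Xx le_x.
have row r : nth 0 (remove_hook la c) r =
    if i <= r < t.-1 then (nth 0 la r.+1).-1 else if r == t.-1 then j else nth 0 la r.
  by rewrite nth_row /hook_row -def_t.
move=> v; rewrite mem_mv //; apply/mem_betasP/orP=> [[r lt_r ->] | [/eqP-> | ]].
- rewrite row; have t1 := lt_t r.+1; case: ifP => [r_lt | r_ge].
    right; apply/andP; split.
      apply/mem_betasP; exists r.+1; clear -r_lt t1 le_t le_s; lia.
    have ti := @nth_sorted_geq la i r.+1 s_la; rewrite /x; clear -r_lt t1 le_t le_s ti; lia.
  case: ifP => [/eqP-> | ne_r]; first by left; rewrite def_y; clear -le_t le_s lt_it; lia.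
  right; apply/andP; split; first by apply/mem_betasP; exists r.
  rewrite /x; have ti := @nth_sorted_geq la i r s_la; have ti' := @nth_sorted_geq la r i s_la.
  by clear -r_ge ne_r lt_r ti ti' lt_it le_t le_s; lia.
- exists t.-1; first by clear -lt_it le_t le_s; lia.
  by rewrite row eqxx ltnn andbF def_y; clear -lt_it le_t le_s; lia.
case/andP=> /mem_betasP[r lt_r ->] ne_x.
have [lt_ri | le_ir] := ltnP r i.
  by exists r => //; rewrite row leqNgt lt_ri /=; case: eqP => //; clear -lt_ri lt_it; lia.
have ne_r : r != i by apply: contra ne_x => /eqP->.
have [lt_rt | le_tr] := ltnP r t; last first.
  by exists r => //; rewrite row; case: ifP; last case: ifP; clear -le_tr lt_it; lia.
exists r.-1; first by clear -lt_r; lia.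
have cond : i <= r.-1 < t.-1 by clear -le_ir ne_r lt_rt; lia.
have r_gt0 : 0 < r by clear -le_ir ne_r; lia.
rewrite row cond prednK //; have := lt_t r.
clear -le_ir ne_r lt_rt lt_r; lia.
Qed.

(** The column j is the number of gaps below y: with t beads above y there are s - t below it, hence
    y - (s - t) gaps. *)
Lemma movable_hook e s la x : 0 < e -> sorted geq la -> size la <= s ->
    movable e (betas s la) x ->
  exists i j, (i, j) \in hooks e la /\ x = nth 0 la i + (s - i.+1).
Proof.
move=> e_gt0 s_la le_s /and3P[/mem_betasP[i lt_i def_x] le_x Xy].
set y := x - e in Xy; set X := betas s la in Xy.
have s_X : sorted gtn X := betas_sorted s s_la.
pose t := count (fun b => y < b) X.
have lt_t r : (r < t) = (y < nth 0 X r) by rewrite ltn_count_sorted // gtn_sorted_geq.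
have le_ts : t <= s by rewrite -(size_betas s la) count_size.
have ge_y r : t <= r -> r < s -> nth 0 X r < y.
  move=> le_tr lt_r; rewrite ltn_neqAle leqNgt -lt_t -leqNgt le_tr andbT.
  by apply: contraNneq Xy => <-; rewrite mem_nth // size_betas.
have le_sy : s - t <= y.
  have [lt_ts | ge_ts] := ltnP t s; last by clear -ge_ts; lia.
  have := ge_y t (leqnn t) lt_ts; rewrite nth_betas //; clear -lt_ts; lia.
pose j := y - (s - t).
have lt_j r : (j < nth 0 la r) = (r < t).
  have [lt_rs | ge_rs] := ltnP r s; last first.
    by rewrite nth_default ?(leq_trans le_s) // ltn0 ltnNge (leq_trans le_ts).
  have [lt_rt | le_tr] := ltnP r t.
    have := lt_t t.-1; rewrite nth_betas; last by clear -lt_rt le_ts; lia.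
    have := @nth_sorted_geq la r t.-1 s_la.
    by rewrite /j; clear -lt_rt le_sy lt_rs le_ts; lia.
  have lt_ts := leq_ltn_trans le_tr lt_rs; have := nth_sorted_geq s_la le_tr.
  have := ge_y t (leqnn t) lt_ts; rewrite nth_betas // /j; clear -le_tr le_sy lt_ts le_ts; lia.
have conj_j : nth 0 (conj_part la) j = t.
  apply/eqP; rewrite eqn_leq [_ <= t]leqNgt [t <= _]leqNgt.
  by rewrite ltn_conj_part // lt_j ltnn -lt_j -ltn_conj_part // ltnn.
have lt_it : i < t by rewrite lt_t nth_betas // -def_x /y; clear -le_x e_gt0; lia.
exists i, j; split=> //; rewrite mem_hooks // lt_j lt_it conj_j /=.
by move: le_sy; rewrite /j /y def_x; clear -lt_it le_ts le_x def_x; lia.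
Qed.

(** A hook removal keeps the runner counts and lowers the size, so no hook is left after [sumn la]
    steps, and a set of beads without hooks is pushed down. *)
Lemma is_core_core e s la : 0 < e -> is_part la -> size la <= s ->
  is_part (core e la) /\ size (core e la) <= s /\
  is_core e (betas s la) (betas s (core e la)).
Proof.
move=> e_gt0 la_p le_s; rewrite /core.
have step mu : is_part mu -> size mu <= s ->
    [/\ is_part (remove_first_hook e mu), size (remove_first_hook e mu) <= s,
       (forall r, size (runner e r (betas s (remove_first_hook e mu))) =
                  size (runner e r (betas s mu))) &
       hooks e mu = [::] \/ sumn (remove_first_hook e mu) < sumn mu].
  move=> mu_p le_mu; rewrite /remove_first_hook; case def_h: (hooks e mu) => [|[i j] h].
    by split=> //; left.
  have s_mu := part_sorted mu_p.
  have hook_c : (i, j) \in hooks e mu by rewrite def_h mem_head.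
  have [_ p' le' _] := remove_hookP s_mu hook_c.
  have [mv_x eq_b] := hook_movable e_gt0 s_mu le_mu hook_c.
  have [uY wtY] := movable_mv (betas_uniq s s_mu) mv_x.
  set x := _ + _ in mv_x eq_b uY wtY.
  have perm_b : perm_eq (betas s (remove_hook mu (i, j))) (mv (betas s mu) x (x - e)).
    by apply: uniq_perm => //; apply: betas_uniq; apply: part_sorted.
  split=> //; [exact: leq_trans le' le_mu | move=> r | right].
    rewrite -(@size_runner_mv e r (betas s mu) x (x - e)).
      by rewrite !size_filter; apply/seq.permP.
    by case/and3P: mv_x => _ le_x _; rewrite -{1}(subnK le_x) modnDr.
  rewrite -(wt_betas le_mu) -(wt_betas (leq_trans le' le_mu)) -wtY.
  by rewrite /wt (perm_size perm_b) (perm_sumn perm_b) -[X in X < _]addn0 ltn_add2l.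
have iter_step m : [/\ is_part (iter m (remove_first_hook e) la),
    size (iter m (remove_first_hook e) la) <= s,
    (forall r, size (runner e r (betas s (iter m (remove_first_hook e) la))) =
               size (runner e r (betas s la))) &
    hooks e (iter m (remove_first_hook e) la) = [::] \/
    sumn (iter m (remove_first_hook e) la) + m <= sumn la].
  elim: m => [|m [p_m le_m cnt_m done_m]]; first by split=> //; right; rewrite addn0.
  have [p' le' cnt' done'] := step _ p_m le_m; split=> //= [r|].
    by rewrite cnt' cnt_m.
  case: done_m => [done_m | lt_m].
    by left; rewrite /remove_first_hook done_m.
  case: done' => [done' | lt']; last by right; lia.
  by left; rewrite /remove_first_hook done'.
have [p_n le_n cnt_n done_n] := iter_step (sumn la).
set nu := iter _ _ _ in p_n le_n cnt_n done_n *; split=> //; split=> //.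
have u_nu : uniq (betas s nu) by apply/betas_uniq/part_sorted.
split=> //; first by rewrite !size_betas.
have no_hooks : hooks e nu = [::].
  case: done_n => // le0; have nu0 : sumn nu = 0 by lia.
  case def_h: (hooks e nu) => [|[i j] h] //.
  have hook_c : (i, j) \in hooks e nu by rewrite def_h mem_head.
  have [mv_x _] := hook_movable e_gt0 (part_sorted p_n) le_n hook_c.
  have := movable_leq u_nu mv_x; rewrite wt_betas // nu0; lia.
move=> x Xx le_x; apply: contraT => Xx'.
have mv_x : movable e (betas s nu) x by apply/and3P.
have [i [j [hook_c _]]] := movable_hook e_gt0 (part_sorted p_n) le_n mv_x.
by rewrite no_hooks in hook_c.
Qed.

Lemma is_hook_part_hookset s la : is_part la -> size la <= s ->
  is_hook_part la = hookset (betas s la).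
Proof.
move=> la_p le_s; have s_la := part_sorted la_p.
have -> : is_hook_part la = (nth 0 la 1 <= 1).
  have pos i : i < size la -> 0 < nth 0 la i by move=> lt_i; rewrite part_nth_gt0.
  rewrite /is_hook_part -nth_behead nth0; apply/allP/idP=> [all1 | le1 x].
    by case: (behead la) all1 => //= a l /(_ a (mem_head _ _))/eqP->.
  case/(nthP 0) => i; rewrite size_behead nth_behead => lt_i <-.
  have lt_i1 : i.+1 < size la by rewrite -ltn_predRL.
  rewrite /= eqn_leq pos // andbT (leq_trans (nth_sorted_geq s_la (ltn0Sn i))) //.
  by rewrite -nth_behead nth0.
rewrite /hookset size_betas; have [s_le1 | s_gt1] := leqP s 1.
  rewrite nth_default ?(leq_trans le_s) //; apply/esym.
  by rewrite (leq_trans (count_size _ _)) ?size_betas.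
rewrite leqNgt [RHS]leqNgt; congr (~~ _).
case: s s_gt1 {le_s} => // s s_gt1; have s_b := betas_sorted s.+1 s_la.
have -> : count (leq s.+1) (betas s.+1 la) = count (fun r => s < r) (betas s.+1 la) by [].
rewrite ltn_count_sorted ?gtn_sorted_geq // nth_betas //; lia.
Qed.

(** * The 2-quotient tower *)

Lemma half_sorted (b : bool) X : sorted gtn X -> sorted gtn (half b X).
Proof.
move=> s_X; rewrite /half sorted_map.
have s_F : sorted gtn [seq x <- X | odd x == b] by apply: sorted_filter s_X; exact: gtn_trans.
apply: (sub_in_sorted (P := fun x => odd x == b) (e := gtn) _ _ s_F) => [x y|].
  rewrite !unfold_in => /eqP odd_x /eqP odd_y /= lt_yx.
  by have := odd_double_half x; have := odd_double_half y; rewrite odd_x odd_y; lia.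
by apply/allP=> x; rewrite mem_filter => /andP[].
Qed.

Lemma gtn_sorted_eq X Y : sorted gtn X -> sorted gtn Y -> X =i Y -> X = Y.
Proof. by apply: (irr_sorted_eq gtn_trans) => x; rewrite /= ltnn. Qed.

Lemma part_of_beta_shift X Y : sorted gtn X -> sorted gtn Y -> Y =i shift X ->
  part_of_beta Y = part_of_beta X.
Proof.
move=> s_X s_Y eqY; set p := part_of_beta X.
have p_p : is_part p by apply: part_of_beta_part.
have le_p : size p <= size X by apply: size_part_of_beta.
suff -> : Y = betas (size X).+1 p by rewrite betasK // ltnW.
apply: gtn_sorted_eq => //; first exact/betas_sorted/part_sorted.
by move=> v; rewrite mem_betasS // part_of_betaK.
Qed.

(** Two more beads keep the runners apart and add one bead to each half, so the quotient is the same
    for every even s that is large enough. *)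
Lemma quotient2_betas (b : bool) s la (X := half b (betas s la)) :
    is_part la -> size la <= s -> ~~ odd s ->
  [/\ is_part (quotient2 b la), size (quotient2 b la) <= size X &
      betas (size X) (quotient2 b la) = X].
Proof.
move=> la_p le_s even_s; rewrite {}/X.
have s_h m : sorted gtn (half b (betas m la)) by apply/half_sorted/betas_sorted/part_sorted.
suff -> : quotient2 b la = part_of_beta (half b (betas s la)).
  by rewrite part_of_beta_part ?size_part_of_beta ?part_of_betaK.
have [m ->] : exists m, s = even_size la + m.*2.
  exists (s - even_size la)./2; have := odd_double_half (s - even_size la).
  have le_e : even_size la <= s.
    rewrite /even_size; have [odd_l | _] := boolP (odd (size la)); last by rewrite addn0.
    by rewrite addn1 ltn_neqAle le_s andbT; apply: contraNneq even_s => <-.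
  have -> : odd (s - even_size la) = false.
    by rewrite oddB // (negPf even_s) /even_size oddD oddb addbb.
  by lia.
elim: m => [|m IH]; first by rewrite addn0.
have le_m : size la <= even_size la + m.*2 by rewrite /even_size; lia.
rewrite doubleS !addnS IH; apply/esym/part_of_beta_shift => // v.
rewrite mem_half mem_betasS ?(leqW le_m) // mem_shift mem_shift mem_betasS // mem_half.
by case: b {IH s_h}; case: v => [|v] //=; rewrite mem_shift.
Qed.

Lemma quotient_odd la (p := quotient2 false la) (q := quotient2 true la) :
    odd_part la ->
  [/\ odd_part p, odd_part q, disj (sumn p) (sumn q) & (sumn la)./2 = sumn p + sumn q].
Proof.
move=> odd_la; have la_p : is_part la by case/andP: odd_la.
set s := even_size la.
have le_s : size la <= s by apply: leq_addr.
have even_s : ~~ odd s by rewrite oddD oddb addbb.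
have uX : uniq (betas s la) by apply/betas_uniq/part_sorted.
have even_X : ~~ odd (size (betas s la)) by rewrite size_betas.
have := odd_la; rewrite (odd_part_par le_s) la_p par_half //= => /and4P[parA parB dis bal].
have [p_p le_p def_p] := quotient2_betas false la_p le_s even_s.
have [q_p le_q def_q] := quotient2_betas true la_p le_s even_s.
have wt_p : wt (half false (betas s la)) = sumn p by rewrite -def_p wt_betas.
have wt_q : wt (half true (betas s la)) = sumn q by rewrite -def_q wt_betas.
rewrite wt_p wt_q in dis.
rewrite (odd_part_par le_p) p_p def_p (odd_part_par le_q) q_p def_q; split=> //.
have := wt_half uX even_X; rewrite bal wt_p wt_q wt_betas // => ->.
by rewrite addnC half_bit_double.
Qed.

(** [quotient_row] grows at the leaves, whereas induction on k has to split the tower at its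
    root. *)
Lemma quotient_rowS k la :
  quotient_row k.+1 la =
    quotient_row k (quotient2 false la) ++ quotient_row k (quotient2 true la).
Proof.
elim: k => //= k IH.
by rewrite IH map_cat flatten_cat.
Qed.

(** By [disj_addX] the valuation cannot increase on the way down; hence no d-good partition lies
    below a half whose valuation is less than d. *)
Lemma quotient_row_logn k la nu : odd_part la -> nu \in quotient_row k la ->
  logn 2 (sumn nu).+1 <= logn 2 (sumn la %/ 2 ^ k).+1.
Proof.
elim: k la => [|k IH] la odd_la; first by rewrite inE divn1 => /eqP->.
have [odd_p odd_q dis eq_n] := quotient_odd odd_la.
rewrite quotient_rowS mem_cat expnS divnMA divn2 eq_n => /orP[/(IH _ odd_p)|/(IH _ odd_q)] le.
  by apply: (leq_trans le); case: (disj_addX k dis).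
by apply: (leq_trans le); rewrite addnC; rewrite disjC in dis; case: (disj_addX k dis).
Qed.

Lemma modn_logn2 d m : (m == 2 ^ d - 1 %[mod 2 ^ d.+1]) = (logn 2 m.+1 == d).
Proof.
have d_gt0 : 0 < 2 ^ d by rewrite expn_gt0.
apply/eqP/eqP=> [eq_m | <-].
  have -> : m.+1 = 2 ^ d * (2 * (m %/ 2 ^ d.+1)).+1.
    rewrite {1}(divn_eq m (2 ^ d.+1)) eq_m modn_small; last by rewrite expnS; lia.
    by rewrite expnS mulnS; lia.
  by rewrite lognM // pfactorK // logn2_even ?addn0 // mul2n odd_double.
have [o co_o eq_o] := pfactor_coprime (p := 2) (n := m.+1) isT isT.
set e := logn 2 m.+1 in eq_o *; have e_gt0 : 0 < 2 ^ e by rewrite expn_gt0.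
have odd_o : odd o by rewrite -coprime2n.
have -> : m = o./2 * 2 ^ e.+1 + (2 ^ e - 1).
  have def_o := odd_double_half o; rewrite odd_o in def_o.
  apply: succn_inj; rewrite eq_o -{1}def_o mulnDl mul1n expnS; lia.
by rewrite modnMDl.
Qed.

(** By [disj_addX], a half takes part in [nadd_half] exactly when its own valuation is d, so the
    induction hypothesis is used with the same d. The constant 2 is the fixed point of the bound
    under halving, where s <= 2 [size A] + 2; at k = 0 the bound leaves more beads than cells. *)
Lemma nadd_main k la s : odd_part la -> sumn la + 2 ^ k * 4 <= s + 2 ->
  let d := logn 2 (sumn la %/ 2 ^ k).+1 in
  nadd (2 ^ k) (betas s la) =
    if d == 0 then 2 ^ k else if has (good d) (quotient_row k la) then 2 else 0.
Proof.
elim: k la s => [|k IH] la s odd_la.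
  rewrite expn0 divn1 /= => le_s; set d := logn 2 _.
  have la_p : is_part la by case/andP: odd_la.
  have le_la : size la <= s.
    by rewrite (leq_trans (size_part_leq _)) //; [case/andP: la_p | lia].
  have [core_p [le_core coreP]] := is_core_core (expn_gt0 2 d) la_p le_la.
  have par_la : par (betas s la) by move: odd_la; rewrite (odd_part_par le_la) => /andP[].
  have uX := betas_uniq s (part_sorted la_p).
  rewrite (nadd_one uX _ par_la _ coreP) ?wt_betas ?size_betas //; last 2 first.
  - lia.
  - by apply/eqP; rewrite modn_logn2.
  by rewrite /good odd_la modn_logn2 eqxx orbF /= -is_hook_part_hookset.
move=> le_s d.
have la_p : is_part la by case/andP: odd_la.
have k_gt0 : 0 < 2 ^ k by rewrite expn_gt0.
have le_la : size la <= s.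
  rewrite (leq_trans (size_part_leq _)) //; first by case/andP: la_p.
  by rewrite expnS in le_s; clear -le_s k_gt0; lia.
wlog even_s : s le_s le_la / ~~ odd s.
  move=> wlog_even; have [odd_s | even_s] := boolP (odd s); last exact: wlog_even.
  have uX := betas_uniq s (part_sorted la_p).
  rewrite -(nadd_shift (X := betas s la)) //; first last.
  - by rewrite expn_gt0.
  - by rewrite wt_betas // size_betas; rewrite expnS in le_s *; clear -le_s k_gt0; lia.
  rewrite -(wlog_even s.+1) //=; [|lia|lia|by rewrite odd_s].
  have permX : perm_eq (shift (betas s la)) (betas s.+1 la).
    apply: uniq_perm => [||v]; [exact: shift_uniq | exact/betas_uniq/part_sorted |].
    by rewrite mem_betasS.
  rewrite /nadd (seq.permP permX); apply: eq_count => y.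
  rewrite /odd_addable /addable !(perm_mem permX); congr (_ && _).
  by apply: par_perm; apply: perm_map.
have uX : uniq (betas s la) by apply/betas_uniq/part_sorted.
have even_X : ~~ odd (size (betas s la)) by rewrite size_betas.
have par_la : par (betas s la) by move: odd_la; rewrite (odd_part_par le_la) => /andP[].
have [odd_p odd_q dis eq_n] := quotient_odd odd_la.
set p := quotient2 false la in odd_p dis eq_n; set q := quotient2 true la in odd_q dis eq_n.
have [p_p le_p def_p] := quotient2_betas false la_p le_la even_s.
have [q_p le_q def_q] := quotient2_betas true la_p le_la even_s.
rewrite -/p in p_p le_p def_p; rewrite -/q in q_p le_q def_q.
set A := half false (betas s la) in le_p def_p; set B := half true (betas s la) in le_q def_q.
have wt_A : wt A = sumn p by rewrite -def_p wt_betas.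
have wt_B : wt B = sumn q by rewrite -def_q wt_betas.
rewrite nadd_half // -/A -/B wt_A wt_B.
have [sz_A sz_B] : s <= (size A).*2 + 2 /\ s <= (size B).*2 + 2.
  have := par_la; rewrite par_half // => /and4P[_ _ _ /orP bal].
  have := size_half (betas s la); rewrite size_betas -/A -/B.
  by move: bal; rewrite -/A -/B; case=> /eqP; lia.
have le_n : (sumn p + sumn q).*2 <= sumn la.
  by rewrite -eq_n -{2}(odd_double_half (sumn la)) leq_addl.
have IHA := IH p (size A) odd_p; have IHB := IH q (size B) odd_q.
rewrite def_p in IHA; rewrite def_q in IHB.
have le_s' : sumn la + 2 ^ k * 8 <= s + 2 by rewrite expnS in le_s; clear -le_s; lia.
rewrite {}IHA; last by clear -le_s' sz_A le_n; lia.
rewrite {}IHB; last by clear -le_s' sz_B le_n; lia.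
have def_d : d = logn 2 ((sumn p + sumn q) %/ 2 ^ k).+1.
  by rewrite /d expnS divnMA divn2 eq_n.
have [dis1 le1] := disj_addX k dis; rewrite -def_d in dis1 le1.
have [dis2 le2] := disj_addX k (etrans (disjC _ _) dis).
rewrite (addnC (sumn q) (sumn p)) -def_d in dis2 le2.
have no_p := disj_logn0 (k := k) dis; have no_q := disj_logn0 (k := k) (etrans (disjC _ _) dis).
rewrite dis1 dis2 quotient_rowS has_cat -/p -/q.
have no_good r : odd_part r -> logn 2 (sumn r %/ 2 ^ k).+1 < d ->
    has (good d) (quotient_row k r) = false.
  move=> odd_r lt_d; apply/hasP=> -[nu row_nu /and3P[_]].
  rewrite modn_logn2 => /eqP eq_d _.
  by have := quotient_row_logn odd_r row_nu; rewrite eq_d leqNgt lt_d.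
move: no_p no_q le1 le2 no_good.
set dp := logn 2 (sumn p %/ _).+1; set dq := logn 2 (sumn q %/ _).+1 => no_p no_q le1 le2 no_good.
(* For d = 0 both halves count, with 2^k each. For d > 0 [disj_logn0] lets at most one half have
   valuation d, and the other contains no d-good partition. *)
have [d0 | d_gt0] := posnP d.
  have [-> ->] : dp = 0 /\ dq = 0 by rewrite d0 in le1 le2; clear -le1 le2; lia.
  by rewrite d0 /= !mul1n expnS mul2n addnn.
have [eq_p | ne_p] := eqVneq dp d.
  have dq0 : dq = 0 by apply: no_p; rewrite -/dp eq_p.
  rewrite dq0 eq_p (gtn_eqF d_gt0) [0 == d]eq_sym (gtn_eqF d_gt0) mul0n addn0 mul1n.
  by rewrite (no_good q) // ?orbF // -/dq dq0.
have [eq_q | ne_q] := eqVneq dq d.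
  rewrite eq_q (gtn_eqF d_gt0) mul0n add0n mul1n (no_good p) //.
  by rewrite -/dp ltn_neqAle ne_p.
by rewrite !mul0n (no_good p) ?(no_good q) // -/dp -/dq ltn_neqAle ?ne_p ?ne_q.
Qed.

(** * Fibres of fk as odd additions *)

Lemma fkP k s mu la : odd_part mu -> 2 ^ k <= sumn mu -> size mu <= s ->
    is_part la -> size la <= s ->
  fk k mu = la <-> exists x, odd_movable (2 ^ k) (betas s mu) x /\
                             mv (betas s mu) x (x - 2 ^ k) =i betas s la.
Proof.
move=> odd_mu le_k le_mu la_p le_la.
have mu_p : is_part mu by case/andP: odd_mu.
have s_mu := part_sorted mu_p; have f_gt0 : 0 < 2 ^ k by rewrite expn_gt0.
have uX := betas_uniq s s_mu.
have par_mu : par (betas s mu) by move: odd_mu; rewrite (odd_part_par le_mu) => /andP[].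
have hookP c : c \in hooks (2 ^ k) mu -> odd_part (remove_hook mu c) = true ->
    exists x, [/\ odd_movable (2 ^ k) (betas s mu) x, is_part (remove_hook mu c),
      size (remove_hook mu c) <= s &
      betas s (remove_hook mu c) =i mv (betas s mu) x (x - 2 ^ k)].
  case: c => i j hook_c odd_c; have [_ p_c le_c _] := remove_hookP s_mu hook_c.
  have [mv_x eq_b] := hook_movable f_gt0 s_mu le_mu hook_c.
  have [uY _] := movable_mv uX mv_x; have le_cs := leq_trans le_c le_mu.
  exists (nth 0 mu i + (s - i.+1)); split=> //; rewrite /odd_movable mv_x /=.
  rewrite -(par_eq _ uY eq_b); last exact/betas_uniq/part_sorted.
  by move: odd_c; rewrite (odd_part_par le_cs) => /andP[].
rewrite /fk; set F := [seq nu <- _ | odd_part nu].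
(* An odd degree needs an odd term in the recursion, so [head] does not fall back on its default;
   [odd_movable_inj] then makes the choice of the head irrelevant. *)
have [c [hook_c odd_c]] : exists c, c \in hooks (2 ^ k) mu /\ odd_part (remove_hook mu c).
  have := par_mu; rewrite (@par_recE k _ uX) ?wt_betas //.
  case: (boolP (has (odd_movable (2 ^ k) (betas s mu)) (betas s mu))) => [|/hasPn no_x].
    case/hasP=> x _ /andP[mv_x par_x] _.
    have [i [j [hook_c def_x]]] := movable_hook f_gt0 s_mu le_mu mv_x.
    exists (i, j); split=> //; have [_ p_c le_c _] := remove_hookP s_mu hook_c.
    have [_ eq_b] := hook_movable f_gt0 s_mu le_mu hook_c; rewrite -def_x in eq_b.
    rewrite (odd_part_par (leq_trans le_c le_mu)) p_c.
    rewrite (par_eq _ _ eq_b) //; first exact/betas_uniq/part_sorted.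
    by case: (movable_mv uX mv_x).
  rewrite big1_seq // => x /andP[mv_x Xx]; apply/negbTE.
  by have := no_x x Xx; rewrite /odd_movable mv_x.
have [nu [def_hd F_nu]] : exists nu, head [::] F = nu /\ nu \in F.
  have : remove_hook mu c \in F by rewrite mem_filter odd_c map_f.
  by case: (F) => // a l _; exists a; rewrite mem_head.
move: F_nu; rewrite {}def_hd mem_filter => /andP[odd_nu /mapP[c' hook_c' def_nu]].
rewrite {c hook_c odd_c}def_nu in odd_nu *.
have [x [odd_x p_nu le_nu eq_b]] := hookP _ hook_c' odd_nu.
split=> [<- | [x' [odd_x' eq_b']]]; first by exists x; split=> // v; rewrite eq_b.
apply: (betas_mem_inj (s := s)) => // v.
by rewrite eq_b (odd_movable_inj uX par_mu odd_x odd_x') eq_b'.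
Qed.

Lemma sort_geq_gtn X : uniq X -> sorted gtn (sort geq X).
Proof.
by move=> uX; rewrite gtn_sorted_uniq_geq sort_uniq uX sort_sorted // => x y; apply: leq_total.
Qed.

Lemma e_countE n k la s : is_part_of (n - 2 ^ k) la -> odd_part la -> 2 ^ k <= n -> n <= s ->
  e_count n k la = nadd (2 ^ k) (betas s la).
Proof.
case/andP=> la_p /eqP sum_la odd_la le_kn le_ns; set X := betas s la.
have f_gt0 : 0 < 2 ^ k by rewrite expn_gt0.
have size_le mu : is_part mu -> sumn mu <= n -> size mu <= s.
  by case/andP=> _ /size_part_leq le1 le2; apply: leq_trans le_ns; apply: leq_trans le2.
have le_la : size la <= s by apply: size_le => //; lia.
have uX : uniq X by apply/betas_uniq/part_sorted.
have wtX : wt X = n - 2 ^ k by rewrite wt_betas.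
pose L := [seq y <- X | odd_addable (2 ^ k) X y].
(* The raised bead may pass others, and [part_of_beta] reads decreasing sequences only. *)
pose g y := part_of_beta (sort geq (mv X y (y + 2 ^ k))).
have gP y : odd_addable (2 ^ k) X y ->
    [/\ is_part (g y), sumn (g y) = n, odd_part (g y) &
        betas s (g y) =i mv X y (y + 2 ^ k)].
  case/andP=> add_y par_y; have [uZ wtZ] := addable_mv uX add_y.
  have s_Z := sort_geq_gtn uZ; set Z := sort _ _ in s_Z.
  have perm_Z : perm_eq Z (mv X y (y + 2 ^ k)) by rewrite perm_sort.
  have size_Z : size Z = s by rewrite (perm_size perm_Z) size_mv size_betas.
  have p_g : is_part (g y) by apply: part_of_beta_part.
  have le_g : size (g y) <= s by rewrite -[X in _ <= X]size_Z size_part_of_beta.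
  have def_g : betas s (g y) = Z by rewrite -{1}size_Z part_of_betaK.
  split=> //.
  - rewrite -(wt_betas le_g) def_g -[RHS](subnK le_kn) -wtX -wtZ.
    by rewrite /wt (perm_size perm_Z) (perm_sumn perm_Z).
  - by rewrite (odd_part_par le_g) p_g def_g (par_perm perm_Z).
  by move=> v; rewrite def_g (perm_mem perm_Z).
rewrite /e_count /nadd -size_filter -/L; set S := [set mu | _].
rewrite cardE -(size_map (@part_val n)) -(size_map g L); apply/perm_size/uniq_perm.
- by rewrite map_inj_uniq ?enum_uniq //; exact: val_inj.
- rewrite map_inj_in_uniq ?filter_uniq // => y1 y2; rewrite !mem_filter.
  case/andP=> odd1 X1 /andP[odd2 X2] eq_g.
  have [_ _ _ eq1] := gP _ odd1; have [_ _ _ eq2] := gP _ odd2.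
  have := eq1 y1; rewrite eq_g eq2 !mem_mv // X1 eqxx andbF orbF /=.
  have -> : (y1 == y1 + 2 ^ k) = false by clear -f_gt0; lia.
  by move/negbT; rewrite negb_or negbK => /andP[_ /eqP].
move=> nu; apply/mapP/mapP=> [[mu] | [y]].
  rewrite mem_enum inE => /andP[odd_mu /eqP fk_mu] ->.
  have /andP[mu_p /eqP sum_mu] := part_valP mu.
  have le_mu : size mu <= s by apply: size_le; rewrite // sum_mu.
  have [|x [odd_x eq_x]] := (fkP odd_mu _ le_mu la_p le_la).1 fk_mu; first by rewrite sum_mu.
  have /andP[mv_x par_x] := odd_x; have uM := betas_uniq s (part_sorted mu_p).
  have [add_x eq_M] := movable_addable uM mv_x.
  have permX : perm_eq X (mv (betas s mu) x (x - 2 ^ k)).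
    have [uM' _] := movable_mv uM mv_x.
    by apply: uniq_perm => // v; rewrite eq_x.
  have add_X : addable (2 ^ k) X (x - 2 ^ k).
    by move: add_x; rewrite /addable !(perm_mem permX).
  have eq_MX : mv X (x - 2 ^ k) (x - 2 ^ k + 2 ^ k) =i betas s mu.
    move=> v; rewrite -eq_M; apply: perm_mem; exact: perm_map.
  have [uZ _] := addable_mv uX add_X.
  have odd_X : odd_addable (2 ^ k) X (x - 2 ^ k).
    rewrite /odd_addable add_X (par_eq uZ uM eq_MX).
    by move: odd_mu; rewrite (odd_part_par le_mu) => /andP[].
  exists (x - 2 ^ k); first by rewrite mem_filter odd_X; case/andP: add_X.
  have [p_g sum_g _ eq_g] := gP _ odd_X.
  apply: (betas_mem_inj (s := s)) => //; first by apply: size_le; rewrite ?sum_g.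
  by move=> v; rewrite eq_g eq_MX.
rewrite mem_filter => /andP[odd_y Xy] ->; have [p_g sum_g odd_g eq_g] := gP _ odd_y.
have g_n : is_part_of n (g y) by rewrite /is_part_of p_g sum_g eqxx.
exists (IntPart g_n) => //; rewrite mem_enum inE /= odd_g /=; apply/eqP.
have le_g : size (g y) <= s by apply: size_le; rewrite ?sum_g.
apply/(@fkP k s) => //; first by rewrite sum_g.
exists (y + 2 ^ k); rewrite addnK.
have /andP[add_y par_y] := odd_y; have [uZ _] := addable_mv uX add_y.
have Xy' : y + 2 ^ k \notin X by case/andP: add_y.
have ug := betas_uniq s (part_sorted p_g).
have perm_g : perm_eq (betas s (g y)) (mv X y (y + 2 ^ k)) by apply: uniq_perm.
have Zy : y + 2 ^ k \in mv X y (y + 2 ^ k) by rewrite mem_mv // eqxx.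
have eq_X : mv (betas s (g y)) (y + 2 ^ k) y =i X.
  by move=> v; rewrite mem_mv ?eq_g // -mem_mvK.
have gy' : y \notin betas s (g y).
  rewrite eq_g mem_mv // eqxx andbF orbF; clear -f_gt0; lia.
have mv_y : movable (2 ^ k) (betas s (g y)) (y + 2 ^ k).
  by rewrite /movable addnK gy' leq_addl eq_g Zy.
split=> //; rewrite /odd_movable mv_y addnK (par_eq (mv_uniq _ ug gy') uX eq_X).
by move: odd_la; rewrite (odd_part_par le_la) => /andP[].
Qed.

Theorem corollary3p8 (n k : nat) (hn : 1 <= n) (hk : 2 ^ k < n)
    (la : seq nat) (hla : is_part_of (n - 2 ^ k) la) (hodd : odd_part la) :
  let d := logn 2 (n %/ 2 ^ k) in
  e_count n k la =
    if d == 0 then 2 ^ k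
    else if has (good d) (quotient_row k la) then 2
    else 0.
Proof.
have sum_la : sumn la = n - 2 ^ k by case/andP: hla => _ /eqP.
have def_n : n %/ 2 ^ k = (sumn la %/ 2 ^ k).+1.
  by rewrite sum_la -{1}(subnK (ltnW hk)) divnDr // divnn expn_gt0 addn1.
(* The count is taken with n + 4 * 2^k beads, enough for the bound of [nadd_main]. *)
rewrite (e_countE hla hodd (ltnW hk) (leq_addr (2 ^ k * 4) n)) def_n /=.
by apply: nadd_main; rewrite // sum_la -addnA leq_add ?leq_subr ?leq_addr.
Qed.
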